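(* Let $0<Q<n$, let $E\subset\mathbb{R}^n$ be a compact Ahlfors $Q$-regular set with $\operatorname{diam}(E)\le 1$, let $B\subset\mathbb{R}^n$ be a ball with $E\subset\tfrac12 B$, and let $\nu=\mathcal{H}^Q|_E$. Let $p>1$ and $0<\theta<1$, and let $\alpha\le 0$ be such that $\alpha+n-Q>0$ and $\theta\ge 1-\tfrac{\alpha+n-Q}{p}$. Let $\mu_\alpha$ be a measure on $\mathbb{R}^n$, absolutely continuous with respect to Lebesgue measure and doubling on $B$, with $\mu_\alpha(B(x,r))\simeq r^{n+\alpha}$ for all $x\in E$ and $0<r\le 10$. Then there is a bounded linear extension operator \[ S:B^\theta_{p,p}(E,\nu)\to N^{1,p}(B,\mu_\alpha) \] such that if $u$ is a Lipschitz function on $E$, then $Su$ is a Lipschitz function on $B$ with $u=Su|_E$.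
   Context: Notation: $m$ is Lebesgue measure on $\mathbb{R}^n$, $d$ the Euclidean metric, $\mathcal{H}^Q$ the $Q$-dimensional Hausdorff measure, $\tau B$ the ball concentric with $B$ with radius $\tau$ times as large. $F\simeq G$ means $C^{-1}G\le F\le CG$ with a constant $C\ge1$ independent of the points and radii involved. $E$ is Ahlfors $Q$-regular if $\mathcal{H}^Q(E\cap B(x,r))\simeq r^Q$ for all $x\in E$ and $0<r\le\operatorname{diam}(E)$. The measure $\mu_\alpha$ is a Borel regular measure of the form $d\mu_\alpha=\omega\,dm$ with $\omega\ge 0$ locally integrable. Doubling on $B$: there is $C\ge1$ with $\mu_\alpha(B(x,2r))\le C\mu_\alpha(B(x,r))$ for all $x\in B$, $0<r\le 10$ (balls being taken in the space $B$ with the Euclidean metric, i.e. intersected with $B$). Weighted Sobolev space: $N^{1,p}(B,\mu_\alpha)=W^{1,p}(B,\mu_\alpha)$ consists of the functions $f\in L^p(B,\mu_\alpha)$ having a weak derivative $\nabla f:B\to\mathbb{R}^n$ with $|\nabla f|\in L^p(B,\mu_\alpha)$, with norm $\|f\|_{N^{1,p}(B,\mu_\alpha)}=\|f\|_{L^p(B,\mu_\alpha)}+\||\nabla f|\|_{L^p(B,\mu_\alpha)}$. Besov space: $B^\theta_{p,p}(E,\nu)$ consists of the $u\in L^p(E,\nu)$ with \[ \|u\|_{B^\theta_{p,p}(E,\nu)}^p=\int_E\int_E\frac{|u(y)-u(x)|^p}{d(x,y)^{\theta p}\,\nu(B(x,d(x,y)))}\,d\nu(y)\,d\nu(x)<\infty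 . \] Boundedness of $S$ is with respect to $\|u\|_{L^p(E,\nu)}+\|u\|_{B^\theta_{p,p}(E,\nu)}$ on the source.
   Formalization: The formal theorem also assumes diam(E) > 0: a one-point E satisfies the Ahlfors condition vacuously, has ν = 0, and admits no such S with Su = u on E; the empty set is excluded as well. *)

(* Defs.v *)
From HB Require Import structures.
From mathcomp Require Import all_boot all_order all_algebra.
From mathcomp Require Import all_classical all_reals all_analysis.

Set Implicit Arguments.
Unset Strict Implicit.
Unset Printing Implicit Defensive.

Import Order.TTheory GRing.Theory Num.Theory.
Import numFieldNormedType.Exports.

Local Open Scope classical_set_scope.
Local Open Scope ring_scope.

(* R^n is 'rV[R]_n.  Its library topology is the Euclidean one, but the library
   [ball] (and, in positive dimension, norm) is the one of the sup norm, so the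
   Euclidean metric notions are defined here. *)
Section euclidean.
Context {R : realType} {n : nat}.
Implicit Types (x y v : 'rV[R]_n) (A : set 'rV[R]_n) (r : R).

Definition eunorm v : R := Num.sqrt (\sum_(i < n) v 0 i ^+ 2).

Definition eudist x y : R := eunorm (x - y).

Definition eball x r : set 'rV[R]_n := [set y | eudist x y < r].

(* -oo for the empty set *)
Definition diam A : \bar R :=
  ereal_sup [set z | exists x y, [/\ A x, A y & z = (eudist x y)%:E]].

Definition lipschitz_fun A (f : 'rV[R]_n -> R) : Prop :=
  exists L : R, forall x y, A x -> A y -> `|f x - f y| <= L * eudist x y.

End euclidean.

Section countable_covers.
Context {R : realType} {T : pointedType}.
Local Open Scope ereal_scope.
Implicit Type tau : set T -> \bar R.

Definition cover_measure tau (A : set T) : \bar R :=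
  ereal_inf [set \sum_(k <oo) tau (F k) |
    F in [set F : (set T)^nat | A `<=` \bigcup_k F k]].

Let D := g_sigma_algebraType [set: set T].

Let cover_measureE tau : cover_measure tau = @mu_ext _ D R tau.
Proof.
apply/funext => A; congr ereal_inf; apply/seteqP; split=> _ [F AF <-];
  exists F => //; last by case: AF.
by split=> // i; exact: sub_sigma_algebra.
Qed.

Section properties.
Variable tau : set T -> \bar R.
Hypotheses (tau0 : tau set0 = 0) (tau_ge0 : forall A, 0 <= tau A).

Lemma cover_measure0 : cover_measure tau set0 = 0.
Proof. by rewrite cover_measureE; exact: (@mu_ext0 _ D R tau). Qed.

Lemma cover_measure_ge0 A : 0 <= cover_measure tau A.
Proof. by rewrite cover_measureE; exact: (@mu_ext_ge0 _ D R tau). Qed.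

Lemma le_cover_measure : {homo cover_measure tau : A B / A `<=` B >-> A <= B}.
Proof. by rewrite cover_measureE; exact: (@le_mu_ext _ D R tau). Qed.

Lemma cover_measure_sigma_subadditive : sigma_subadditive (cover_measure tau).
Proof. by rewrite cover_measureE; exact: (@mu_ext_sigma_subadditive _ D R tau). Qed.

End properties.
End countable_covers.

Section lebesgue.
Context (R : realType) (n : nat).
Local Open Scope ereal_scope.

(* The volume of a closed box; +oo on sets that are neither empty nor a box.
   A nonempty box determines its corners, so the infimum is over at most one
   value. *)
Definition box_volume (U : set 'rV[R]_n) : \bar R :=
  if U == set0 then 0 else
  ereal_inf [set v | exists a b : 'rV[R]_n,
    [/\ forall i, (a 0%R i <= b 0%R i)%R,
        U = [set x | forall i, (a 0%R i <= x 0%R i <= b 0%R i)%R] &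
        v = (\prod_(i < n) (b 0 i - a 0 i))%R%:E]].

Definition lebesgue_outer : set 'rV[R]_n -> \bar R := cover_measure box_volume.

Let box_volume0 : box_volume set0 = 0.
Proof. by rewrite /box_volume eqxx. Qed.

Let box_volume_ge0 U : 0 <= box_volume U.
Proof.
rewrite /box_volume; case: ifP => // _; apply: le_ereal_inf_tmp.
move=> _ [a [b [ab _ ->]]]; rewrite lee_fin; apply: prodr_ge0 => i _.
by rewrite subr_ge0.
Qed.

HB.instance Definition _ := isOuterMeasure.Build R 'rV[R]_n lebesgue_outer
  (cover_measure0 box_volume0 box_volume_ge0)
  (cover_measure_ge0 box_volume_ge0)
  (@le_cover_measure _ _ box_volume)
  (cover_measure_sigma_subadditive box_volume_ge0).

End lebesgue.

Arguments lebesgue_outer : clear implicits.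

(* An outer measure as a measure on its Caratheodory sigma-algebra *)
Definition cara_measure {R : realType} {T : pointedType}
    (nu : {outer_measure set T -> \bar R}) :
    {measure set (caratheodory_type nu) -> \bar R} :=
  [the measure (caratheodory_type nu) R of
    (nu : set (caratheodory_type nu) -> \bar R)].

(* R^n with the sigma-algebra of Lebesgue measurable sets *)
Notation lebesgue_space R n := (caratheodory_type (lebesgue_outer R n)).

Definition lebesgue_measure_rV (R : realType) (n : nat) :
    {measure set (lebesgue_space R n) -> \bar R} :=
  cara_measure (lebesgue_outer R n).

Section hausdorff.
Context (R : realType) (n : nat).
Local Open Scope ereal_scope.
Implicit Types (s delta : R).

Definition hausdorff_gauge s delta (U : set 'rV[R]_n) : \bar R :=
  if U == set0 then 0 else if diam U <= delta%:E then diam U `^ s else +oo.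

(* Without normalizing constant *)
Definition hausdorff s (A : set 'rV[R]_n) : \bar R :=
  ereal_sup [set cover_measure (hausdorff_gauge s delta) A |
    delta in [set delta | (0 < delta)%R]].

Let gauge0 s delta : hausdorff_gauge s delta set0 = 0.
Proof. by rewrite /hausdorff_gauge eqxx. Qed.

Let gauge_ge0 s delta U : 0 <= hausdorff_gauge s delta U.
Proof.
by rewrite /hausdorff_gauge; do 2 case: ifP => // _; exact: poweR_ge0.
Qed.

Let hausdorff0 s : hausdorff s set0 = 0.
Proof.
rewrite /hausdorff (_ : [set _ | _ in _] = [set 0]) ?ereal_sup1//.
apply/seteqP; split=> [_ [d _ <-]|_ ->]; first exact: cover_measure0.
by exists 1%R => //=; exact: cover_measure0.
Qed.

Let cover_le_hausdorff s delta A : (0 < delta)%R ->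
  cover_measure (hausdorff_gauge s delta) A <= hausdorff s A.
Proof. by move=> d0; apply: ereal_sup_ubound; exists delta. Qed.

Let hausdorff_ge0 s A : 0 <= hausdorff s A.
Proof.
apply: (le_trans _ (@cover_le_hausdorff s 1%R A ltr01)).
exact: cover_measure_ge0.
Qed.

Let le_hausdorff s : {homo hausdorff s : A B / A `<=` B >-> A <= B}.
Proof.
move=> A B AB; apply: ge_ereal_sup => _ [d d0 <-].
by apply: (le_trans _ (@cover_le_hausdorff s d B d0)); exact: le_cover_measure.
Qed.

Let hausdorff_sigma_subadditive s : sigma_subadditive (hausdorff s).
Proof.
move=> F; apply: ge_ereal_sup => _ [d d0 <-].
apply: (le_trans (cover_measure_sigma_subadditive (gauge_ge0 s d) F)).
apply: lee_nneseries => i _ *; first exact: cover_measure_ge0.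
exact: cover_le_hausdorff.
Qed.

HB.instance Definition _ s := isOuterMeasure.Build R 'rV[R]_n (hausdorff s)
  (hausdorff0 s) (hausdorff_ge0 s) (@le_hausdorff s)
  (@hausdorff_sigma_subadditive s).

(* The restriction of the s-dimensional Hausdorff measure to E *)
Definition hausdorff_on s (E A : set 'rV[R]_n) : \bar R :=
  hausdorff s (A `&` E).

Let hausdorff_on0 s E : hausdorff_on s E set0 = 0.
Proof. by rewrite /hausdorff_on set0I. Qed.

Let hausdorff_on_ge0 s E A : 0 <= hausdorff_on s E A.
Proof. exact: hausdorff_ge0. Qed.

Let le_hausdorff_on s E : {homo hausdorff_on s E : A B / A `<=` B >-> A <= B}.
Proof. by move=> A B AB; apply: le_hausdorff; exact: setSI. Qed.

Let hausdorff_on_sigma_subadditive s E : sigma_subadditive (hausdorff_on s E).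
Proof.
move=> F; rewrite /hausdorff_on setI_bigcupl.
exact: hausdorff_sigma_subadditive.
Qed.

HB.instance Definition _ s E := isOuterMeasure.Build R 'rV[R]_n
  (hausdorff_on s E) (hausdorff_on0 s E) (hausdorff_on_ge0 s E)
  (@le_hausdorff_on s E) (@hausdorff_on_sigma_subadditive s E).

Definition ahlfors_regular s (E : set 'rV[R]_n) : Prop :=
  exists2 C : R, (1 <= C)%R & forall x r, E x -> (0 < r)%R -> r%:E <= diam E ->
    (C^-1 * r `^ s)%R%:E <= hausdorff s (E `&` eball x r) <= (C * r `^ s)%R%:E.

End hausdorff.

Section Lp.
Context d {T : measurableType d} {R : realType}.
Implicit Types (mu : {measure set T -> \bar R}) (p : R) (D : set T) (f : T -> R).

Definition Lp_on mu p D f : Prop := f \_ D \in Lfun mu p%:E.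

Definition Lp_norm mu p D f : \bar R := 'N[mu]_(p%:E)[EFin \o (f \_ D)].

End Lp.

Section weights.
Context {R : realType} {n : nat}.
Local Open Scope ereal_scope.
Local Notation m := (lebesgue_measure_rV R n).
Implicit Types (mu : {measure set (lebesgue_space R n) -> \bar R}).
Implicit Types (B E : set 'rV[R]_n) (D : set (lebesgue_space R n)).
Implicit Types (f w : lebesgue_space R n -> R).

Definition loc_integrable D f : Prop := measurable_fun D f /\
  forall K : set 'rV[R]_n, compact K -> K `<=` D ->
    \int[m]_(x in K) `|f x|%:E < +oo.

Definition has_density mu w : Prop :=
  [/\ forall x, (0 <= w x)%R, loc_integrable setT w &
      forall A, measurable A -> mu A = \int[m]_(x in A) (w x)%:E].

Definition doubling_on B mu : Prop :=
  exists2 C : R, (1 <= C)%R & forall x r, B x -> (0 < r <= 10)%R ->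
    mu (eball x (2 * r) `&` B) <= C%:E * mu (eball x r `&` B).

Definition ball_growth E mu (s : R) : Prop :=
  exists2 C : R, (1 <= C)%R & forall x r, E x -> (0 < r <= 10)%R ->
    (C^-1 * r `^ s)%R%:E <= mu (eball x r) <= (C * r `^ s)%R%:E.

End weights.

Section sobolev.
Context {R : realType} {n : nat}.
Local Notation m := (lebesgue_measure_rV R n).
Implicit Types (mu : {measure set (lebesgue_space R n) -> \bar R}) (p : R).
Implicit Types (D : set 'rV[R]_n) (f phi : 'rV[R]_n -> R).
Implicit Types (g : 'rV[R]_n -> 'rV[R]_n).

Definition along f (x : 'rV[R]_n) (i : 'I_n) : R -> R :=
  fun t => f (x + t *: delta_mx 0 i).

Definition partial (i : 'I_n) f : 'rV[R]_n -> R :=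
  fun x => derive1 (along f x i) 0.

Fixpoint of_class_C (k : nat) f : Prop :=
  continuous f /\
  if k is k'.+1 then
    forall i, (forall x, derivable (along f x i) 0 1) /\
              of_class_C k' (partial i f)
  else True.

Definition test_function D phi : Prop :=
  (forall k, of_class_C k phi) /\
  exists K : set 'rV[R]_n,
    [/\ compact K, K `<=` D & forall x, ~ K x -> phi x = 0].

Definition is_weak_gradient D f g : Prop :=
  loc_integrable D f /\
  forall i, loc_integrable D (fun x => g x 0 i) /\
    forall phi, test_function D phi ->
      (\int[m]_(x in D) (f x * partial i phi x)%:E =
       - \int[m]_(x in D) (g x 0 i * phi x)%:E)%E.

(* A choice of the weak gradient, which is unique up to Lebesgue-null sets;
   the zero function if there is none. *)
Definition weak_gradient D f : 'rV[R]_n -> 'rV[R]_n :=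
  xget (fun=> 0) [set g | is_weak_gradient D f g].

Definition sobolev mu p D f : Prop :=
  [/\ Lp_on mu p D f, exists g, is_weak_gradient D f g &
      Lp_on mu p D (eunorm \o weak_gradient D f)].

Definition sobolev_norm mu p D f : \bar R :=
  (Lp_norm mu p D f + Lp_norm mu p D (eunorm \o weak_gradient D f))%E.

End sobolev.

Section besov.
Context {R : realType} {n : nat}.
Local Open Scope ereal_scope.
Variable nu : {outer_measure set 'rV[R]_n -> \bar R}.
Local Notation nu' := (cara_measure nu).
Implicit Types (E : set 'rV[R]_n) (theta p : R) (u : 'rV[R]_n -> R).

(* The integrand vanishes on the diagonal, since 0 / 0 = 0 in R and
   0 * +oo = 0 in \bar R. *)
Definition besov_energy theta p E u : \bar R :=
  \int[nu']_(x in E) \int[nu']_(y in E)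
    ((`|u y - u x| `^ p / eudist x y `^ (theta * p))%R%:E
     * (nu (eball x (eudist x y)))^-1).

Definition besov theta p E u : Prop :=
  Lp_on nu' p E u /\ besov_energy theta p E u < +oo.

Definition besov_norm theta p E u : \bar R :=
  besov_energy theta p E u `^ p^-1.

(* The full norm of the Besov space *)
Definition Lp_besov_norm theta p E u : \bar R :=
  Lp_norm nu' p E u + besov_norm theta p E u.

End besov.

(* Main.v *)
Require Import Defs.
From mathcomp Require finmap.
From HB Require Import structures.
From mathcomp Require Import all_boot all_order all_algebra.
From mathcomp Require Import all_classical all_reals all_analysis.
From mathcomp Require Import measurable_realfun ring lra.
Import Order.TTheory GRing.Theory Num.Theory.
Import numFieldNormedType.Exports.
Local Open Scope classical_set_scope.
Local Open Scope ring_scope.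

Set Implicit Arguments.
Unset Strict Implicit.
Unset Printing Implicit Defensive.

(* Let [rho = sqrt (|x - y|^2 + eps^2)] and let [v_eps x] be the average of [u]
   over [E] with weights proportional to [rho ^- (2 m)], [m] large; [S u] is
   [v_0] off [E] and [u] on [E].  Since 2 m > Q, Ahlfors regularity bounds the
   normalized weight of [y] by a multiple of [rho ^- Q].  As the derivatives of
   the weights have mean zero, that of [v_eps] is an average of
   [u y - v_eps x].  Jensen's inequality therefore gives, uniformly in [eps],
     |v_eps x|^p <= C int |u y|^p |x - y|^-Q,
     |D v_eps x|^p <= C int int |u y - u z|^p max(|x - y|, |x - z|)^-(p + 2 Q).
   Integrating in [x] against a measure whose balls centred on [E] have mass at
   most [r ^ (n + alpha)], and using Tonelli's theorem and
   [max(|x - y|, |x - z|) >= |y - z| / 2], the right-hand sides are bounded by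
   the L^p norm and by the Besov energy; this applies to [mu] and, because
   [alpha <= 0], to Lebesgue measure.  For [eps > 0] the function [v_eps] is
   smooth, so that letting [eps] tend to 0 shows that the pointwise gradient of
   [v_0] off the null set [E] is the weak gradient of [S u].  If [u] is
   [L]-Lipschitz, the same averages show [|D v_eps| <= C L] near [E] and
   [|v_eps - u| <= C L eps] on [E]. *)

(** * Euclidean metric *)

(** Weak gradients are tested against Lebesgue measure, while the norms are taken with respect to
    [mu], whose density may vanish: finiteness for [mu] alone would not give local Lebesgue
    integrability, which is why the potentials are estimated for both measures. The condition on
    [theta] enters through one comparison of exponents. Integrated against a measure of growth
    [N = n + alpha], the weight [max(|x - y|, |x - z|)^-(p + 2 Q)] is controlled by
    [|y - z|^-(theta p + Q)] on bounded sets as soon as [p + 2 Q <= theta p + Q + N]. A power kernel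
    replaces a Whitney partition of unity and makes the operator one explicit linear formula; the
    price is that distant points keep some weight. The requirement [2 m >= 2 Q + p] pays for this:
    the decay of one weight absorbs both the singularity of the other and the factor [1 / rho] lost
    by differentiation. Across [E] the function [v_0] is not smooth, so integration by parts is
    carried out only for [eps > 0], where [v_eps] is bounded and differentiable on all of [R^n]. *)

Section euclidean_metric.
Context {R : realType} {n : nat}.
Implicit Types (x y z v w h : 'rV[R]_n) (r : R).

Definition dotp v w : R := \sum_(i < n) v 0 i * w 0 i.

Lemma dotpC v w : dotp v w = dotp w v.
Proof. by apply: eq_bigr => i _; rewrite mulrC. Qed.

Lemma dotpDl v v' w : dotp (v + v') w = dotp v w + dotp v' w.
Proof. by rewrite -big_split; apply: eq_bigr => i _; rewrite mxE mulrDl. Qed.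

Lemma dotpZl (a : R) v w : dotp (a *: v) w = a * dotp v w.
Proof. by rewrite /dotp mulr_sumr; apply: eq_bigr => i _; rewrite mxE mulrA. Qed.

Lemma dotpvv_ge0 v : 0 <= dotp v v.
Proof. by apply: sumr_ge0 => i _; rewrite -expr2 sqr_ge0. Qed.

Lemma sqr_eunorm v : eunorm v ^+ 2 = dotp v v.
Proof.
rewrite /eunorm sqr_sqrtr; last by apply: sumr_ge0 => i _; rewrite sqr_ge0.
by apply: eq_bigr => i _; rewrite expr2.
Qed.

Lemma eunorm_ge0 v : 0 <= eunorm v. Proof. exact: sqrtr_ge0. Qed.

Lemma coord_le_eunorm v i : `|v 0 i| <= eunorm v.
Proof.
rewrite -(@ler_sqr _ `|_| _) ?nnegrE ?eunorm_ge0 ?normr_ge0// sqr_eunorm.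
rewrite /dotp (bigD1 i)//= real_normK ?num_real// -expr2 lerDl.
by apply: sumr_ge0 => j _; rewrite -expr2 sqr_ge0.
Qed.

Lemma eunorm_eq0 v : eunorm v = 0 -> v = 0.
Proof.
move=> v0; apply/rowP => i; rewrite mxE; apply/eqP; rewrite -normr_le0 -v0.
exact: coord_le_eunorm.
Qed.

Lemma eunorm0 : eunorm (0 : 'rV[R]_n) = 0.
Proof.
by rewrite /eunorm big1 ?sqrtr0// => i _; rewrite mxE expr0n.
Qed.

Lemma dotp_le v w : `|dotp v w| <= eunorm v * eunorm w.
Proof.
have [w0|w0] := eqVneq (eunorm w) 0.
  rewrite w0 mulr0 /dotp big1 ?normr0// => i _.
  by rewrite (eunorm_eq0 w0) mxE mulr0.
have w_gt0 : 0 < dotp w w by rewrite -sqr_eunorm exprn_gt0// lt_def w0 eunorm_ge0.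
rewrite -(@ler_sqr _ `|_| _) ?nnegrE ?mulr_ge0 ?eunorm_ge0 ?normr_ge0//.
rewrite real_normK ?num_real// exprMn !sqr_eunorm.
have := dotpvv_ge0 (dotp w w *: v - dotp v w *: w).
rewrite -!scaleNr dotpDl !dotpZl.
rewrite ![dotp _ (_ + _)]dotpC !dotpDl !dotpZl (dotpC w v).
set a := dotp v v; set b := dotp w w; set c := dotp v w => H.
have {}H : 0 <= b * (a * b - c ^+ 2) by rewrite (le_trans H)//; lra.
by rewrite pmulr_rge0// subr_ge0 in H.
Qed.

Lemma eunormD v w : eunorm (v + w) <= eunorm v + eunorm w.
Proof.
rewrite -(@ler_sqr _ (eunorm (v + w))) ?nnegrE ?addr_ge0 ?eunorm_ge0//.
rewrite sqr_eunorm sqrrD !sqr_eunorm dotpDl ![dotp _ (_ + _)]dotpC !dotpDl.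
rewrite (dotpC w v); have := ler_norm (dotp v w); have := dotp_le v w; lra.
Qed.

Lemma eunormZ (a : R) v : eunorm (a *: v) = `|a| * eunorm v.
Proof.
apply/eqP; rewrite -(@eqrXn2 _ 2) ?mulr_ge0 ?eunorm_ge0//.
rewrite exprMn !sqr_eunorm dotpZl dotpC dotpZl mulrA.
by rewrite real_normK ?num_real// expr2.
Qed.

Lemma eunormN v : eunorm (- v) = eunorm v.
Proof. by rewrite -scaleN1r eunormZ normrN1 mul1r. Qed.

Lemma eunorm_le_sum v : eunorm v <= \sum_(i < n) `|v 0 i|.
Proof.
rewrite -(@ler_sqr _ (eunorm v)) ?nnegrE ?sumr_ge0 ?eunorm_ge0// sqr_eunorm.
rewrite expr2 big_distrl/=; apply: ler_sum => i _.
rewrite -expr2 -real_normK ?num_real// expr2 ler_wpM2l//.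
by rewrite (bigD1 i)//= lerDl sumr_ge0.
Qed.

Lemma eunorm_delta i : eunorm (delta_mx 0 i : 'rV[R]_n) = 1.
Proof.
rewrite /eunorm (bigD1 i)//= big1 ?mxE ?eqxx ?expr1n ?addr0 ?sqrtr1//.
by move=> j ji; rewrite mxE eqxx (negPf ji) expr0n.
Qed.

Lemma eunorm_le v r : 0 <= r -> (forall i, `|v 0 i| <= r) -> eunorm v <= n%:R * r.
Proof.
move=> r0 vr; apply: (le_trans (eunorm_le_sum v)).
rewrite (@le_trans _ _ (\sum_(i < n) r)) ?ler_sum//.
by rewrite sumr_const card_ord mulr_natl.
Qed.

Lemma eudist_ge0 x y : 0 <= eudist x y. Proof. exact: eunorm_ge0. Qed.

Lemma eudistC x y : eudist x y = eudist y x.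
Proof. by rewrite /eudist -eunormN opprB. Qed.

Lemma eudistxx x : eudist x x = 0.
Proof. by rewrite /eudist subrr eunorm0. Qed.

Lemma eudist_triangle y x z : eudist x z <= eudist x y + eudist y z.
Proof.
by rewrite /eudist (_ : x - z = (x - y) + (y - z)) ?eunormD// addrA subrK.
Qed.

Lemma coord_le_eudist x y i : `|x 0 i - y 0 i| <= eudist x y.
Proof. by have := coord_le_eunorm (x - y) i; rewrite !mxE. Qed.

Lemma eudist_eq0 x y : eudist x y = 0 -> x = y.
Proof. by move=> /eunorm_eq0/eqP; rewrite subr_eq0 => /eqP. Qed.

End euclidean_metric.

(** * Open sets and boxes in the Euclidean topology *)

Section euclidean_topology.
Context {R : realType} {n : nat}.
Implicit Types (x y a b : 'rV[R]_n) (r : R) (U : set 'rV[R]_n).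

Lemma open_eballP U : open U <-> forall x, U x -> exists2 r, 0 < r & eball x r `<=` U.
Proof.
split=> [oU x Ux|H].
  have /nbhs_ballP[r /= r0 rU] : nbhs x U by exact: open_nbhs_nbhs.
  exists r => // y yr; apply: rU; split => // i j.
  rewrite /ball/= (ord1 i); exact: le_lt_trans (coord_le_eudist _ _ _) yr.
rewrite openE => x /H[r r0 rU]; apply/nbhs_ballP.
(* Dividing by [n.+1] instead of [n] covers dimension 0 and makes the final inequality strict. *)
have n1 : (0 : R) < n.+1%:R by rewrite ltr0n.
exists (r / n.+1%:R) => /=; first by rewrite divr_gt0.
move=> y [_ xy]; apply: rU; rewrite /eball/=.
apply: (@le_lt_trans _ _ (n%:R * (r / n.+1%:R))).
  apply: eunorm_le => [|i]; first by rewrite ltW// divr_gt0.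
  by rewrite !mxE ltW//; exact: xy.
by rewrite mulrCA gtr_pMr// ltr_pdivrMr// mul1r ltr_nat.
Qed.

Lemma eball_open x r : open (eball x r).
Proof.
apply/open_eballP => y xy; exists (r - eudist x y); first by rewrite subr_gt0.
move=> z yz; apply: (le_lt_trans (eudist_triangle y _ _)).
by rewrite addrC -ltrBrDr.
Qed.

Definition obox a b : set 'rV[R]_n := [set x | forall i, a 0 i < x 0 i < b 0 i].
Definition cbox a b : set 'rV[R]_n := [set x | forall i, a 0 i <= x 0 i <= b 0 i].

Lemma obox_sub_cbox a b : obox a b `<=` cbox a b.
Proof. by move=> x h i; have /andP[/ltW-> /ltW->] := h i. Qed.

Lemma oboxI a b a' b' : obox a b `&` obox a' b' =
  obox (\row_i Num.max (a 0 i) (a' 0 i)) (\row_i Num.min (b 0 i) (b' 0 i)).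
Proof.
apply/seteqP; split=> [x [h h'] i|x h].
  by rewrite !mxE gt_max lt_min; case/andP: (h i) => -> ->; case/andP: (h' i) => -> ->.
by split=> i; have := h i; rewrite !mxE gt_max lt_min => /andP[/andP[h1 h2] /andP[h3 h4]]; exact/andP.
Qed.

Lemma cbox_compact a b : compact (cbox a b).
Proof.
have := @rV_compact R^o n (fun i => [set t | a 0 i <= t <= b 0 i]).
apply => i; have := @segment_compact R (a 0 i) (b 0 i).
by congr compact; apply/seteqP; split => t /=; rewrite in_itv.
Qed.

Lemma cbox_closed a b : closed (cbox a b).
Proof. by apply: compact_closed; [exact: norm_hausdorff|exact: cbox_compact]. Qed.

(** Rational corners make the family countable. The closed boxes are kept inside [U] because local
    integrability and test functions speak of compact subsets of [U]. *)
Lemma open_bigcup_obox U : open U -> exists (P : set nat) (a b : ('rV[R]_n)^nat),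
  (forall k, P k -> cbox (a k) (b k) `<=` U) /\
  U = \bigcup_(k in P) obox (a k) (b k).
Proof.
move=> /open_eballP oU.
pose rq (q : 'rV[rat]_n) : 'rV[R]_n := map_mx ratr q.
(* Integers that code no pair receive the default [(0, 0)]; this is harmless, since only indices
   whose closed box lies in [U] are kept. *)
pose D k : 'rV[rat]_n * 'rV[rat]_n := odflt (0, 0) (unpickle k).
pose a k := rq (D k).1; pose b k := rq (D k).2.
exists [set k | cbox (a k) (b k) `<=` U], a, b; split => //.
apply/seteqP; split=> [x Ux|x [k /= kU] /obox_sub_cbox/kU//].
have [r r0 rU] := oU _ Ux; pose d := r / n.+1%:R.
have d0 : 0 < d by rewrite divr_gt0// ltr0n.
have qa i : exists q : rat, x 0 i - d < ratr q < x 0 i.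
  have [|q] := @rat_in_itvoo R (x 0 i - d) (x 0 i); first by rewrite gtrBl.
  by rewrite in_itv/=; exists q.
have qb i : exists q : rat, x 0 i < ratr q < x 0 i + d.
  have [|q] := @rat_in_itvoo R (x 0 i) (x 0 i + d); first by rewrite ltrDl.
  by rewrite in_itv/=; exists q.
pose u : 'rV[rat]_n := \row_i projT1 (cid (qa i)).
pose v : 'rV[rat]_n := \row_i projT1 (cid (qb i)).
have uP i : x 0 i - d < rq u 0 i < x 0 i by rewrite !mxE; case: cid.
have vP i : x 0 i < rq v 0 i < x 0 i + d by rewrite !mxE; case: cid.
have Duv : D (pickle (u, v)) = (u, v) by rewrite /D pickleK.
exists (pickle (u, v)); rewrite /= /a /b Duv/=; last first.
  by move=> i; case/andP: (uP i) => _ ->; case/andP: (vP i) => ->.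
move=> y yuv; apply: rU; rewrite /eball/=.
apply: (@le_lt_trans _ _ (n%:R * d)).
  apply: eunorm_le => [|i]; first exact: ltW.
  rewrite !mxE ler_norml; have := uP i; have := vP i; have := yuv i; lra.
by rewrite /d mulrCA gtr_pMr// ltr_pdivrMr ?ltr0n// mul1r ltr_nat.
Qed.

(** This places the closed boxes, which define the outer measure, in the sigma-algebra generated by
    the open boxes, which are stable under intersection. *)
Lemma cbox_bigcap_obox a b : cbox a b =
  \bigcap_k obox (a - const_mx k.+1%:R^-1) (b + const_mx k.+1%:R^-1).
Proof.
apply/seteqP; split=> x h.
  move=> k _ i; rewrite !mxE; have := h i.
  have : (0 : R) < k.+1%:R^-1 by rewrite invr_gt0.
  move=> e0 /andP[h1 h2]; apply/andP; split.
    by rewrite (lt_le_trans _ h1)// ltrBlDr ltrDl.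
  by rewrite (le_lt_trans h2)// ltrDl.
move=> i; apply/andP; split; apply/ler_addgt0Pr => e e0.
  have [k /= ke] : exists k, k.+1%:R^-1 < e.
    by have [k _ ke] := near_infty_natSinv_lt (PosNum e0); exists k; exact: ke (leqnn k).
  have := h k I i; rewrite !mxE => /andP[+ _]; rewrite ltrBlDr.
  by move=> /ltW/le_trans; apply; rewrite lerD2l ltW.
have [k /= ke] : exists k, k.+1%:R^-1 < e.
  by have [k _ ke] := near_infty_natSinv_lt (PosNum e0); exists k; exact: ke (leqnn k).
have := h k I i; rewrite !mxE => /andP[_ +].
by move=> /ltW/le_trans; apply; rewrite lerD2l ltW.
Qed.

End euclidean_topology.

(** * Caratheodory measurability *)

Section caratheodory_criterion.
Context {R : realType} {T : Type}.
Local Open Scope ereal_scope.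

(* Additivity is only assumed across a gap; the slabs of [X] between two
   consecutive levels increasing to [c] have summable measures, so that the tail
   of the series accounts for the missing part. *)
Lemma gap_additive_caratheodory (mu : {outer_measure set T -> \bar R}) (f : T -> R) :
  (forall (s t : R) X, (s < t)%R ->
     mu (X `&` [set x | (f x <= s)%R]) + mu (X `&` [set x | (t <= f x)%R]) <= mu X) ->
  forall c : R, mu.-caratheodory [set x | (f x < c)%R].
Proof.
move=> gap c; apply: le_caratheodory_measurable => X.
have [Xoo|] := eqVneq (mu X) +oo; first by rewrite Xoo leey.
rewrite -ltey => Xoo.
pose t j : R := (c - j.+1%:R^-1)%R.
have tS j : (t j < t j.+1)%R.
  by rewrite /t ltrD2l ltrN2 ltf_pV2 ?posrE ?ltr0n// ltr_nat.
have tc j : (t j < c)%R by rewrite /t gtrBl invr_gt0 ltr0n.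
pose Xj j := X `&` [set x | (f x <= t j)%R].
pose Rj j := X `&` [set x | (t j < f x <= t j.+1)%R].
have XR j : mu (Xj j) + mu (Rj j.+1) <= mu (Xj j.+2).
  apply: le_trans (gap _ _ _ (tS j)); apply: leeD; apply: le_outer_measure => x.
    move=> [Xx /= xj]; split=> //; split => //=.
    by rewrite (le_trans xj)// ltW// (lt_trans (tS _)).
  by move=> [Xx /= /andP[xj xj']]; split; [split|exact: ltW].
have XX j : mu (Xj j) <= mu X by apply: le_outer_measure; exact: subIsetl.
(* Each use of [XR] skips one level, so the telescoping leaves two terms; the whole series is at
   most twice [mu X]. *)
have sumR N : \sum_(0 <= j < N) mu (Rj j.+1) <= mu (Xj N.+1) + mu (Xj N).
  elim: N => [|N IH]; first by rewrite big_geq// adde_ge0// outer_measure_ge0.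
  rewrite big_nat_recr//=; apply: (le_trans (leeD2r _ IH)).
  by rewrite -addeA addeC leeD2r.
have sumoo : \sum_(j <oo) mu (Rj j.+1) < +oo.
  apply: (@le_lt_trans _ _ (mu X + mu X)); last exact: lte_add_pinfty.
  apply: lime_le; first by apply: is_cvg_nneseries => *; exact: outer_measure_ge0.
  by apply: nearW => N; apply: (le_trans (sumR N)); exact: leeD.
have XU N : mu (X `&` [set x | (f x < c)%R]) <=
    mu (Xj N.+1) + \sum_(N <= j <oo) mu (Rj j.+1).
  rewrite -nneseries_addn; last by move=> *; exact: outer_measure_ge0.
  apply: le_trans (leeD2l _ (outer_measure_sigma_subadditive mu _)).
  apply: le_trans (outer_measureU2 _ _ _); apply: le_outer_measure => x [Xx /= xc].
  have [xN|xN] := leP (f x) (t N.+1); [by left|right].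
  have exk : exists k, (f x <= t (k + N).+2)%R.
    have cx : (0 < c - f x)%R by rewrite subr_gt0.
    have [k _ /(_ k (leqnn k))/= kc] := near_infty_natSinv_lt (PosNum cx).
    exists k; rewrite /t lerBrDr -lerBrDl (le_trans _ (ltW kc))//.
    by rewrite lef_pV2 ?posrE ?ltr0n// ler_nat ltnS (leq_trans (leq_addr N k))// leqW.
  case: (ex_minnP exk) => k xk kmin; exists k => //; split => //=; rewrite xk andbT.
  case: k kmin {xk} => [|k] kmin; first exact: xN.
  by rewrite ltNge; apply/negP => /kmin; rewrite ltnn.
apply/lee_addgt0Pr => e e0.
have [N _ /(_ N (leqnn N))/=] : \forall N \near \oo, \sum_(N <= j <oo) mu (Rj j.+1) < e%:E.
  have H := @nneseries_tail_cvg R (fun j => mu (Rj j.+1)) xpredT sumoo (fun _ _ => outer_measure_ge0 _ _).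
  have /fine_cvgP[] := H; move=> finH /cvgrPdist_lt/(_ _ e0)[M _ HM]; case: finH => M' _ HM'.
  exists (maxn M M') => // N /=; rewrite geq_max => /andP[MN MN'].
  have /= := HM N MN; rewrite sub0r normrN => /(le_lt_trans (ler_norm _)).
  by rewrite -lte_fin fineK//; exact: HM'.
move=> /ltW Ne.
apply: (le_trans (leeD2r _ (XU N))); rewrite addeAC; apply: leeD => //.
apply: le_trans (gap _ _ X (tc N.+1)); apply: leeD2l; apply: le_outer_measure.
by move=> x [Xx /= xc]; split => //=; rewrite leNgt; exact/negP.
Qed.

(** Intersecting every member of a cover of [X] with [A] and with [B] yields covers of the two
    pieces, so an inequality between gauges passes to the infima. *)
Lemma cover_measure_additive (P : pointedType) (tau : set P -> \bar R) (A B X : set P) :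
  (forall U, 0 <= tau U) -> (forall U, tau (U `&` A) + tau (U `&` B) <= tau U) ->
  cover_measure tau (X `&` A) + cover_measure tau (X `&` B) <= cover_measure tau X.
Proof.
move=> tau0 tauAB; apply: le_ereal_inf_tmp => _ [F /= XF <-].
apply: (@le_trans _ _ (\sum_(k <oo) tau (F k `&` A) + \sum_(k <oo) tau (F k `&` B))).
  apply: leeD; apply: ereal_inf_lbound.
    exists (fun k => F k `&` A) => // x [/XF[k _ Fk] Ax]; by exists k.
  exists (fun k => F k `&` B) => // x [/XF[k _ Fk] Ax]; by exists k.
by rewrite -nneseriesD//; apply: lee_nneseries => // i _ _; exact: adde_ge0.
Qed.

End caratheodory_criterion.

Section coordinate_caratheodory.
Context {R : realType} {n : nat}.
Local Open Scope ereal_scope.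
Implicit Types (nu : {outer_measure set 'rV[R]_n -> \bar R}).

Lemma cbox_neq0 (a b : 'rV[R]_n) : (forall i, (a 0%R i <= b 0%R i)%R) -> cbox a b == set0 = false.
Proof.
move=> ab; apply/negP => /eqP E; have : cbox a b a by move=> i; rewrite lexx ab.
by rewrite E.
Qed.

Lemma box_volume_cbox (a b : 'rV[R]_n) : (forall i, (a 0%R i <= b 0%R i)%R) ->
  box_volume (cbox a b) <= (\prod_(i < n) (b 0 i - a 0 i))%R%:E.
Proof.
move=> ab; rewrite /box_volume cbox_neq0//.
by apply: ereal_inf_lbound; exists a, b.
Qed.

Lemma box_volume_ge0 (U : set 'rV[R]_n) : 0 <= box_volume U.
Proof.
rewrite /box_volume; case: ifP => // _; apply: le_ereal_inf_tmp.
move=> _ [a [b [ab _ ->]]]; rewrite lee_fin; apply: prodr_ge0 => i _.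
by rewrite subr_ge0.
Qed.

Lemma box_volume0 : box_volume (set0 : set 'rV[R]_n) = 0.
Proof. by rewrite /box_volume eqxx. Qed.

(** A hyperplane meeting a closed box cuts it into two closed boxes sharing a face, whose volumes
    add up exactly; otherwise one piece is empty. Sets that are not boxes have infinite volume on
    the right. *)
Lemma box_volume_halfspaces (i : 'I_n) (c : R) (U : set 'rV[R]_n) :
  box_volume (U `&` [set x | (x 0%R i <= c)%R]) +
  box_volume (U `&` [set x | (c <= x 0%R i)%R]) <= box_volume U.
Proof.
have [->|/negPf U0] := eqVneq U set0; first by rewrite !set0I box_volume0 adde0.
rewrite [leRHS]/box_volume U0; apply: le_ereal_inf_tmp => _ [a [b [ab -> ->]]].
rewrite -/(cbox a b).
have volE := box_volume_cbox ab.
have [ca|ac] := ltP c (a 0%R i).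
  rewrite (_ : cbox a b `&` [set x | (x 0%R i <= c)%R] = set0); last first.
    by apply/seteqP; split=> // x [/(_ i)/andP[xa _] /=]; rewrite leNgt (lt_le_trans ca xa).
  rewrite box_volume0 add0e (_ : cbox a b `&` _ = cbox a b)//.
  by apply/setIidPl => x /(_ i)/andP[xa _] /=; rewrite ltW// (lt_le_trans ca xa).
have [bc|cb] := ltP (b 0%R i) c.
  rewrite (_ : cbox a b `&` [set x | (c <= x 0%R i)%R] = set0); last first.
    by apply/seteqP; split=> // x [/(_ i)/andP[_ xb] /=]; rewrite leNgt (le_lt_trans xb bc).
  rewrite box_volume0 adde0 (_ : cbox a b `&` _ = cbox a b)//.
  by apply/setIidPl => x /(_ i)/andP[_ xb] /=; rewrite ltW// (le_lt_trans xb bc).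
pose upd (v : 'rV[R]_n) : 'rV[R]_n := (\row_j if j == i then c else v 0 j)%R.
have updi v : (upd v 0 i = c)%R by rewrite mxE eqxx.
have updj v j : j != i -> (upd v 0 j = v 0 j)%R by move=> /negPf ji; rewrite mxE ji.
rewrite (_ : cbox a b `&` [set x | (x 0%R i <= c)%R] = cbox a (upd b)); last first.
  apply/seteqP; split=> x.
    move=> [h /= xc] j; rewrite mxE; case: eqVneq => [->|_]; last exact: h.
    by rewrite xc andbT; case/andP: (h i).
  move=> h; split => [j|/=]; last by have := h i; rewrite updi => /andP[].
  have := h j; have [->|ji] := eqVneq j i; last by rewrite updj.
  by rewrite updi => /andP[-> /= /le_trans]; exact.
rewrite (_ : cbox a b `&` [set x | (c <= x 0%R i)%R] = cbox (upd a) b); last first.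
  apply/seteqP; split=> x.
    move=> [h /= xc] j; rewrite mxE; case: eqVneq => [->|_]; last exact: h.
    by rewrite xc; case/andP: (h i).
  move=> h; split => [j|/=]; last by have := h i; rewrite updi => /andP[].
  have := h j; have [->|ji] := eqVneq j i; last by rewrite updj.
  by rewrite updi => /andP[/(le_trans ac) -> ->].
apply: le_trans (leeD (box_volume_cbox _) (box_volume_cbox _)) _.
- by move=> j; rewrite mxE; case: eqVneq => // ->.
- by move=> j; rewrite mxE; case: eqVneq => // ->.
pose q := (\prod_(j < n | j != i) (b 0 j - a 0 j))%R.
have Eb : (\prod_(j < n) (upd b 0 j - a 0 j) = (c - a 0 i) * q)%R.
  by rewrite (bigD1 i)//= updi; congr (_ * _)%R; apply: eq_bigr => j ji; rewrite updj.
have Ea : (\prod_(j < n) (b 0 j - upd a 0 j) = (b 0 i - c) * q)%R.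
  by rewrite (bigD1 i)//= updi; congr (_ * _)%R; apply: eq_bigr => j ji; rewrite updj.
have E : (\prod_(j < n) (b 0 j - a 0 j) = (b 0 i - a 0 i) * q)%R by rewrite (bigD1 i).
by rewrite Ea Eb E -EFinD lee_fin -mulrDl addrC addrA subrK.
Qed.

(** Measurability of coordinate half-spaces is all that is needed to make Borel sets Caratheodory
    measurable, so Lebesgue and Hausdorff measures share one treatment. *)
Definition coord_measurable nu :=
  forall (i : 'I_n) (c : R), nu.-caratheodory [set x : 'rV[R]_n | (x 0%R i < c)%R].

Lemma lebesgue_coord_measurable : coord_measurable (lebesgue_outer R n).
Proof.
move=> i; apply: (@gap_additive_caratheodory _ _ _ (fun x : 'rV[R]_n => x 0%R i)).
move=> s t X st; apply: le_trans (cover_measure_additive X box_volume_ge0 (box_volume_halfspaces i s)).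
apply: leeD => //; apply: le_outer_measure => x [Xx /= tx]; split => //=.
by rewrite (le_trans (ltW st)).
Qed.

Lemma le_diam (U V : set 'rV[R]_n) : U `<=` V -> diam U <= diam V.
Proof.
move=> UV; apply: le_ereal_sup => _ [x [y [Ux Uy ->]]].
by exists x, y; split => //; exact: UV.
Qed.

Lemma eudist_le_diam (U : set 'rV[R]_n) x y : U x -> U y -> (eudist x y)%:E <= diam U.
Proof. by move=> Ux Uy; apply: ereal_sup_ubound; exists x, y. Qed.

Lemma hausdorff_gauge_ge0 s d (U : set 'rV[R]_n) : 0 <= hausdorff_gauge s d U.
Proof. by rewrite /hausdorff_gauge; do 2 case: ifP => // _; exact: poweR_ge0. Qed.

Lemma hausdorff_gauge0 s d : hausdorff_gauge s d (set0 : set 'rV[R]_n) = 0.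
Proof. by rewrite /hausdorff_gauge eqxx. Qed.

(** A set meeting both half-spaces has diameter at least [t - r > d], hence infinite gauge at scale
    [d]. Otherwise one piece is empty and monotonicity of the gauge suffices. *)
Lemma hausdorff_gauge_gap (s d r t : R) (i : 'I_n) (U : set 'rV[R]_n) :
  (0 <= s)%R -> (d < t - r)%R ->
  hausdorff_gauge s d (U `&` [set x | (x 0%R i <= r)%R]) +
  hausdorff_gauge s d (U `&` [set x | (t <= x 0%R i)%R]) <= hausdorff_gauge s d U.
Proof.
move=> s0 drt; set V := U `&` _; set W := U `&` _.
have mono V' : V' `<=` U -> hausdorff_gauge s d V' <= hausdorff_gauge s d U.
  move=> VU; rewrite /hausdorff_gauge; case: ifPn => [_|/set0P[x Vx]].
    exact: hausdorff_gauge_ge0.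
  have diam_ge0 V'' : V'' x -> 0 <= diam V''.
    by move=> Vx'; have := eudist_le_diam Vx' Vx'; rewrite eudistxx.
  rewrite [leRHS]ifF; last by apply/negbTE; apply/set0P; exists x; exact: VU.
  have [dU|_] := boolP (diam U <= d%:E); last by rewrite leey.
  rewrite (le_trans (le_diam VU) dU) gt0_ler_poweR ?le_diam//.
    by rewrite in_itv/= diam_ge0// leey.
  by rewrite in_itv/= diam_ge0 ?leey//; exact: VU.
have [V0|/set0P[x [Ux /= xr]]] := eqVneq V set0.
  by rewrite V0 hausdorff_gauge0 add0e; apply: mono; exact: subIsetl.
have [W0|/set0P[y [Uy /= ty]]] := eqVneq W set0.
  by rewrite W0 hausdorff_gauge0 adde0; apply: mono; exact: subIsetl.
rewrite [leRHS]/hausdorff_gauge ifF; last by apply/negbTE; apply/set0P; exists x.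
rewrite ifF ?leey//; apply/negbTE; rewrite -ltNge.
apply: lt_le_trans (eudist_le_diam Uy Ux); rewrite lte_fin.
apply: lt_le_trans (coord_le_eudist _ _ i).
by rewrite (lt_le_trans drt)// (le_trans _ (ler_norm _))// lerB.
Qed.

Lemma le_hausdorff_gauge s (d d' : R) (U : set 'rV[R]_n) : (d <= d')%R ->
  hausdorff_gauge s d' U <= hausdorff_gauge s d U.
Proof.
move=> dd'; rewrite /hausdorff_gauge; case: ifP => // _.
case: ifPn => [Ud'|]; case: ifPn => [Ud|_]; rewrite ?leey//.
by rewrite (le_trans Ud) ?lee_fin.
Qed.

Lemma le_cover_hausdorff_gauge s (d d' : R) (A : set 'rV[R]_n) : (d <= d')%R ->
  cover_measure (hausdorff_gauge s d') A <= cover_measure (hausdorff_gauge s d) A.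
Proof.
move=> dd'; apply: le_ereal_inf_tmp => _ [F /= AF <-].
apply: (@le_trans _ _ (\sum_(k <oo) hausdorff_gauge s d' (F k))).
  by apply: ereal_inf_lbound; exists F.
apply: lee_nneseries => [k _ _|k _]; first exact: hausdorff_gauge_ge0.
exact: le_hausdorff_gauge.
Qed.

Lemma cover_le_hausdorff s d (A : set 'rV[R]_n) : (0 < d)%R ->
  cover_measure (hausdorff_gauge s d) A <= hausdorff s A.
Proof. by move=> d0; apply: ereal_sup_ubound; exists d. Qed.

Lemma hausdorff_coord_measurable (s : R) : (0 <= s)%R -> coord_measurable (hausdorff s).
Proof.
move=> s0 i; apply: (@gap_additive_caratheodory _ _ _ (fun x : 'rV[R]_n => x 0%R i)).
move=> r t X rt.
set A := X `&` _; set B := X `&` _.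
(* The two scales are decoupled so that each supremum can be taken separately, the other term being
   finite and moved to the right. *)
suff AB (d d' : R) : (0 < d)%R -> (0 < d')%R ->
    cover_measure (hausdorff_gauge s d) A + cover_measure (hausdorff_gauge s d') B <=
    hausdorff s X.
  change (hausdorff s A + hausdorff s B <= hausdorff s X).
  have [->|] := eqVneq (hausdorff s X) +oo; first by rewrite leey.
  rewrite -ltey => Xoo.
  have fin (V : set 'rV[R]_n) : V `<=` X -> hausdorff s V \is a fin_num.
    move=> VX; rewrite ge0_fin_numE ?outer_measure_ge0//.
    exact: (le_lt_trans (le_outer_measure (hausdorff s) _ _ VX)).
  have finc (d' : R) (V : set 'rV[R]_n) : (0 < d')%R -> V `<=` X ->
      cover_measure (hausdorff_gauge s d') V \is a fin_num.
    move=> d'0 VX; rewrite ge0_fin_numE.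
      by apply: le_lt_trans (cover_le_hausdorff _ _ d'0) _; rewrite -ge0_fin_numE ?outer_measure_ge0 ?fin.
    exact/cover_measure_ge0/hausdorff_gauge_ge0.
  rewrite -leeBrDl ?fin//; last exact: subIsetl.
  apply: ge_ereal_sup => _ [d' /= d'0 <-].
  rewrite leeBrDl ?fin//; last exact: subIsetl.
  rewrite -leeBrDr ?finc//; last exact: subIsetl.
  apply: ge_ereal_sup => _ [d /= d0 <-].
  by rewrite leeBrDr ?finc//; [exact: AB|exact: subIsetl].
(* A common scale finer than both given ones, where the gauges are larger, and smaller than the gap
   between the half-spaces. *)
move=> d0 d'0; pose e : R := Num.min (Num.min d d') ((t - r) / 2)%R.
have e0 : (0 < e)%R by rewrite !lt_min d0 d'0/= divr_gt0// subr_gt0.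
apply: le_trans (cover_le_hausdorff s X e0).
have eg : (e < t - r)%R.
  by rewrite !gt_min; apply/orP; right; rewrite ltr_pdivrMr// ltr_pMr ?subr_gt0// ltr1n.
apply: le_trans (cover_measure_additive X (hausdorff_gauge_ge0 s e)
  (fun U => hausdorff_gauge_gap i U s0 eg)).
by apply: leeD; apply: le_cover_hausdorff_gauge; rewrite !ge_min lexx ?orbT.
Qed.

Lemma hausdorff_on_coord_measurable (s : R) E : (0 <= s)%R -> coord_measurable (hausdorff_on s E).
Proof.
move=> s0 i c X; have := hausdorff_coord_measurable s0 i c (X `&` E).
by rewrite !(setIAC X E).
Qed.

End coordinate_caratheodory.

Section borel_caratheodory.
Context {R : realType} {n : nat}.
Variable nu : {outer_measure set 'rV[R]_n -> \bar R}.
Hypothesis nuc : coord_measurable nu.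
Local Notation T := (caratheodory_type nu).

Lemma measurable_coord (i : 'I_n) : measurable_fun [set: T] (fun x : T => (x : 'rV[R]_n) 0 i).
Proof.
apply: (measurability _ (RGenInftyO.measurableE R)).
move=> _ [_ [c ->] <-]; rewrite setTI.
by rewrite (_ : _ @^-1` _ = [set x : 'rV[R]_n | x 0 i < c]); [exact: nuc|apply/seteqP; split=> x /=; rewrite in_itv].
Qed.

Lemma measurable_obox (a b : 'rV[R]_n) : measurable (obox a b : set T).
Proof.
rewrite (_ : obox a b = \bigcap_(i in [set: 'I_n])
  ((fun x : T => (x : 'rV[R]_n) 0 i) @^-1` `]a 0 i, b 0 i[%classic)); last first.
  by apply/seteqP; split=> x h i => [_|]; have := h i; rewrite /= in_itv//=; apply.
apply: fin_bigcap_measurable => // i _.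
by rewrite -[X in measurable X]setTI; apply: measurable_coord.
Qed.

Lemma open_measurable_cara (U : set 'rV[R]_n) : open U -> measurable (U : set T).
Proof.
move=> /open_bigcup_obox[P [a [b [_ ->]]]].
by apply: bigcup_measurable => k _; exact: measurable_obox.
Qed.

Lemma closed_measurable_cara (U : set 'rV[R]_n) : closed U -> measurable (U : set T).
Proof.
by move=> cU; rewrite -[U]setCK; apply: measurableC; apply: open_measurable_cara; rewrite openC.
Qed.

Lemma compact_measurable_cara (U : set 'rV[R]_n) : compact U -> measurable (U : set T).
Proof.
by move=> cU; apply: closed_measurable_cara; apply: compact_closed => //; exact: norm_hausdorff.
Qed.

Lemma continuous_measurable_cara (f : 'rV[R]_n -> R) :
  continuous f -> measurable_fun [set: T] (f : T -> R).
Proof.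
move=> cf; apply: (measurability _ (RGenOpens.measurableE R)).
move=> _ [_ [a [b ->]] <-]; rewrite setTI; apply: open_measurable_cara.
by apply: open_comp => // x _; exact: cf.
Qed.

End borel_caratheodory.

(** * Lebesgue measure: translation invariance and null sets *)

Section lebesgue_rV.
Context {R : realType} {n : nat}.
Local Open Scope ereal_scope.
Local Notation leb := (lebesgue_measure_rV R n).
Local Notation T := (lebesgue_space R n).
Implicit Types (a b h x : 'rV[R]_n) (X : set 'rV[R]_n).

Lemma lebesgue_cbox_le a b : (forall i, (a 0%R i <= b 0%R i)%R) ->
  lebesgue_outer R n (cbox a b) <= (\prod_(i < n) (b 0 i - a 0 i))%R%:E.
Proof.
move=> ab; apply: le_trans (box_volume_cbox ab); apply: ereal_inf_lbound.
exists (fun k => if k == 0%N then cbox a b else set0) => /=; first by move=> x ?; exists 0%N.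
rewrite (nneseries_split 0 1) ?add0n; last by move=> k _; exact: box_volume_ge0.
rewrite big_nat1 eseries0 ?adde0// => -[|k]//= _ _; exact: box_volume0.
Qed.

Lemma lebesgue_outer_bounded X x (r : R) : (0 <= r)%R ->
  (forall y, X y -> (eudist x y <= r)%R) ->
  lebesgue_outer R n X <= ((2 * r) ^+ n)%:E.
Proof.
move=> r0 Xr; pose a : 'rV[R]_n := (x - const_mx r)%R; pose b : 'rV[R]_n := (x + const_mx r)%R.
apply: (@le_trans _ _ (lebesgue_outer R n (cbox a b))).
  apply: le_outer_measure => y /Xr xy i.
  rewrite !mxE -ler_distl distrC.
  exact: le_trans (coord_le_eudist _ _ i) xy.
apply: le_trans (lebesgue_cbox_le _) _.
  by move=> i; rewrite !mxE; rewrite lerD2l (le_trans _ r0)// oppr_le0.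
rewrite lee_fin -[X in (_ ^+ X)%R]card_ord -prodr_const le_eqVlt; apply/orP; left.
by apply/eqP; apply: eq_bigr => i _; rewrite !mxE; ring.
Qed.

Lemma lebesgue_eball_le x (r : R) : (0 <= r)%R -> leb (eball x r) <= ((2 * r) ^+ n)%:E.
Proof. by move=> r0; apply: (@lebesgue_outer_bounded _ x) => // y /ltW. Qed.

Definition shift_rV h x : 'rV[R]_n := (x + h)%R.

Lemma lebesgue_outer_shift h X : lebesgue_outer R n (shift_rV h @^-1` X) = lebesgue_outer R n X.
Proof.
(* One inequality for all shifts suffices: the reverse one is the case of the opposite shift. *)
have H k Y : lebesgue_outer R n (shift_rV k @^-1` Y) <= lebesgue_outer R n Y.
  apply: le_ereal_inf_tmp => _ [F /= YF <-].
  apply: (@le_trans _ _ (\sum_(j <oo) box_volume (shift_rV k @^-1` F j))).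
    by apply: ereal_inf_lbound; exists (fun j => shift_rV k @^-1` F j) => // x /YF[j _ Fj]; exists j.
  apply: lee_nneseries => [j _ _|j _]; first exact: box_volume_ge0.
  move: (F j) => U; have [->|/negPf U0] := eqVneq U set0.
    by rewrite preimage_set0.
  rewrite [leRHS]/box_volume U0; apply: le_ereal_inf_tmp => _ [a [b [ab -> ->]]].
  rewrite (_ : shift_rV k @^-1` _ = cbox (a - k)%R (b - k)%R).
    apply: le_trans (box_volume_cbox _) _.
      by move=> i; rewrite !mxE lerD2r.
    rewrite lee_fin le_eqVlt; apply/orP; left; apply/eqP; apply: eq_bigr => i _.
    by rewrite !mxE; ring.
  by apply/seteqP; split=> x /= hx i; have := hx i; rewrite !mxE lerBlDr lerBrDr.
apply/eqP; rewrite eq_le H/=; have := H (- h)%R (shift_rV h @^-1` X).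
by rewrite -comp_preimage (_ : shift_rV h \o shift_rV (- h)%R = id)//; apply/funext => x/=; rewrite /shift_rV subrK.
Qed.

Lemma measurable_shift_rV h : measurable_fun [set: T] (shift_rV h : T -> T).
Proof.
move=> _ A mA; rewrite setTI.
suff : (lebesgue_outer R n).-caratheodory (shift_rV h @^-1` A) by [].
move=> X.
have E (Y Z : set 'rV[R]_n) : shift_rV h @^-1` (shift_rV (- h)%R @^-1` Y `&` Z) = Y `&` shift_rV h @^-1` Z.
  rewrite preimage_setI -comp_preimage (_ : shift_rV (- h)%R \o shift_rV h = id)//.
  by apply/funext => x/=; rewrite /shift_rV addrK.
set Y := shift_rV (- h)%R @^-1` X.
apply: (etrans (esym (lebesgue_outer_shift (- h)%R X))); apply: (etrans (mA Y)).
by congr (_ + _); apply: (etrans (esym (lebesgue_outer_shift h _))); rewrite E.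
Qed.

Lemma ge0_integral_shift_rV h (f : T -> \bar R) : measurable_fun [set: T] f ->
  (forall x, 0 <= f x) -> \int[leb]_x f (shift_rV h x) = \int[leb]_x f x.
Proof.
move=> mf f0; have := @ge0_integral_pushforward _ _ T T R _ (measurable_shift_rV h) leb setT f measurableT mf (fun x _ => f0 x).
rewrite preimage_setT => <-; apply: eq_measure_integral => [|mphi A _ _].
  exact: measurable_shift_rV.
exact: lebesgue_outer_shift.
Qed.

Lemma integral_shift_rV h (f : T -> \bar R) : measurable_fun [set: T] f ->
  \int[leb]_x f (shift_rV h x) = \int[leb]_x f x.
Proof.
move=> mf; rewrite [LHS]integralE [RHS]integralE; congr (_ - _).
- rewrite -[RHS](@ge0_integral_shift_rV h)//; last exact: measurable_funepos.
  by apply: eq_integral => x _; rewrite !funeposE.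
- rewrite -[RHS](@ge0_integral_shift_rV h)//; last exact: measurable_funeneg.
  by apply: eq_integral => x _; rewrite !funenegE.
Qed.

Lemma lebesgue_null_measurable X : lebesgue_outer R n X = 0 -> measurable (X : set T).
Proof.
move=> X0; apply: le_caratheodory_measurable => Y.
apply: (@le_trans _ _ (0 + lebesgue_outer R n Y)); last by rewrite add0e.
apply: leeD; last by apply: le_outer_measure; exact: subIsetl.
by rewrite -X0; apply: le_outer_measure; exact: subIsetr.
Qed.

(** A set of diameter [e <= d] lies in a cube of side [2 e], of volume at most [2^n d^(n - s) e^s].
    Summing over a cover bounds the Lebesgue measure by [2^n d^(n - s)] times the Hausdorff measure,
    and [d] tends to 0. *)
Lemma hausdorff_lebesgue_null (s : R) X : (0 <= s)%R -> (s < n%:R)%R ->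
  hausdorff s X < +oo -> lebesgue_outer R n X = 0.
Proof.
move=> s0 sn Xoo.
have Xfin : hausdorff s X \is a fin_num by rewrite ge0_fin_numE// outer_measure_ge0.
have bound (d : R) : (0 < d)%R ->
    lebesgue_outer R n X <= (2 ^+ n * d `^ (n%:R - s))%:E * hausdorff s X.
  move=> d0; have c0 : (0 < 2 ^+ n * d `^ (n%:R - s))%R by rewrite mulr_gt0 ?exprn_gt0 ?powR_gt0.
  apply: (@le_trans _ _ ((2 ^+ n * d `^ (n%:R - s))%:E * cover_measure (hausdorff_gauge s d) X)); last first.
    by rewrite lee_pmul2l// cover_le_hausdorff.
  rewrite -lee_pdivrMl//; apply: le_ereal_inf_tmp => _ [F /= XF <-].
  rewrite lee_pdivrMl// -nneseriesZl; last by move=> *; exact: hausdorff_gauge_ge0.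
  apply: (@le_trans _ _ (lebesgue_outer R n (\bigcup_k F k))); first exact: le_outer_measure.
  apply: le_trans (outer_measure_sigma_subadditive _ _) _.
  apply: lee_nneseries => [k _ _|k _]; first exact: outer_measure_ge0.
  move: (F k) => U; rewrite /hausdorff_gauge; case: ifPn => [/eqP->|/set0P[x Ux]].
    by rewrite outer_measure0 mule0.
  case: ifPn => [Ud|_]; last by rewrite gt0_muley// leey.
  have dU0 : 0 <= diam U by have := eudist_le_diam Ux Ux; rewrite eudistxx.
  have dUfin : diam U \is a fin_num by rewrite ge0_fin_numE// (le_lt_trans Ud) ?ltry.
  move: (dUfin) => /fineK dUE; set e := fine (diam U) in dUE.
  have e0 : (0 <= e)%R by rewrite fine_ge0.
  have ed : (e <= d)%R by rewrite -lee_fin dUE.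
  apply: le_trans (@lebesgue_outer_bounded _ x e e0 _) _.
    by move=> y Uy; rewrite -lee_fin dUE; exact: eudist_le_diam.
  rewrite -dUE poweR_EFin -EFinM lee_fin exprMn -mulrA ler_wpM2l ?exprn_ge0//.
  rewrite -powR_mulrn// -{1}(subrK s n%:R) powRD; last first.
    by apply/implyP => /eqP; rewrite subrK => n0; move: sn; rewrite n0 ltNge s0.
  rewrite ler_wpM2r ?powR_ge0//; apply: ge0_ler_powR => //.
    by rewrite subr_ge0 ltW.
  by rewrite nnegrE ltW.
apply/eqP; rewrite eq_le outer_measure_ge0 andbT; apply/lee_addgt0Pr => e e0; rewrite add0e.
(* The [+ 1] keeps [c] positive when the Hausdorff measure vanishes; [d] below is the solution of
   [d^(n - s) = e / c]. *)
pose c := (2 ^+ n * (fine (hausdorff s X) + 1))%R.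
have c0 : (0 < c)%R.
  by rewrite mulr_gt0 ?exprn_gt0// ltr_wpDl// fine_ge0// outer_measure_ge0.
pose d := ((e / c) `^ (n%:R - s)^-1)%R.
have d0 : (0 < d)%R by rewrite powR_gt0// divr_gt0.
apply: le_trans (bound d d0) _.
rewrite -powRrM mulVf ?subr_eq0 ?gt_eqF// powRr1 ?divr_ge0 ?(ltW e0) ?(ltW c0)//.
rewrite -(fineK Xfin) -EFinM lee_fin -[leRHS](@divfK _ c) ?gt_eqF//.
rewrite mulrAC mulrC ler_wpM2l ?divr_ge0 ?(ltW e0) ?(ltW c0)//.
by rewrite /c ler_wpM2l ?exprn_ge0// lerDl.
Qed.

End lebesgue_rV.

(** * Test functions and the fundamental lemma of the calculus of variations *)

Section smooth1.
Context {R : realType}.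
Implicit Types (f g : R -> R) (k : nat).

(** Each level carries its derivative as a witness, so the sum, product and affine rules go by
    induction on [k]. *)
Fixpoint smooth1 k f : Prop :=
  if k is k'.+1 then
    exists2 g, (forall t, is_derive t (1 : R) f (g t)) & smooth1 k' g
  else continuous f.

Lemma is_derive1_continuous f g : (forall t, is_derive t (1 : R) f (g t)) -> continuous f.
Proof.
by move=> fg t; apply/differentiable_continuous/derivable1_diffP; case: (fg t).
Qed.

Lemma smooth1S k f : smooth1 k.+1 f -> smooth1 k f.
Proof.
elim: k f => [f [g fg _]|k IH f [g fg gk]]; first exact: is_derive1_continuous fg.
by exists g => //; exact: IH.
Qed.

Lemma smooth1D k f g : smooth1 k f -> smooth1 k g -> smooth1 k (f + g).
Proof.
elim: k f g => [f g fc gc t|k IH f g [f' ff' f'k] [g' gg' g'k]].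
  by apply: continuousD; [exact: fc|exact: gc].
exists (f' + g'); last exact: IH.
move=> t; have H1 := ff' t; have H2 := gg' t; exact: is_deriveD.
Qed.

Lemma smooth1M k f g : smooth1 k f -> smooth1 k g -> smooth1 k (f * g).
Proof.
elim: k f g => [f g fc gc t|k IH f g fk gk].
  by apply: continuousM; [exact: fc|exact: gc].
have fk' := smooth1S fk; have gk' := smooth1S gk.
case: fk => f' ff' f'k; case: gk => g' gg' g'k.
exists (f * g' + g * f').
  move=> t; have H1 := ff' t; have H2 := gg' t; exact: is_deriveM.
by apply: smooth1D; exact: IH.
Qed.

Lemma smooth1_affine k f (c d : R) : smooth1 k f -> smooth1 k (fun t => f (c * t + d)).
Proof.
elim: k f => [f fc t|k IH f [g fg gk]].
  apply: continuous_comp; last exact: fc.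
  by apply: cvgD; [apply: cvgM; [exact: cvg_cst|exact: cvg_id]|exact: cvg_cst].
exists (cst c * (fun t => g (c * t + d))).
  move=> t; have H1 : is_derive t (1 : R) (fun t => c * t + d) c.
    have -> : (fun t => c * t + d) = c *: id + cst d by [].
    by apply: is_derive_eq; rewrite addr0 /GRing.scale/= mulr1.
  have H2 := fg (c * t + d).
  have := @is_derive1_comp _ f (fun t => c * t + d) t _ _ H2 H1.
  by rewrite mulrC.
apply: smooth1M; last exact: IH.
elim: k {IH g fg gk} (c) => [|k IH] e; first by move=> ?; exact: cst_continuous.
exists (cst 0) => // t; exact: is_derive_cst.
Qed.

(** The functions [P(1/t) exp(-1/t)], extended by 0, form a family closed under differentiation: [P]
    becomes [(P - P') X^2]. The case [P = 1] is the classical smooth function that is flat at 0. *)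
Definition flat (P : {poly R}) (t : R) : R :=
  if 0 < t then P.[t^-1] * expR (- t^-1) else 0.

(** With [q = s / k], the inequality [q <= exp q] raised to the power [k] gives the bound. *)
Lemma exprM_expRN_le (s : R) k : 0 <= s -> s ^+ k * expR (- s) <= k%:R ^+ k.
Proof.
move=> s0; rewrite expRN ler_pdivrMr ?expR_gt0//.
case: k => [|k]; first by rewrite !expr0 mul1r -expR0 ler_expR.
pose q := s / k.+1%:R; have q0 : 0 <= q by rewrite divr_ge0.
have -> : s = k.+1%:R * q by rewrite mulrC divfK.
rewrite expRM_natl exprMn ler_wpM2l ?exprn_ge0//.
rewrite lerXn2r ?nnegrE ?expR_ge0//.
by apply: le_trans (expR_ge1Dx _); rewrite lerDr.
Qed.

Lemma flat_bounded (P : {poly R}) : exists2 C, 0 <= C & forall t, `|flat P t| <= C.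
Proof.
exists (\sum_(i < size P) `|P`_i| * i%:R ^+ i).
  by apply: sumr_ge0 => i _; rewrite mulr_ge0// exprn_ge0.
move=> t; rewrite /flat; case: ifPn => [t0|_]; last first.
  by rewrite normr0; apply: sumr_ge0 => i _; rewrite mulr_ge0// exprn_ge0.
rewrite horner_coef mulr_suml (le_trans (ler_norm_sum _ _ _))//.
apply: ler_sum => i _; rewrite -mulrA normrM ler_wpM2l//.
rewrite ger0_norm ?mulr_ge0 ?expR_ge0 ?exprn_ge0 ?invr_ge0 ?(ltW t0)//.
by apply: exprM_expRN_le; rewrite invr_ge0 ltW.
Qed.

Lemma is_derive_flat (P : {poly R}) (t : R) :
  is_derive t (1 : R) (flat P) (flat ((P - P^`()) * 'X^2) t).
Proof.
have [t0|t0|->] := ltgtP t 0.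
- rewrite {2}/flat ltNge (ltW t0)/=.
  apply: near_eq_is_derive (is_derive_cst 0 t 1).
  near=> s; rewrite /flat ltNge ifF//; apply/negbTE; rewrite negbK ltW//.
  by near: s; exact: lt_nbhsl.
- rewrite {2}/flat t0 !hornerE.
  have tN0 : t != 0 by rewrite gt_eqF.
  pose g (s : R) := P.[s^-1] * expR (- s^-1).
  apply: (@near_eq_is_derive _ _ _ g).
    by near=> s; rewrite /flat /g ifT//; near: s; exact: lt_nbhsr.
  have dV : is_derive t (1 : R) (fun s : R => s^-1) (- t ^- 2).
    have := is_deriveV tN0 (is_derive_id t (1 : R)).
    by rewrite /GRing.scale/= mulr1.
  have dP : is_derive t (1 : R) (fun s : R => P.[s^-1]) (P^`().[t^-1] * - t ^- 2).
    exact: (@is_derive1_comp _ (horner P) (fun s => s^-1)).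
  have dNV : is_derive t (1 : R) (fun s : R => - s^-1) (t ^- 2).
    by rewrite -[t ^- 2]opprK; exact: is_deriveN.
  have dE : is_derive t (1 : R) (fun s : R => expR (- s^-1)) (expR (- t^-1) * t ^- 2).
    exact: (@is_derive1_comp _ expR (fun s => - s^-1)).
  apply: (is_derive_eq (is_deriveM dP dE)); rewrite /GRing.scale/=.
  by field.
(* Boundedness for [P X^2] amounts to quadratic decay of [flat P] at 0, hence to a zero derivative
   there. *)
have [C C0 CP] := flat_bounded (P * 'X^2).
have flat0 (P' : {poly R}) : flat P' 0 = 0 by rewrite /flat ltxx.
have flat_le s : `|flat P s| <= C * s ^+ 2.
  rewrite /flat; case: ifPn => [s0|_]; last by rewrite normr0 mulr_ge0// sqr_ge0.
  have := CP s; rewrite /flat s0 hornerM hornerXn => Cs.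
  rewrite -ler_pdivrMr ?exprn_gt0//; apply: le_trans _ Cs.
  rewrite -(ger0_norm (exprn_ge0 2 (ltW s0))) -normrV ?unitfE ?expf_neq0 ?gt_eqF//.
  by rewrite -normrM -exprVn mulrAC.
rewrite flat0; suff H : (fun h : R => h^-1 *: (flat P (h *: (1 : R) + 0) - flat P 0)) @ 0^' --> (0 : R).
  by apply: DeriveDef; [apply/cvg_ex; exists 0|exact: cvg_lim].
apply/cvgrPdist_le => e e0.
near=> h; rewrite sub0r normrN flat0 subr0 addr0 /GRing.scale/= mulr1 normrM.
have hN0 : h != 0 by near: h; exact: nbhs_dnbhs_neq.
rewrite normrV ?unitfE// ler_pdivrMl ?normr_gt0//.
apply: le_trans (flat_le h) _; rewrite -real_normK ?num_real// expr2 mulrA mulrC ler_wpM2l//.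
rewrite (@le_trans _ _ (C * (e / (C + 1))))//.
  rewrite ler_wpM2l//; near: h; apply: dnbhs0_le; rewrite divr_gt0// ltr_wpDl//.
by rewrite mulrCA ger_pMr// ler_pdivrMr ?mul1r ?lerDl// ltr_wpDl.
Unshelve. all: by end_near. Qed.

Lemma smooth1_flat k (P : {poly R}) : smooth1 k (flat P).
Proof.
elim: k P => [|k IH] P.
  exact: (is_derive1_continuous (g := flat ((P - P^`()) * 'X^2)) (is_derive_flat P)).
by exists (flat ((P - P^`()) * 'X^2)) => //; exact: is_derive_flat.
Qed.

End smooth1.

Section product_functions.
Context {R : realType} {n : nat}.
Implicit Types (eta : 'I_n -> R -> R) (x : 'rV[R]_n).

(** A partial derivative of a product of one-variable functions only replaces one factor, so
    [of_class_C] for bump functions reduces to one-variable calculus by induction. *)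
Definition prod_fun eta x : R := \prod_(j < n) eta j (x 0 j).

Lemma smooth1_continuous k (f : R -> R) : smooth1 k f -> continuous f.
Proof. by case: k => [|k] //= [g fg _]; exact: is_derive1_continuous fg. Qed.

Lemma prod_fun_continuous eta : (forall j, continuous (eta j)) -> continuous (prod_fun eta).
Proof.
move=> ceta; apply: continuous_big => [|j _]; first exact: mul_continuous.
move=> x; apply: (@continuous_comp _ _ _ (fun y : 'rV[R]_n => y 0 j)).
  exact: coord_continuous.
exact: ceta.
Qed.

Definition upd_fun eta i (g : R -> R) j : R -> R := if j == i then g else eta j.

Lemma is_derive_prod_fun eta (i : 'I_n) (g : R -> R) x :
  (forall t, is_derive t (1 : R) (eta i) (g t)) ->
  is_derive 0 (1 : R) (along (prod_fun eta) x i) (prod_fun (upd_fun eta i g) x).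
Proof.
move=> ig.
have -> : along (prod_fun eta) x i =
    (\prod_(j < n | j != i) eta j (x 0 j)) \*: (fun t => eta i (1 * t + x 0 i)).
  apply/funext => t; rewrite /along /prod_fun (bigD1 i)//= mulrC; congr (_ * _).
    by apply: eq_bigr => j ji; rewrite !mxE eqxx (negPf ji) mulr0 addr0.
  by rewrite !mxE !eqxx mulr1 mul1r addrC.
have H1 : is_derive (0 : R) (1 : R) (fun t => 1 * t + x 0 i) 1.
  have -> : (fun t => 1 * t + x 0 i) = id + cst (x 0 i) by apply/funext => t; rewrite mul1r.
  by apply: is_derive_eq; rewrite addr0.
have H2 := ig (1 * 0 + x 0 i).
have H3 := @is_derive1_comp _ (eta i) (fun t => 1 * t + x 0 i) 0 _ _ H2 H1.
apply: (is_derive_eq (is_deriveZ _ H3)).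
rewrite [RHS](bigD1 i)//= {1}/upd_fun eqxx.
rewrite /GRing.scale/= mulr1 mulr0 add0r mulrC; congr (_ * _).
by apply: eq_bigr => j /negPf ji; rewrite /upd_fun ji.
Qed.

Lemma of_class_C_prod_fun k eta : (forall j, smooth1 k (eta j)) -> of_class_C k (prod_fun eta).
Proof.
elim: k eta => [|k IH] eta seta; (split; first by apply: prod_fun_continuous => j; exact: smooth1_continuous (seta j)) => //.
move=> i; have [g ig sg] := seta i; split.
  by move=> x; have [] := is_derive_prod_fun x ig.
have -> : partial i (prod_fun eta) = prod_fun (upd_fun eta i g).
  apply/funext => x; rewrite /partial derive1E.
  by have [_ ->] := is_derive_prod_fun x ig.
apply: IH => j; rewrite /upd_fun; case: ifPn => // _; exact: smooth1S.
Qed.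

(** Since [exp(-1/(k s))] tends to 1 for [s > 0], these test functions converge pointwise to the
    indicator of the open box as [k] grows. The arguments are written as affine maps of [t] to match
    [smooth1_affine]. *)
Definition box_bump (a b : 'rV[R]_n) (k : nat) : 'rV[R]_n -> R :=
  prod_fun (fun i t => flat 1 (k%:R * t + - (k%:R * a 0 i)) * flat 1 (- k%:R * t + k%:R * b 0 i)).

Lemma flat1_ge0 (t : R) : 0 <= flat 1 t.
Proof. by rewrite /flat; case: ifPn => // _; rewrite hornerC mul1r expR_ge0. Qed.

Lemma flat1_le1 (t : R) : flat 1 t <= 1.
Proof.
rewrite /flat; case: ifPn => // t0; rewrite hornerC mul1r -expR0 ler_expR.
by rewrite oppr_le0 invr_ge0 ltW.
Qed.

Lemma flat1_le0 (t : R) : t <= 0 -> flat 1 t = 0.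
Proof. by move=> t0; rewrite /flat ltNge t0. Qed.

Lemma flat1_cvg (s : R) : flat 1 (k%:R * s) @[k --> \oo] --> ((0 < s)%R%:R : R).
Proof.
have [s0|s0] := ltP 0 s; last first.
  under eq_fun do rewrite flat1_le0 ?mulr_ge0_le0//; exact: cvg_cst.
rewrite /= -(cvg_shiftS _).
have -> : (fun k : nat => flat 1 (k.+1%:R * s)) = (fun k : nat => expR (- ((k.+1%:R : R)^-1 * s^-1))).
  by apply/funext => k; rewrite /flat mulr_gt0 ?ltr0n// hornerC mul1r invfM.
have -> : true%:R = expR (- (0 * s^-1)) :> R by rewrite mul0r oppr0 expR0.
have H : - ((k.+1%:R : R)^-1 * s^-1) @[k --> \oo] --> (- (0 * s^-1) : R).
  by apply: cvgN; apply: cvgM; [exact: cvg_harmonic|exact: cvg_cst].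
exact: (cvg_comp _ _ H (@continuous_expR R _)).
Qed.

Lemma box_bump_ge0 a b k x : 0 <= box_bump a b k x.
Proof. by apply: prodr_ge0 => i _; rewrite mulr_ge0 ?flat1_ge0. Qed.

Lemma box_bump_le1 a b k x : box_bump a b k x <= 1.
Proof.
have -> : 1 = \prod_(i < n) 1 :> R by rewrite big1.
apply: ler_prod => i _; rewrite mulr_ge0 ?flat1_ge0//=.
by rewrite mulr_ile1 ?flat1_ge0 ?flat1_le1.
Qed.

Lemma box_bump_out a b k x : ~ obox a b x -> box_bump a b k x = 0.
Proof.
move=> /existsNP[i /negP]; rewrite negb_and -!leNgt => xi; rewrite /box_bump /prod_fun (bigD1 i)//=.
case/orP: xi => xi; [rewrite (@flat1_le0 (_ + - (k%:R * a 0 i)))|rewrite (@flat1_le0 (_ + k%:R * b 0 i))]; rewrite ?mulr0 ?mul0r//.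
  by rewrite -mulrBr mulr_ge0_le0// subr_le0.
by rewrite mulNr addrC -mulrBr mulr_ge0_le0// subr_le0.
Qed.

Lemma test_function_box_bump a b k (U : set 'rV[R]_n) :
  cbox a b `<=` U -> test_function U (box_bump a b k).
Proof.
move=> abU; split=> [l|].
  apply: of_class_C_prod_fun => j; apply: smooth1M.
    exact: (smooth1_affine _ _ (smooth1_flat l 1)).
  exact: (smooth1_affine _ _ (smooth1_flat l 1)).
exists (cbox a b); split => //; first exact: cbox_compact.
by move=> x xab; apply: box_bump_out => /obox_sub_cbox.
Qed.

Lemma box_bump_cvg a b x : box_bump a b k x @[k --> \oo] --> (\1_(obox a b) x : R).
Proof.
rewrite /box_bump /prod_fun indicE.
have -> : (x \in obox a b)%:R = \prod_(i < n) ((0 < x 0 i - a 0 i)%R%:R * (0 < b 0 i - x 0 i)%R%:R) :> R.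
  have [|] := boolP (x \in obox a b); rewrite ?inE ?notin_setE => xab.
    by rewrite big1// => i _; have /andP[xa xb] := xab i; rewrite !subr_gt0 xa xb mulr1.
  have /existsNP[i /negP] := xab; rewrite negb_and => xi; rewrite (bigD1 i)//= !subr_gt0.
  by case/orP: xi => /negPf ->; rewrite ?mulr0 ?mul0r.
apply: cvg_big => [|j _]; first exact: mul_continuous.
apply: cvgM.
  by under eq_fun do rewrite -mulrBr; exact: flat1_cvg.
by under eq_fun do rewrite mulNr addrC -mulrBr; exact: flat1_cvg.
Qed.

End product_functions.

Section integral_supported.
Local Open Scope ereal_scope.

Lemma integral_supported d (X : measurableType d) (R : realType) (mu : {measure set X -> \bar R})
    (A U : set X) (g : X -> \bar R) : A `<=` U ->
  (forall t, U t -> ~ A t -> g t = 0) -> \int[mu]_(t in U) g t = \int[mu]_(t in A) g t.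
Proof.
move=> AU g0; rewrite [LHS]integral_mkcond [RHS]integral_mkcond.
congr integral; apply/funext => x; rewrite !patchE.
case: ifPn; rewrite ?inE ?notin_setE => Ux; case: ifPn; rewrite ?inE ?notin_setE => Ax //.
  exact: g0.
by have := AU _ Ax.
Qed.

End integral_supported.

(** * From test functions to boxes, and from boxes to measurable sets *)

Section fundamental_lemma.
Context {R : realType} {n : nat}.
Local Open Scope ereal_scope.
Local Notation leb := (lebesgue_measure_rV R n).
Local Notation T := (lebesgue_space R n).
Implicit Types (a b x : 'rV[R]_n) (U A : set 'rV[R]_n) (h : 'rV[R]_n -> R).

Let lebc : coord_measurable (lebesgue_outer R n) := @lebesgue_coord_measurable R n.

(** The bumps of the box converge to its indicator and are at most 1, so [|h|], integrable on the
    closed box, dominates. *)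
Lemma integral_obox_eq0 U h a b : open U -> loc_integrable U h ->
  (forall phi, test_function U phi -> \int[leb]_(x in U) (h x * phi x)%:E = 0) ->
  cbox a b `<=` U -> \int[leb]_(x in obox a b) (h x)%:E = 0.
Proof.
move=> oU [mh hK] hphi abU.
have mU : measurable (U : set T) by exact: open_measurable_cara.
have mab : measurable (cbox a b : set T) by apply: compact_measurable_cara => //; exact: cbox_compact.
have mhab : measurable_fun (cbox a b : set T) h by exact: measurable_funS mh.
have ih : leb.-integrable (cbox a b) (EFin \o h).
  by apply/integrableP; split; [exact/measurable_EFinP|exact: hK (@cbox_compact _ _ a b) abU].
have bump0 k : \int[leb]_(x in cbox a b) (h x * box_bump a b k x)%:E = 0.
  rewrite -(hphi _ (test_function_box_bump k abU)); apply/esym/integral_supported => //.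
  by move=> x _ xab; rewrite box_bump_out ?mulr0// => /obox_sub_cbox.
have mbump k : measurable_fun (cbox a b : set T) (box_bump a b k).
  apply: measurable_funTS; apply: continuous_measurable_cara => //.
  exact: (proj1 (proj1 (test_function_box_bump k abU) 0%N)).
have H := @dominated_cvg _ _ _ leb _ mab
  (fun k x => (h x * box_bump a b k x)%:E) (fun x => (h x * \1_(obox a b) x)%:E)
  (fun x => `|h x|%:E).
have {}H : \int[leb]_(x in cbox a b) (h x * box_bump a b k x)%:E @[k --> \oo] -->
    \int[leb]_(x in cbox a b) (h x * \1_(obox a b) x)%:E.
  apply: H => //.
  - by move=> k; apply/measurable_EFinP; apply: measurable_funM.
  - move=> x _; apply: cvg_EFin; first exact: nearW.
    by apply: cvgM; [exact: cvg_cst|exact: box_bump_cvg].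
  - exact: integrable_abse ih.
  - move=> k x _; rewrite lee_fin normrM ler_piMr// ger0_norm ?box_bump_ge0//.
    exact: box_bump_le1.
have : \int[leb]_(x in cbox a b) (h x * \1_(obox a b) x)%:E = 0.
  rewrite -(cvg_lim _ H)//; under eq_fun do rewrite bump0; exact: lim_cst.
rewrite (@integral_supported _ _ _ leb (obox a b)); last 2 first.
- exact: obox_sub_cbox.
- by move=> x _ xab; rewrite indicE memNset ?mulr0.
move=> <-; apply: eq_integral => x xab.
by rewrite indicE xab mulr1.
Qed.

(** A monotone class argument: open boxes are stable under intersection, and the sets over which [h]
    integrates to 0 form a lambda-system, integrability giving differences and, by domination,
    increasing unions. *)
Lemma integral_sigma_obox (h : T -> R) : leb.-integrable [set: T] (EFin \o h) ->
  (forall a b, \int[leb]_(x in obox a b) (h x)%:E = 0) ->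
  forall A, <<s [set obox ab.1 ab.2 | ab in [set: 'rV[R]_n * 'rV[R]_n] ] >> A ->
  \int[leb]_(x in A) (h x)%:E = 0.
Proof.
move=> ih h0; set G := [set _ | _ in _].
pose H := [set A : set T | measurable A /\ \int[leb]_(x in A) (h x)%:E = 0].
have mh : measurable_fun [set: T] h by have /measurable_int/measurable_EFinP := ih.
have GIH : setI_closed G.
  move=> _ _ [[a b] _ <-] [[a' b'] _ <-]; rewrite oboxI.
  by eexists (_, _).
have oT : [set: T] = \bigcup_k obox (const_mx (- k%:R)%R) (const_mx k%:R)%R.
  apply/seteqP; split=> // x _.
  have [k kx] : exists k, (eunorm (x : 'rV[R]_n) < k%:R)%R.
    by exists (Num.truncn (eunorm (x : 'rV[R]_n))).+1; rewrite truncnS_gt// eunorm_ge0.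
  exists k => // i; rewrite !mxE -ltr_norml; exact: le_lt_trans (coord_le_eunorm _ _) kx.
have ndH : ndseq_closed H.
  move=> F ndF HF; split; first by apply: bigcup_measurable => k _; case: (HF k).
  pose hF k x := ((h \_ (F k)) x)%:E.
  have cvF : \int[leb]_x (hF k x) @[k --> \oo] --> \int[leb]_x ((h \_ (\bigcup_k F k)) x)%:E.
    apply: (@dominated_cvg _ _ _ leb _ measurableT hF _ (fun x => `|h x|%:E)) => //.
    - move=> k; apply/measurable_EFinP; apply/(measurable_restrictT _ _).1 => //; first by case: (HF k).
      exact: measurable_funTS.
    - move=> x _; apply: cvg_EFin; first exact: nearW.
      rewrite patchE; case: ifPn; rewrite ?inE ?notin_setE => xF.
        case: xF => k _ Fkx; apply: cvg_near_cst; exists k => // j /= kj.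
        by rewrite /hF/= patchE mem_set//; have /subsetPset := ndF _ _ kj; apply.
      apply: cvg_near_cst; apply: nearW => k; rewrite /hF/= patchE memNset//.
      by apply: contra_not xF => ?; exists k.
    - exact: integrable_abse ih.
    - move=> k x _; rewrite /hF lee_fin patchE; case: ifPn => _//; by rewrite normr0.
  have hFE B : \int[leb]_x ((h \_ B) x)%:E = \int[leb]_(x in B) (h x)%:E.
    by rewrite [RHS]integral_mkcond; congr integral; apply/funext => x; rewrite !patchE; case: ifP.
  rewrite -hFE -(cvg_lim _ cvF)//; under eq_fun do rewrite hFE (proj2 (HF _)).
  exact: lim_cst.
have GH : G `<=` H.
  by move=> _ [[a b] _ <-]; split; [exact: measurable_obox|exact: h0].
have lH : lambda_system setT H.
  split => //.
  - rewrite oT; apply: ndH => [j k jk|k]; last by apply: GH; eexists (_, _).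
    apply/subsetPset => x xj i; have := xj i; rewrite !mxE => /andP[h1 h2].
    have jkR : (j%:R <= k%:R :> R)%R by rewrite ler_nat.
    by rewrite (lt_le_trans h2 jkR) andbT (le_lt_trans _ h1)// lerN2.
  - move=> A B BA [mA A0] [mB B0]; split; first exact: measurableD.
    have := A0; rewrite -{1}(setDUK BA) integral_setU//; last 3 first.
    - exact: measurableD.
    - by apply/measurable_EFinP; exact: measurable_funTS.
    - by rewrite disj_set2E setDIK.
    by rewrite [X in X + _]B0 add0e.
move=> A GA; have [] // := lambda_system_subset GIH lH GH _ GA.
Qed.

End fundamental_lemma.

Section fundamental_lemma_open.
Context {R : realType} {n : nat}.
Local Open Scope ereal_scope.
Local Notation leb := (lebesgue_measure_rV R n).
Local Notation T := (lebesgue_space R n).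
Implicit Types (a b x : 'rV[R]_n) (U A : set 'rV[R]_n) (h : 'rV[R]_n -> R).

Let lebc : coord_measurable (lebesgue_outer R n) := @lebesgue_coord_measurable R n.

Definition oboxes : set (set 'rV[R]_n) :=
  [set obox ab.1 ab.2 | ab in [set: 'rV[R]_n * 'rV[R]_n] ].

Lemma sigma_oboxes_bigcup (F : (set 'rV[R]_n)^nat) :
  (forall k, <<s oboxes >> (F k)) -> <<s oboxes >> (\bigcup_k F k).
Proof. by have [_ _ sU] := @smallest_sigma_algebra _ setT oboxes => HF; exact: (sU F HF). Qed.

Lemma sigma_oboxes_bigcap (F : (set 'rV[R]_n)^nat) :
  (forall k, <<s oboxes >> (F k)) -> <<s oboxes >> (\bigcap_k F k).
Proof.
have [_ sC _] := @smallest_sigma_algebra _ setT oboxes => HF.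
rewrite -[\bigcap_k F k]setCK setC_bigcap -setTD.
by apply: (sC); apply: sigma_oboxes_bigcup => k; rewrite -setTD; exact: sC (HF k).
Qed.

(** In a nearly optimal cover every set has finite [box_volume], so it is empty or a closed box and
    lies in the generated sigma-algebra. *)
Lemma sigma_oboxes_cover A (e : R) : (0 < e)%R -> lebesgue_outer R n A < +oo ->
  exists O, [/\ <<s oboxes >> O, A `<=` O & lebesgue_outer R n O <= lebesgue_outer R n A + e%:E].
Proof.
move=> e0 Aoo.
have Afin : lebesgue_outer R n A \is a fin_num by rewrite ge0_fin_numE ?outer_measure_ge0.
have [_ [F /= AF <-] Fe] := lb_ereal_inf_adherent e0 Afin.
have Foo : \sum_(k <oo) box_volume (F k) < +oo.
  by apply: (lt_le_trans Fe); rewrite leey.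
have Fk k : <<s oboxes >> (F k) /\ lebesgue_outer R n (F k) <= box_volume (F k).
  have Fkoo : box_volume (F k) < +oo.
    apply: le_lt_trans Foo; apply: le_trans (nneseries_lim_ge k.+1 _); last first.
      by move=> j _ _; exact: box_volume_ge0.
    rewrite big_nat_recr//= leeDr// sume_ge0// => j _; exact: box_volume_ge0.
  have [->|Fk0] := eqVneq (F k) set0.
    by rewrite outer_measure0 box_volume0; split => //; have [] := @smallest_sigma_algebra _ setT oboxes.
  move: Fkoo; rewrite /box_volume (negPf Fk0) => Fkoo.
  have [v [a [b [ab FE vE]]] _] := ereal_inf_lt Fkoo.
  split.
    rewrite FE -/(cbox a b) cbox_bigcap_obox.
    by apply: sigma_oboxes_bigcap => j; apply: sub_gen_smallest; eexists (_, _).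
  apply: le_ereal_inf_tmp => _ [a' [b' [ab' -> ->]]]; exact: lebesgue_cbox_le.
exists (\bigcup_k F k); split => //.
  by apply: sigma_oboxes_bigcup => k; case: (Fk k).
apply: le_trans (outer_measure_sigma_subadditive _ _) _.
apply: le_trans (ltW Fe); apply: lee_nneseries => [k _ _|k _].
  exact: outer_measure_ge0.
by case: (Fk k).
Qed.

Lemma sigma_oboxes_measurable : <<s oboxes >> `<=` (measurable : set (set T)).
Proof.
apply: smallest_sub; first exact: sigma_algebra_measurable.
by move=> _ [[a b] _ <-]; exact: measurable_obox.
Qed.

(** Lebesgue measurable sets are those of Caratheodory and need not be generated by boxes.
    Intersecting covers with error [1 / (k + 1)] repairs this up to a null set, which integrals do
    not see. *)
Lemma sigma_oboxes_hull A : measurable (A : set T) -> lebesgue_outer R n A < +oo ->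
  exists O, [/\ <<s oboxes >> O, A `<=` O & lebesgue_outer R n (O `\` A) = 0].
Proof.
move=> mA Aoo.
have Afin : lebesgue_outer R n A \is a fin_num by rewrite ge0_fin_numE ?outer_measure_ge0.
have e0 k : (0 < k.+1%:R^-1 :> R)%R by rewrite invr_gt0.
have := fun k => sigma_oboxes_cover (e0 k) Aoo; move=> /choice[V VP].
exists (\bigcap_k V k); split.
- by apply: sigma_oboxes_bigcap => j; case: (VP j).
- by move=> x Ax k _; case: (VP k) => _ AO _; exact: AO.
apply/eqP; rewrite eq_le outer_measure_ge0 andbT; apply/lee_addgt0Pr => e epos; rewrite add0e.
have [k _ /(_ k (leqnn k))/= ke] := near_infty_natSinv_lt (PosNum epos).
have [sO AO OA] := VP k.
have mO := sigma_oboxes_measurable sO.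
apply: le_trans (_ : lebesgue_outer R n (V k `\` A) <= _).
  by apply: le_outer_measure => x [Ox nAx]; split => //; exact: Ox.
have := mA (V k); rewrite (setIidr AO) -setDE => OE.
move: OA; rewrite OE leeD2lE// => /le_trans; apply.
by rewrite lee_fin ltW.
Qed.

(** The integral of [h] over a hull of the positivity set vanishes, and the hull exceeds that set by
    a null set only; hence a nonnegative function has integral 0 there. *)
Lemma obox_integral_pos_null (h : T -> R) : leb.-integrable [set: T] (EFin \o h) ->
  (forall a b, \int[leb]_(x in obox a b) (h x)%:E = 0) ->
  leb [set x | (0 < h x)%R] < +oo -> leb [set x | (0 < h x)%R] = 0.
Proof.
move=> ih h0 Aoo; set A := [set x | _]; rewrite -/A in Aoo.
have mh : measurable_fun [set: T] h by have /measurable_int/measurable_EFinP := ih.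
have mA : measurable (A : set T).
  rewrite /A (_ : [set x | _] = [set: T] `&` h @^-1` `]0%R, +oo[); first exact: mh.
  by rewrite setTI; apply/seteqP; split=> x /=; rewrite in_itv/= andbT.
have [V [sO AO OA0]] := sigma_oboxes_hull mA Aoo.
have mO := sigma_oboxes_measurable sO.
have mOA : measurable (V `\` A : set T) by exact: measurableD.
have := integral_sigma_obox ih h0 sO.
rewrite (negligible_integral mOA)//; last exact: integrableS ih.
rewrite setDD (setIidr AO) => A0.
have : \int[leb]_(x in A) `|(h x)%:E| = 0.
  by rewrite -[RHS]A0; apply: eq_integral => x; rewrite inE => Ax; rewrite gee0_abs// lee_fin ltW.
have mhA : measurable_fun (A : set T) (EFin \o h) by apply/measurable_EFinP; exact: measurable_funTS.
move=> /(ae_eq_integral_abs leb mA mhA)[N [mN N0 AN]].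
apply/eqP; rewrite eq_le measure_ge0 andbT -N0 le_measure ?inE//.
move=> x Ax; apply: AN => /= /(_ Ax)[] hx.
by move: Ax; rewrite /A/= hx ltxx.
Qed.

(** On each box whose closure lies in [U], the function cut off to the box is globally integrable
    with zero integral over all boxes. The positivity argument, applied to it and to its opposite,
    concludes, and countably many such boxes cover [U]. *)
Lemma fundamental_lemma_calculus_of_variations U h : open U -> loc_integrable U h ->
  (forall phi, test_function U phi -> \int[leb]_(x in U) (h x * phi x)%:E = 0) ->
  {ae leb, forall x, U x -> h x = 0%R}.
Proof.
move=> oU lh hphi; have [mh hK] := lh.
have [P [a [b [abU UE]]]] := open_bigcup_obox oU.
have boxE k : P k -> leb.-negligible [set x | obox (a k) (b k) x /\ h x != 0%R].
  move=> Pk; set B := obox (a k) (b k).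
  have mB : measurable (B : set T) by exact: measurable_obox.
  have BU : B `<=` U by apply: subset_trans (abU k Pk); exact: obox_sub_cbox.
  pose h0 : T -> R := h \_ B.
  have ih : leb.-integrable [set: T] (EFin \o h0).
    rewrite (_ : EFin \o h0 = (EFin \o h) \_ B); last by rewrite restrict_EFin.
    apply/(integrable_mkcond _ mB).1; apply/integrableP; split.
      by apply/measurable_EFinP; apply: measurable_funS mh => //; exact: open_measurable_cara.
    apply: le_lt_trans (hK _ (@cbox_compact _ _ (a k) (b k)) (abU k Pk)).
    apply: ge0_subset_integral => //; last exact: obox_sub_cbox.
      by apply: compact_measurable_cara => //; exact: cbox_compact.
    apply/measurable_EFinP; apply: measurableT_comp => //.
    by apply: measurable_funS mh => //; [exact: open_measurable_cara|exact: abU].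
  have boxfin (X : set T) : X `<=` B -> leb X < +oo.
    move=> XB; pose r := (\sum_(i < n) `|b k 0 i - a k 0 i|)%R.
    have r0 : (0 <= r)%R by exact: sumr_ge0.
    apply: (@le_lt_trans _ _ ((2 * r) ^+ n)%:E); last exact: ltry.
    apply: (@lebesgue_outer_bounded _ _ _ (a k)) => // y /XB yB.
    rewrite (le_trans (eunorm_le_sum _))// ler_sum// => i _; rewrite !mxE distrC.
    have := yB i => /andP[ay yb]; rewrite gtr0_norm ?subr_gt0// gtr0_norm ?subr_gt0 ?(lt_trans ay)//.
    by rewrite lerB// ltW.
  (* The cut-off turns an arbitrary box into its intersection with [B], which is again an open box
     and has its closure in [U]. *)
  have box0 a' b' : \int[leb]_(x in obox a' b') (h0 x)%:E = 0.
    rewrite (_ : \int[leb]_(x in _) _ = \int[leb]_(x in obox a' b' `&` B) (h x)%:E).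
      rewrite oboxI; apply: (integral_obox_eq0 oU lh hphi).
      apply: subset_trans (abU k Pk) => x xab i; have := xab i.
      by rewrite !mxE ge_max le_min => /andP[/andP[_ ->] /andP[_ ->]].
    rewrite [RHS]integral_mkcondr; apply: eq_integral => x _.
    by rewrite /h0 !patchE; case: ifP.
  have pos0 := obox_integral_pos_null ih box0.
  have neg0 : leb [set x | (0 < - h0 x)%R] < +oo -> leb [set x | (0 < - h0 x)%R] = 0.
    apply: obox_integral_pos_null.
      by have := integrableN ih; congr integrable; apply/funext => x /=.
    move=> a' b'; under eq_integral do rewrite EFinN.
    have mo : measurable (obox a' b' : set T) by exact: measurable_obox.
    rewrite (integralN (integrable_add_def mo (integrableS measurableT mo (@subsetT _ _) ih))).
    by rewrite box0 oppe0.
  have h0B x : h0 x != 0%R -> B x.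
    by rewrite /h0 patchE; case: ifPn; rewrite ?inE// eqxx.
  have mh0 : measurable_fun [set: T] h0 by have /measurable_int/measurable_EFinP := ih.
  have mpos (g : T -> R) : measurable_fun [set: T] g -> measurable [set x | (0 < g x)%R].
    move=> mg; rewrite (_ : [set x | _] = [set: T] `&` g @^-1` `]0%R, +oo[); first exact: mg.
    by rewrite setTI; apply/seteqP; split=> x /=; rewrite in_itv/= andbT.
  exists ([set x | (0 < h0 x)%R] `|` [set x | (0 < - h0 x)%R]); split.
  - by apply: measurableU; apply: mpos => //; exact: measurableT_comp.
  - have mneg : measurable_fun [set: T] (fun x => - h0 x)%R by exact: measurableT_comp.
    have H := measureU2 leb (mpos _ mh0) (mpos _ mneg).
    have posE : leb [set x | (0 < h0 x)%R] = 0.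
      by apply: pos0; apply: boxfin => x /= hx; apply: h0B; rewrite gt_eqF.
    have negE : leb [set x | (0 < - h0 x)%R] = 0.
      by apply: neg0; apply: boxfin => x /= hx; apply: h0B; rewrite -oppr_eq0 gt_eqF.
    have H0 : leb [set x | (0 < h0 x)%R] + leb [set x | (0 < - h0 x)%R] <= 0 by rewrite posE negE adde0.
    by apply/eqP; rewrite eq_le measure_ge0 andbT; exact: le_trans H H0.
  move=> x [Bx hx]; have h0x : h0 x = h x by rewrite /h0 patchE mem_set.
  rewrite /= h0x oppr_gt0; have [| |h00] := ltgtP (h x) 0%R; [by right|by left|].
  by rewrite h00 eqxx in hx.
have : leb.-negligible (\bigcup_k (if k \in P then [set x | obox (a k) (b k) x /\ h x != 0%R] else set0)).
  apply: negligible_bigcup => k; case: ifPn; first by rewrite inE; exact: boxE.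
  by move=> _; exact: negligible_set0.
apply: negligibleS => x /=.
move=> /not_implyP[]; rewrite {1}UE => -[k Pk xk] /eqP hx; exists k => //.
by rewrite mem_set.
Qed.

End fundamental_lemma_open.

(** * Integration by parts *)

Section continuity.
Context {R : realType} {n : nat}.
Implicit Types (x y : 'rV[R]_n) (f : 'rV[R]_n -> R).

Lemma eudist_continuous f :
  (forall x e, 0 < e -> exists2 d, 0 < d & forall y, eudist x y < d -> `|f x - f y| < e) ->
  continuous f.
Proof.
move=> H; apply/continuousP => A oA; apply/open_eballP => x Afx.
have /nbhs_ballP[e /= e0 eA] : nbhs (f x) A by exact: open_nbhs_nbhs.
have [d d0 Hd] := H x e e0; exists d => // y xy.
by apply: eA; exact: Hd.
Qed.

Lemma eudist_lipschitz_continuous f (L : R) :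
  (forall x y, `|f x - f y| <= L * eudist x y) -> continuous f.
Proof.
move=> fL; apply: eudist_continuous => x e e0; exists (e / (`|L| + 1)).
  by rewrite divr_gt0// ltr_wpDl.
move=> y; rewrite ltr_pdivlMr ?ltr_wpDl// => xy.
apply: le_lt_trans (fL x y) _; apply: le_lt_trans xy.
by rewrite mulrC ler_wpM2l ?eudist_ge0// (le_trans (ler_norm _))// lerDl.
Qed.

Lemma eudist_continuousr x : continuous (eudist x).
Proof.
apply: (@eudist_lipschitz_continuous _ 1) => y z; rewrite mul1r ler_norml.
have h1 := eudist_triangle y x z; have h2 := eudist_triangle z x y.
by rewrite (eudistC z y) in h2; lra.
Qed.

Lemma compact_eunorm_bounded (K : set 'rV[R]_n) : compact K ->
  exists2 r, 0 <= r & forall x, K x -> eunorm x <= r.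
Proof.
move=> cK; have [K0|/set0P[x0 Kx0]] := eqVneq K set0.
  by exists 0 => // x; rewrite K0.
have [|c Kc cmax] := @EVT_max_rV R n (eudist 0) K (ex_intro _ x0 Kx0) cK.
  by apply: continuous_subspaceT; exact: eudist_continuousr.
exists (eudist 0 c) => [|x Kx]; first exact: eudist_ge0.
rewrite (_ : eunorm x = eudist 0 x); last by rewrite eudistC /eudist subr0.
by apply: cmax; rewrite inE.
Qed.

Lemma compactly_supported_bounded f (K : set 'rV[R]_n) : continuous f -> compact K ->
  (forall x, ~ K x -> f x = 0) -> exists2 C, 0 <= C & forall x, `|f x| <= C.
Proof.
move=> cf cK f0; have [K0|/set0P[x0 Kx0]] := eqVneq K set0.
  by exists 0 => // x; rewrite f0 ?normr0// K0.
have [|c Kc cmax] := @EVT_max_rV R n (fun x => `|f x|) K (ex_intro _ x0 Kx0) cK.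
  apply: continuous_subspaceT => x; apply: continuous_comp; first exact: cf.
  exact: norm_continuous.
exists `|f c| => // x; have [Kx|Kx] := pselect (K x); last by rewrite f0// normr0.
by apply: cmax; rewrite inE.
Qed.

End continuity.

Section integration_by_parts.
Context {R : realType} {n : nat}.
Local Notation leb := (lebesgue_measure_rV R n).
Local Notation T := (lebesgue_space R n).
Implicit Types (f v phi : 'rV[R]_n -> R) (x : 'rV[R]_n).

Let lebc : coord_measurable (lebesgue_outer R n) := @lebesgue_coord_measurable R n.

Definition dir_along f x h : R -> R := fun t => f (x + t *: h).

(** Rebasing the line at [x + t *: h] reduces the derivative at [t] to a derivative at 0. *)
Lemma is_derive_dir_along f df h x t :
  (forall x, is_derive (0 : R) (1 : R) (dir_along f x h) (df x)) ->
  is_derive t (1 : R) (dir_along f x h) (df (x + t *: h)).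
Proof.
move=> fd.
have -> : dir_along f x h = dir_along f (x + t *: h) h \o (fun s => s - t).
  apply/funext => s; by rewrite /dir_along/= -addrA -scalerDl [t + _]addrC subrK.
have H1 : is_derive t (1 : R) (fun s : R => s - t) 1.
  have -> : (fun s : R => s - t) = id - cst t by [].
  by apply: is_derive_eq; rewrite subr0.
have H2 := fd (x + t *: h); rewrite -(subrr t) in H2.
by have := @is_derive1_comp _ (dir_along f (x + t *: h) h) (fun s => s - t) t _ _ H2 H1; rewrite mulr1.
Qed.

Lemma dir_along_lipschitz f df h (C : R) :
  (forall x, is_derive (0 : R) (1 : R) (dir_along f x h) (df x)) ->
  forall x t, 0 < t -> (forall s, 0 <= s <= t -> `|df (x + s *: h)| <= C) ->
  `|f (x + t *: h) - f x| <= C * t.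
Proof.
move=> fd x t t0 dfC.
have fd' s := is_derive_dir_along x s fd.
have cf : {within `[0, t], continuous (dir_along f x h)}.
  apply: continuous_subspaceT; exact: is_derive1_continuous fd'.
have [c c0t] := MVT t0 (fun s _ => fd' s) cf.
rewrite /dir_along scale0r addr0 subr0 => ->.
rewrite normrM (gtr0_norm t0) ler_wpM2r ?(ltW t0)// dfC//.
by move: c0t; rewrite in_itv/= => /andP[/ltW -> /ltW ->].
Qed.

Lemma bounded_supported_integrable f (C r : R) :
  measurable_fun [set: T] (f : T -> R) -> (forall x, `|f x| <= C) -> 0 <= r ->
  (forall x, r <= eunorm x -> f x = 0) -> leb.-integrable [set: T] (EFin \o f).
Proof.
move=> mf fC r0 f0; apply/integrableP; split; first exact/measurable_EFinP.
have mB : measurable (eball 0 r : set T) by apply: open_measurable_cara => //; exact: eball_open.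
rewrite (@integral_supported _ _ _ leb (eball 0 r))//; last first.
  move=> x _; rewrite /eball/= eudistC /eudist subr0 => /negP; rewrite -leNgt => rx.
  by rewrite f0// normr0.
apply: (@le_lt_trans _ _ (\int[leb]_(x in eball 0 r) C%:E)%E).
  have mf' : measurable_fun [set: T] (fun x => `|(f x)%:E|)%E.
    by apply/measurable_EFinP; exact: (measurableT_comp (@normr_measurable R setT) mf).
  apply: ge0_le_integral.
  - exact: mB.
  - by move=> x _; exact: abse_ge0.
  - exact: (measurable_funTS mf').
  - exact: measurable_cst.
  - by move=> x _; rewrite lee_fin.
rewrite integral_cst//; apply: lte_mul_pinfty; rewrite ?lee_fin//.
  by apply: le_trans (fC 0).
by rewrite (le_lt_trans (lebesgue_eball_le 0 r0))// ltry.
Qed.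

(** By translation invariance the difference quotients integrate to 0. They are bounded by [C]
    through the mean value theorem and vanish off one ball, so the limit may be taken under the
    integral; this avoids Fubini in coordinates. *)
Lemma integral_derivative_eq0 f df (i : 'I_n) (K : set 'rV[R]_n) (C : R) : compact K ->
  measurable_fun [set: T] (f : T -> R) -> measurable_fun [set: T] (df : T -> R) ->
  (forall x, `|f x| <= C) -> (forall x, `|df x| <= C) ->
  (forall x, ~ K x -> f x = 0) ->
  (forall x, is_derive (0 : R) (1 : R) (along f x i) (df x)) ->
  (\int[leb]_x (df x)%:E = 0)%E.
Proof.
move=> cK mf mdf fC dfC fK fd.
have [r r0 Kr] := compact_eunorm_bounded cK.
pose e : 'rV[R]_n := delta_mx 0 i.
pose t (k : nat) : R := k.+1%:R^-1.
have t0 k : 0 < t k by rewrite invr_gt0.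
have t1 k : t k <= 1 by rewrite invf_le1// ler1n.
have C0 : 0 <= C by apply: le_trans (fC 0).
pose dq k x := (f (x + t k *: e) - f x) / t k.
have mshift k : measurable_fun [set: T] (fun x : T => f ((x : 'rV[R]_n) + t k *: e)).
  exact: measurableT_comp mf (measurable_shift_rV (t k *: e)).
have mdq k : measurable_fun [set: T] (dq k : T -> R).
  exact: (measurable_funM (measurable_funB (mshift k) mf) (measurable_cst _)).
have f_out x : r < eunorm x -> f x = 0.
  by move=> rx; apply: fK => /Kr; rewrite leNgt rx.
have fint : leb.-integrable [set: T] (EFin \o f).
  apply: (bounded_supported_integrable mf fC (addr_ge0 r0 ler01)).
  by move=> x rx; apply: f_out; rewrite (lt_le_trans _ rx)// ltrDl.
have shift_out k x : r + 1 < eunorm x -> f (x + t k *: e) = 0.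
  move=> rx; apply: f_out; rewrite -(ltrD2r 1) (lt_le_trans rx)//.
  have := eunormD (x + t k *: e) (- (t k *: e)); rewrite addrK eunormN eunormZ eunorm_delta mulr1.
  by rewrite ger0_norm ?(ltW (t0 _))// => /le_trans; apply; rewrite lerD2l.
have fsint k : leb.-integrable [set: T] (EFin \o (fun x => f (x + t k *: e))).
  apply: (bounded_supported_integrable (mshift k) (fun x => fC _) (addr_ge0 r0 (ler0n _ 2))).
  by move=> x rx; apply: shift_out; rewrite (lt_le_trans _ rx)// ltrD2l ltr1n.
have dq0 k : (\int[leb]_x (dq k x)%:E = 0)%E.
  rewrite /dq; under eq_integral do rewrite mulrC EFinM.
  rewrite (integralZl measurableT (integrableB measurableT (fsint k) fint)).
  rewrite (integralB measurableT (fsint k) fint).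
  have -> : (\int[leb]_x (f (x + t k *: e))%:E = \int[leb]_x (f x)%:E)%E.
    exact: (@integral_shift_rV _ _ (t k *: e) (EFin \o f) (measurable_int _ fint)).
  by rewrite subee ?mule0//; exact: (integrable_fin_num measurableT fint).
(* The steps [t k] are at most 1, so every shifted support lies within [r + 1] of the origin; radius
   [r + 2] leaves a strict margin. *)
have mB : measurable_fun [set: T] (fun x : T => C * \1_(eball 0 (r + 2)) x).
  apply: (measurable_funM (measurable_cst _)); apply: measurable_indic.
  by apply: (open_measurable_cara lebc); exact: eball_open.
have cv : (\int[leb]_x (dq k x)%:E)%E @[k --> \oo] --> (\int[leb]_x (df x)%:E)%E.
  apply: (@dominated_cvg _ _ _ leb _ measurableT (fun k x => (dq k x)%:E) _
    (fun x => (C * \1_(eball 0 (r + 2)) x)%:E)).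
  - by move=> k; apply/measurable_EFinP; exact: mdq.
  - move=> x _; apply: cvg_EFin; first exact: nearW.
    have [/cvg_ex[l fl] dE] := fd x.
    have El : df x = l by rewrite -dE; exact: cvg_lim.
    have tc : (forall k, t k != 0) /\ t k @[k --> \oo] --> (0 : R).
      by split=> [k|]; [rewrite gt_eqF|exact: cvg_harmonic].
    rewrite El; move: fl => /cvgr_dnbhsP/(_ _ tc).
    have -> : (fun k => (t k)^-1 *: (along f x i (t k *: (1 : R) + 0) - along f x i 0)) = dq^~ x.
      apply/funext => k; rewrite /dq /along scale0r addr0 addr0 mulrC.
      by rewrite /GRing.scale/= mulr1.
    by [].
  - by [].
  - apply: (@bounded_supported_integrable _ C (r + 2) mB _ (addr_ge0 r0 (ler0n _ 2))).
    + by move=> x; rewrite indicE normrM (ger0_norm C0) ger0_norm// ler_piMr// lern1 leq_b1.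
    + move=> x rx; rewrite indicE memNset ?mulr0//= /eball/= eudistC /eudist subr0.
      by apply/negP; rewrite -leNgt.
  - move=> k x _; rewrite lee_fin indicE; have [xr|xr] := boolP (x \in eball 0 (r + 2)).
      rewrite mulr1 normrM normfV (gtr0_norm (t0 k)) ler_pdivrMr//.
      exact: (dir_along_lipschitz (h := e) (df := df)).
    move: xr; rewrite notin_setE/= /eball/= eudistC /eudist subr0 => /negP.
    rewrite -leNgt => rx; rewrite mulr0 /dq (shift_out k x) ?(f_out x) ?subr0 ?mul0r ?normr0//.
      by rewrite (lt_le_trans _ rx)// ltrDl.
    by rewrite (lt_le_trans _ rx)// ltrD2l ltr1n.
rewrite -(cvg_lim _ cv)//; under eq_fun do rewrite dq0; exact: lim_cst.
Qed.

Lemma partial_eq0_off_compact (K : set 'rV[R]_n) phi i : compact K ->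
  (forall x, ~ K x -> phi x = 0) -> forall x, ~ K x -> partial i phi x = 0.
Proof.
move=> cK phi0 x Kx; have [l /= l0 lK] : exists2 l, 0 < l & eball x l `<=` ~` K.
  have oK : open (~` K) by rewrite openC; apply: compact_closed => //; exact: norm_hausdorff.
  exact: (open_eballP _).1 oK x Kx.
rewrite /partial derive1E.
suff H : is_derive (0 : R) (1 : R) (along phi x i) 0 by case: H.
apply: near_eq_is_derive (is_derive_cst (0 : R) (0 : R) (1 : R)).
near=> t; rewrite /along phi0//; apply: lK.
rewrite /eball/= /eudist opprD addrA subrr sub0r eunormN eunormZ eunorm_delta mulr1.
by near: t; exact: (@nbhs0_lt R R^o l l0).
Unshelve. all: by end_near. Qed.

(** The product [v * phi] has compact support, so the integral of its derivative is 0 and the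
    product rule gives the identity. *)
Lemma integral_mul_partial (U : set 'rV[R]_n) v dv (i : 'I_n) (C : R) phi : open U ->
  measurable_fun [set: T] (v : T -> R) -> measurable_fun [set: T] (dv : T -> R) ->
  (forall x, `|v x| <= C) -> (forall x, `|dv x| <= C) ->
  (forall x, is_derive (0 : R) (1 : R) (along v x i) (dv x)) ->
  test_function U phi ->
  (\int[leb]_(x in U) (v x * partial i phi x)%:E = - \int[leb]_(x in U) (dv x * phi x)%:E)%E.
Proof.
move=> oU mv mdv vC dvC vd [phiC [K [cK KU phi0]]].
have [cphi /(_ i)[dphi [cdphi _]]] := phiC 1%N.
have phid x : is_derive (0 : R) (1 : R) (along phi x i) (partial i phi x).
  by rewrite /partial derive1E; exact: derivableP.
have dphi0 := partial_eq0_off_compact i cK phi0.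
have [A A0 phiA] := compactly_supported_bounded cphi cK phi0.
have [B B0 dphiB] := compactly_supported_bounded cdphi cK dphi0.
have [r r0 Kr] := compact_eunorm_bounded cK.
have C0 : 0 <= C by apply: le_trans (vC 0).
have mphi : measurable_fun [set: T] (phi : T -> R) by exact: (continuous_measurable_cara lebc cphi).
have mdphi : measurable_fun [set: T] (partial i phi : T -> R).
  exact: (continuous_measurable_cara lebc cdphi).
have outK x : r + 1 <= eunorm x -> ~ K x.
  by move=> rx /Kr; apply/negP; rewrite -ltNge (lt_le_trans _ rx)// ltrDl.
have r1 : 0 <= r + 1 by rewrite addr_ge0.
have int1 : leb.-integrable [set: T] (EFin \o (fun x => v x * partial i phi x)).
  apply: (@bounded_supported_integrable _ (C * B) (r + 1) (measurable_funM mv mdphi) _ r1).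
  - by move=> x; rewrite normrM ler_pM.
  - by move=> x /outK/dphi0 /= ->; rewrite mulr0.
have int2 : leb.-integrable [set: T] (EFin \o (fun x => dv x * phi x)).
  apply: (@bounded_supported_integrable _ (C * A) (r + 1) (measurable_funM mdv mphi) _ r1).
  - by move=> x; rewrite normrM ler_pM.
  - by move=> x /outK/phi0 /= ->; rewrite mulr0.
have setTE (g : 'rV[R]_n -> R) : (forall x, ~ K x -> g x = 0) ->
    (\int[leb]_(x in U) (g x)%:E = \int[leb]_x (g x)%:E)%E.
  move=> g0; rewrite (@integral_supported _ _ _ leb K)//; last by move=> x _ /g0 ->.
  by rewrite [RHS](@integral_supported _ _ _ leb K)//; move=> x _ /g0 ->.
rewrite !setTE; last 2 first.
  by move=> x /phi0 ->; rewrite mulr0.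
  by move=> x /dphi0 ->; rewrite mulr0.
have : (\int[leb]_x (v x * partial i phi x + dv x * phi x)%:E = 0)%E.
  apply: (@integral_derivative_eq0 (fun x => v x * phi x) _ i K (C * A + (C * B + C * A)) cK
    (measurable_funM mv mphi) (measurable_funD (measurable_funM mv mdphi) (measurable_funM mdv mphi))).
  - move=> x; rewrite normrM (@le_trans _ _ (C * A)) ?ler_pM// lerDl.
    by rewrite addr_ge0// mulr_ge0.
  - move=> x; rewrite (le_trans (ler_normD _ _))// !normrM.
    apply: (@le_trans _ _ (C * B + C * A)); first by rewrite lerD ?ler_pM.
    by rewrite lerDr mulr_ge0.
  - by move=> x /phi0 ->; rewrite mulr0.
  - move=> x; have := is_deriveM (vd x) (phid x).
    by rewrite /along scale0r addr0 /GRing.scale/= [phi x * _]mulrC.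
under eq_integral do rewrite EFinD.
rewrite (integralD measurableT int1 int2) => /eqP; rewrite -[in X in X -> _](oppeK (\int[leb]_x (dv x * phi x)%:E)%E).
rewrite sube_eq; last 2 first.
- exact: (integrable_fin_num measurableT int1).
- by rewrite fin_num_adde_defl// fin_numN; exact: (integrable_fin_num measurableT int2).
by rewrite add0e => /eqP.
Unshelve. all: by end_near. Qed.

End integration_by_parts.

(** * Dyadic estimates and weighted averages *)

Section powR_extra.
Context {R : realType}.
Implicit Types (x y e s : R).

Lemma powRN_le x y e : 0 <= e -> 0 < x -> x <= y -> y `^ (- e) <= x `^ (- e).
Proof.
move=> e0 x0 xy; have y0 := lt_le_trans x0 xy.
rewrite !powRN lef_pV2 ?posrE ?powR_gt0//.
by apply: ge0_ler_powR => //; rewrite nnegrE ltW.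
Qed.

Lemma powR_exp2 (k : nat) s : (2 ^+ k : R) `^ s = (2 `^ s) ^+ k.
Proof. by rewrite -(powR_mulrn k (ler0n R 2)) -powRrM mulrC powRrM powR_mulrn ?powR_ge0. Qed.

Lemma powR2N_itv s : 0 < s -> 0 <= (2 : R) `^ (- s) < 1.
Proof.
move=> s0; rewrite powR_ge0/= powRN invf_lt1 ?powR_gt0//.
have := @gt0_ltr_powR R s s0 1 2; rewrite powR1 !nnegrE; apply => //.
by rewrite ltr1n.
Qed.

Lemma exists_dyadic_above (t x : R) : 0 < t -> t <= x ->
  exists k : nat, 2 ^+ k * t <= x < 2 ^+ k.+1 * t.
Proof.
move=> t0 tx.
have exk : exists k : nat, x < 2 ^+ k.+1 * t.
  exists (Num.truncn (x / t)).+1; rewrite -ltr_pdivrMr//.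
  rewrite (lt_trans (truncnS_gt _))// -natrX ltr_nat.
  exact: ltn_trans (ltnSn _) (ltn_expl _ _).
case: (ex_minnP exk) => -[|k] xk kmin; first by exists 0%N; rewrite expr0 mul1r tx.
exists k.+1; rewrite xk andbT leNgt; apply/negP => /kmin.
by rewrite ltnn.
Qed.

Lemma exists_dyadic_below (r x : R) : 0 < x -> x < r ->
  exists k : nat, 2^-1 ^+ k.+1 * r <= x < 2^-1 ^+ k * r.
Proof.
move=> x0 xr; have r0 := lt_trans x0 xr.
have exk : exists k : nat, 2^-1 ^+ k.+1 * r <= x.
  exists (Num.truncn (r / x)).+1; rewrite exprVn mulrC ler_pdivrMr ?exprn_gt0//.
  rewrite mulrC -ler_pdivrMr// ltW// (lt_trans (truncnS_gt _))// -natrX ltr_nat.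
  exact: ltn_trans (ltnSn _) (ltn_expl _ _).
case: (ex_minnP exk) => -[|k] xk kmin; first by exists 0%N; rewrite xk expr0 mul1r.
exists k.+1; rewrite xk/= ltNge; apply/negP => /kmin.
by rewrite ltnn.
Qed.

End powR_extra.

Section dyadic.
Context d (X : measurableType d) (R : realType) (mu : {measure set X -> \bar R}).
Variables (D : set X) (rho : X -> R) (A N : R).
Hypotheses (mD : measurable D) (mrho : measurable_fun D rho) (A_ge0 : 0 <= A) (N_ge0 : 0 <= N).
Hypothesis growth : forall r : R, 0 < r ->
  (mu (D `&` [set x | (rho x < r)%R]) <= (A * r `^ N)%R%:E)%E.
Local Open Scope ereal_scope.

Let mlt (r : R) : measurable (D `&` [set x | (rho x < r)%R]).
Proof.
rewrite (_ : [set x | _] = rho @^-1` `]-oo, r[%classic); first exact: mrho.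
by apply/seteqP; split => x /=; rewrite in_itv.
Qed.

(** The function is dominated by the series of [c k] times the indicators of the sublevel sets
    [rho < r k]; the growth bound turns its integral into a geometric series of ratio [q]. *)
Lemma integral_dyadic_le (D' : set X) (f : X -> R) (c r : R^nat) (a q : R) :
  measurable D' -> D' `<=` D -> measurable_fun D' f ->
  (forall x, D' x -> (0 <= f x)%R) -> (forall k, 0 <= c k)%R -> (forall k, 0 < r k)%R ->
  (forall x, D' x -> exists k, (f x <= c k)%R /\ (rho x < r k)%R) ->
  (0 <= a)%R -> (0 <= q < 1)%R ->
  (forall k, c k * (A * r k `^ N) = a * q ^+ k)%R ->
  \int[mu]_(x in D') (f x)%:E <= (a / (1 - q))%:E.
Proof.
move=> mD' D'D mf f0 c0 r0 fc a0 /andP[q0 q1] E.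
pose B k := D `&` [set x | (rho x < r k)%R].
pose g k x : \bar R := (c k * \1_(B k) x)%:E.
have mB k : measurable (B k) by exact: mlt.
have mg k : measurable_fun D' (g k).
  apply/measurable_EFinP; apply: measurable_funM => //; exact: measurable_indic.
have g0 k x : 0 <= g k x by rewrite lee_fin mulr_ge0.
apply: (@le_trans _ _ (\int[mu]_(x in D') \sum_(k <oo) g k x)).
  apply: ge0_le_integral => //.
  - exact/measurable_EFinP.
  - by apply: ge0_emeasurable_sum.
  - move=> x D'x; have [k [fck rk]] := fc x D'x.
    apply: le_trans (nneseries_lim_ge k.+1 _); last by move=> *; exact: g0.
    rewrite big_nat_recr//= (@le_trans _ _ (g k x))//; last by rewrite leeDr// sume_ge0.
    by rewrite /g indicE mem_set ?mulr1 ?lee_fin//; split => //; exact: D'D.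
rewrite integral_nneseries//.
apply: lime_le; first by apply: is_cvg_nneseries => *; exact: integral_ge0.
apply: nearW => m.
apply: (@le_trans _ _ (\sum_(0 <= k < m) (a * q ^+ k)%:E)).
  apply: lee_sum => k _; rewrite -E EFinM /g.
  under eq_integral do rewrite EFinM.
  rewrite ge0_integralZl ?lee_fin//; last first.
    by apply/measurable_EFinP; exact: measurable_indic.
  rewrite lee_wpmul2l ?lee_fin// integral_indic//.
  apply: le_trans (growth (r0 k)); apply: le_measure; rewrite ?inE.
  - exact: measurableI.
  - exact: mB.
  - by move=> x [].
rewrite sumEFin lee_fin -[leLHS]/(series (geometric a q) m) geometric_seriesE ?lt_eqF//.
rewrite ler_wpM2r ?invr_ge0 ?subr_ge0 ?(ltW q1)//.
by rewrite ler_piMr// gerBl exprn_ge0.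
Qed.

(** Layers [2^k t <= rho < 2^(k+1) t]: the negative power is taken at the inner radius and the
    growth bound at the outer one, whence the factor [2^N] and the ratio [2^-s]. *)
Lemma integral_powRN_far (s t : R) : (0 < s)%R -> (0 < t)%R ->
  \int[mu]_(x in D `&` [set x | (t <= rho x)%R]) (rho x `^ (- (N + s)))%:E <=
  (A * 2 `^ N / (1 - 2 `^ (- s)) * t `^ (- s))%:E.
Proof.
move=> s0 t0; rewrite mulrAC.
have q0 := powR2N_itv s0.
have mD' : measurable (D `&` [set x | (t <= rho x)%R]).
  rewrite (_ : [set x | _] = rho @^-1` `[t, +oo[%classic); first exact: mrho.
  by apply/seteqP; split => x /=; rewrite in_itv/= andbT.
apply: (@integral_dyadic_le _ _ (fun k => (2 ^+ k * t) `^ (- (N + s)))%R (fun k => 2 ^+ k.+1 * t)%R) => //.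
- apply: (measurableT_comp (measurable_powR _)) => //; apply: measurable_funS mrho => //; exact: subIsetl.
- by move=> x _; exact: powR_ge0.
- by move=> k; exact: powR_ge0.
- by move=> k; rewrite mulr_gt0 ?exprn_gt0.
- move=> x [_ /= tx]; have [k /andP[kx xk]] := exists_dyadic_above t0 tx.
  exists k; split => //; apply: powRN_le => //; first by rewrite addr_ge0 ?(ltW s0).
  by rewrite mulr_gt0 ?exprn_gt0.
- by rewrite mulr_ge0 ?powR_ge0// mulr_ge0 ?powR_ge0.
- move=> k; set y := (2 ^+ k * t)%R; have y0 : (0 < y)%R by rewrite mulr_gt0 ?exprn_gt0.
  rewrite exprS -mulrA -/y powRM ?(ltW y0)// opprD addrC powRD; last by rewrite (gt_eqF y0) implybT.
  have yE : (y `^ (- s) = (2 `^ (- s)) ^+ k * t `^ (- s))%R.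
    by rewrite /y powRM ?exprn_ge0 ?(ltW t0)// powR_exp2.
  rewrite yE.
  have -> : (y `^ (- N) = (y `^ N)^-1)%R by rewrite powRN.
  have yN : (y `^ N != 0)%R by rewrite gt_eqF ?powR_gt0.
  by field.
Qed.

(** Same scheme with layers shrinking to 0; the exponent being [s] below the growth exponent, the
    ratio is again [2^-s]. *)
Lemma integral_powRN_near (s r : R) : (0 < s)%R -> (s <= N)%R -> (0 < r)%R ->
  \int[mu]_(x in D `&` [set x | (0 < rho x < r)%R]) (rho x `^ (- (N - s)))%:E <=
  (A * 2 `^ (N - s) / (1 - 2 `^ (- s)) * r `^ s)%:E.
Proof.
move=> s0 sN r0; rewrite mulrAC.
have q0 := powR2N_itv s0.
have mD' : measurable (D `&` [set x | (0 < rho x < r)%R]).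
  rewrite (_ : [set x | _] = rho @^-1` `]0%R, r[%classic); first exact: mrho.
  by apply/seteqP; split => x /=; rewrite in_itv.
apply: (@integral_dyadic_le _ _ (fun k => (2^-1 ^+ k.+1 * r) `^ (- (N - s)))%R (fun k => 2^-1 ^+ k * r)%R) => //.
- apply: (measurableT_comp (measurable_powR _)) => //; apply: measurable_funS mrho => //; exact: subIsetl.
- by move=> x _; exact: powR_ge0.
- by move=> k; exact: powR_ge0.
- by move=> k; rewrite mulr_gt0 ?exprn_gt0.
- move=> x [_ /= /andP[x0 xr]]; have [k /andP[kx xk]] := exists_dyadic_below x0 xr.
  exists k; split => //; apply: powRN_le => //; first by rewrite subr_ge0.
  by rewrite mulr_gt0 ?exprn_gt0.
- by rewrite mulr_ge0 ?powR_ge0// mulr_ge0 ?powR_ge0.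
- move=> k; set y := (2^-1 ^+ k * r)%R; have y0 : (0 < y)%R by rewrite mulr_gt0 ?exprn_gt0.
  rewrite exprS -mulrA -/y powRM ?(ltW y0)// opprB [(y `^ _)%R]powRD; last by rewrite (gt_eqF y0) implybT.
  have -> : (2^-1 `^ (s - N) = 2 `^ (N - s) :> R)%R.
    by rewrite -powR_inv1// -powRrM mulN1r opprB.
  have yE : (y `^ s = (2 `^ (- s)) ^+ k * r `^ s)%R.
    rewrite /y powRM ?exprn_ge0 ?(ltW r0)// exprVn -powR_inv1 ?exprn_ge0// -powRrM mulN1r.
    by rewrite powR_exp2.
  rewrite yE.
  have -> : (y `^ (- N) = (y `^ N)^-1)%R by rewrite powRN.
  have yN : (y `^ N != 0)%R by rewrite gt_eqF ?powR_gt0.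
  by field.
Qed.

End dyadic.

Section weighted_average.
Context d (X : measurableType d) (R : realType) (nu : {measure set X -> \bar R}).
Variables (E : set X) (mE : measurable E).
Implicit Types (f g u k : X -> R).

Lemma integrable_mul_bounded u g (C : R) : nu.-integrable E (EFin \o u) ->
  measurable_fun E g -> (forall y, E y -> `|g y| <= C) ->
  nu.-integrable E (EFin \o (fun y => u y * g y)).
Proof.
move=> iu mg gC.
apply: (le_integrable mE _ _ (integrableZl mE C iu)).
  apply/measurable_EFinP; apply: (measurable_funM _ mg).
  by have /measurable_int/measurable_EFinP := iu.
move=> y Ey; rewrite /= lee_fin normrM mulrC normrM ler_wpM2r//.
exact: le_trans (gC y Ey) (ler_norm _).
Qed.

Section jensen.
Variables (p : R) (k : X -> R).
Hypotheses (p_gt1 : 1 < p) (mk : measurable_fun E k) (k_ge0 : forall y, E y -> 0 <= k y).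
Hypothesis k1 : (\int[nu]_(y in E) (k y)%:E = 1)%E.

Let p_gt0 : 0 < p. Proof. exact: lt_trans ltr01 p_gt1. Qed.

(** Young's inequality at the conjugate exponent [q], applied to [f] and [c^(p-1)], integrates to
    [c^p <= I / p + c^p / q], because [k] has mass 1 and [(p - 1) q = p]. Since [1 - 1/q = 1/p],
    this is the claim. *)
Lemma jensen_powR f (c : R) : measurable_fun E f -> (forall y, E y -> 0 <= f y) ->
  (\int[nu]_(y in E) (f y * k y)%:E = c%:E)%E ->
  ((c `^ p)%:E <= \int[nu]_(y in E) (f y `^ p * k y)%:E)%E.
Proof.
move=> mf f0 fc.
have mfp : measurable_fun E (fun y => f y `^ p) by exact: measurableT_comp (measurable_powR _) mf.
have I0 : (0 <= \int[nu]_(y in E) (f y `^ p * k y)%:E)%E.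
  by apply: integral_ge0 => y Ey; rewrite lee_fin mulr_ge0 ?powR_ge0 ?k_ge0.
have c0 : 0 <= c.
  by rewrite -lee_fin -fc; apply: integral_ge0 => y Ey; rewrite lee_fin mulr_ge0 ?f0 ?k_ge0.
have [->|cN0] := eqVneq c 0; first by rewrite powR0 ?gt_eqF.
have cpos : 0 < c by rewrite lt_def cN0.
have [->|Ioo] := eqVneq (\int[nu]_(y in E) (f y `^ p * k y)%:E)%E +oo%E; first by rewrite leey.
have Ifin : (\int[nu]_(y in E) (f y `^ p * k y)%:E)%E \is a fin_num by rewrite ge0_fin_numE// ltey.
pose q := p / (p - 1).
have p10 : 0 < p - 1 by rewrite subr_gt0.
have q0 : 0 < q by rewrite divr_gt0.
have pq : p^-1 + q^-1 = 1 by rewrite /q invf_div; field; rewrite gt_eqF.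
have young y : E y -> c `^ (p - 1) * (f y * k y) <= p^-1 * (f y `^ p * k y) + q^-1 * c `^ p * k y.
  move=> Ey; have := @conjugate_powR R (f y) (c `^ (p - 1)) p q (f0 y Ey) (powR_ge0 _ _) p_gt0 q0 pq.
  rewrite -powRrM (_ : (p - 1) * q = p); last by rewrite /q mulrC divfK ?gt_eqF.
  move=> /(ler_wpM2r (k_ge0 Ey)); rewrite mulrDl => H.
  lra.
have LHS : (\int[nu]_(y in E) (c `^ (p - 1) * (f y * k y))%:E = (c `^ p)%:E)%E.
  under eq_integral do rewrite EFinM.
  rewrite ge0_integralZl ?lee_fin ?powR_ge0//.
  - rewrite fc -EFinM; congr EFin.
    by rewrite -{2}(powRr1 c0) -powRD ?cN0 ?implybT// subrK.
  - by apply/measurable_EFinP; exact: measurable_funM.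
  - by move=> y Ey; rewrite lee_fin mulr_ge0 ?f0 ?k_ge0.
have RHS : (\int[nu]_(y in E) (p^-1 * (f y `^ p * k y) + q^-1 * c `^ p * k y)%:E =
    p^-1%:E * \int[nu]_(y in E) (f y `^ p * k y)%:E + (q^-1 * c `^ p)%:E)%E.
  under eq_integral do rewrite EFinD.
  have mfk : measurable_fun E (fun y => (f y `^ p * k y)%:E) by apply/measurable_EFinP; exact: measurable_funM.
  have mkE : measurable_fun E (fun y => (k y)%:E) by apply/measurable_EFinP.
  rewrite ge0_integralD//.
  - under eq_integral do rewrite EFinM.
    rewrite ge0_integralZl ?lee_fin ?invr_ge0 ?(ltW p_gt0)//; last first.
      by move=> y Ey; rewrite lee_fin mulr_ge0 ?powR_ge0 ?k_ge0.
    congr (_ + _)%E; under eq_integral do rewrite EFinM.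
    rewrite ge0_integralZl ?lee_fin ?mulr_ge0 ?invr_ge0 ?powR_ge0 ?(ltW q0)//; first by rewrite k1 mule1.
  - by move=> y Ey; rewrite lee_fin !mulr_ge0 ?powR_ge0 ?k_ge0 ?invr_ge0 ?(ltW p_gt0).
  - by apply/measurable_EFinP; apply: measurable_funM => //; exact: measurable_funM.
  - by move=> y Ey; rewrite lee_fin !mulr_ge0 ?powR_ge0 ?k_ge0 ?invr_ge0 ?(ltW q0).
  - by apply/measurable_EFinP; exact: measurable_funM.
have : ((c `^ p)%:E <= p^-1%:E * \int[nu]_(y in E) (f y `^ p * k y)%:E + (q^-1 * c `^ p)%:E)%E.
  rewrite -RHS -LHS; apply: ge0_le_integral => //.
  - by move=> y Ey; rewrite lee_fin !mulr_ge0 ?powR_ge0 ?f0 ?k_ge0.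
  - by apply/measurable_EFinP; apply: measurable_funM => //; exact: measurable_funM.
  - apply/measurable_EFinP; apply: measurable_funD; apply: measurable_funM => //.
    exact: measurable_funM.
rewrite -[in X in X -> _](fineK Ifin) -EFinM -EFinD lee_fin => H0.
rewrite -(fineK Ifin) lee_fin; move: H0.
have -> : q^-1 = 1 - p^-1 by rewrite -pq addrAC subrr add0r.
move: (fine _) => I H.
have {}H : p^-1 * c `^ p <= p^-1 * I by lra.
by rewrite ler_pM2l ?invr_gt0 in H.
Qed.

Variables (u : X -> R) (Ck : R).
Hypotheses (iu : nu.-integrable E (EFin \o u)) (kC : forall y, E y -> k y <= Ck).
Hypothesis nuE : (nu E < +oo)%E.

Definition wavg : R := \int[nu]_(y in E) (u y * k y).

Let mu_ : measurable_fun E u. Proof. by have /measurable_int/measurable_EFinP := iu. Qed.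
Let kC' y : E y -> `|k y| <= Ck. Proof. by move=> Ey; rewrite ger0_norm ?kC ?k_ge0. Qed.

Let iuk : nu.-integrable E (EFin \o (fun y => u y * k y)).
Proof. exact: (integrable_mul_bounded iu mk kC'). Qed.

Let ik : nu.-integrable E (EFin \o k).
Proof.
apply/integrableP; split; first exact/measurable_EFinP.
under eq_integral => y /[!inE] Ey do rewrite /= ger0_norm ?k_ge0//.
by rewrite k1 ltry.
Qed.

Let iua (a : R) : nu.-integrable E (EFin \o (fun y => a - u y)).
Proof.
have ia : nu.-integrable E (EFin \o cst a).
  apply/integrableP; split; first exact/measurable_EFinP.
  rewrite /= integral_cst//; exact: lte_mul_pinfty.
by apply: eq_integrable (integrableB mE ia iu) => // y _; rewrite /= EFinB.
Qed.

Lemma wavg_sub (a : R) : a - wavg = \int[nu]_(y in E) ((a - u y) * k y).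
Proof.
under eq_Rintegral do rewrite mulrBl.
rewrite RintegralB//; last first.
  by apply: eq_integrable (integrableZl mE a ik) => // y _; rewrite /= EFinM.
rewrite RintegralZl//; congr (_ - _).
by rewrite /Rintegral k1/= mulr1.
Qed.

Let iabs (a : R) : nu.-integrable E (EFin \o (fun y => `|a - u y| * k y)).
Proof.
exact: (integrable_mul_bounded (integrable_norm (iua a)) mk kC').
Qed.

Lemma wavg_norm_le (a : R) : `|a - wavg| <= \int[nu]_(y in E) (`|a - u y| * k y).
Proof.
rewrite wavg_sub; apply: (le_trans (le_normr_Rintegral _ _)) => //.
  exact: (integrable_mul_bounded (iua a) mk kC').
rewrite le_eqVlt; apply/orP; left; apply/eqP; apply: eq_Rintegral => y; rewrite inE => Ey.
by rewrite normrM [`|k y|]ger0_norm ?k_ge0.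
Qed.

Lemma wavg_jensen (a : R) :
  ((`|a - wavg| `^ p)%:E <= \int[nu]_(y in E) (`|a - u y| `^ p * k y)%:E)%E.
Proof.
pose c := \int[nu]_(y in E) (`|a - u y| * k y).
apply: (@le_trans _ _ (c `^ p)%:E).
  rewrite lee_fin; apply: ge0_ler_powR; rewrite ?nnegrE ?(ltW p_gt0)//; last exact: wavg_norm_le.
  by apply: Rintegral_ge0 => y Ey; rewrite mulr_ge0 ?k_ge0.
apply: jensen_powR => //.
  by apply: measurableT_comp => //; exact: measurable_funB.
by rewrite /c /Rintegral fineK//; exact: (integrable_fin_num mE (iabs a)).
Qed.

(* [g] plays the role of a derivative of the weight [k] *)
Lemma wavg_derivative_jensen (g rho : X -> R) (L Cr : R) :
  measurable_fun E g -> measurable_fun E rho ->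
  measurable_fun E (fun y => \int[nu]_(z in E) (`|u y - u z| `^ p * k z)%:E)%E ->
  (forall y, E y -> 0 <= rho y <= Cr) -> 0 <= L ->
  (forall y, E y -> `|g y| <= L * (rho y * k y)) ->
  ((`|\int[nu]_(y in E) ((u y - wavg) * g y)| `^ p)%:E <=
    (L `^ p)%:E * \int[nu]_(y in E) ((rho y `^ p * k y)%:E *
      \int[nu]_(z in E) (`|u y - u z| `^ p * k z)%:E))%E.
Proof.
move=> mg mrho mJ rhoC L0 gL.
have rho0 y : E y -> 0 <= rho y by move=> /rhoC /andP[].
pose c := \int[nu]_(y in E) ((`|wavg - u y| * rho y) * k y).
have mw : measurable_fun E (fun y => `|wavg - u y|).
  by apply: measurableT_comp => //; exact: measurable_funB.
have iw : nu.-integrable E (EFin \o (fun y => (`|wavg - u y| * rho y) * k y)).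
  have rhoC' y : E y -> `|rho y| <= Cr.
    by move=> Ey; rewrite ger0_norm ?rho0//; case/andP: (rhoC y Ey).
  exact: (integrable_mul_bounded (integrable_mul_bounded (integrable_norm (iua wavg)) mrho rhoC') mk kC').
have gb y : E y -> `|g y| <= L * (Cr * Ck).
  move=> Ey; apply: (le_trans (gL y Ey)); rewrite ler_wpM2l// ler_pM ?rho0 ?k_ge0 ?kC//.
  by case/andP: (rhoC y Ey).
have iug : nu.-integrable E (EFin \o (fun y => (u y - wavg) * g y)).
  have iuw : nu.-integrable E (EFin \o (fun y => u y - wavg)).
    apply: eq_integrable (integrableN (iua wavg)) => // y _.
    by rewrite /= opprB.
  exact: (integrable_mul_bounded iuw mg gb).
have Dc : `|\int[nu]_(y in E) ((u y - wavg) * g y)| <= L * c.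
  apply: (le_trans (le_normr_Rintegral _ iug)) => //.
  rewrite -RintegralZl//; apply: le_Rintegral => //.
  - exact: integrable_norm iug.
  - by apply: eq_integrable (integrableZl mE L iw) => // y _; rewrite /= EFinM.
  - move=> y Ey; rewrite normrM distrC.
    have := ler_wpM2l (normr_ge0 (wavg - u y)) (gL y Ey); lra.
have c0 : 0 <= c.
  by apply: Rintegral_ge0 => y Ey; rewrite !mulr_ge0 ?k_ge0 ?rho0.
apply: (@le_trans _ _ ((L `^ p)%:E * (c `^ p)%:E)%E).
  rewrite -EFinM lee_fin -powRM//; apply: ge0_ler_powR; rewrite ?nnegrE ?(ltW p_gt0)//.
  exact: mulr_ge0.
rewrite lee_wpmul2l ?lee_fin ?powR_ge0//.
have mwr : measurable_fun E (fun y => `|wavg - u y| * rho y) by exact: measurable_funM.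
(* Jensen is used twice: here for the outer average, and in the last bullet for [u y - wavg], which
   brings in the second integration variable. *)
apply: (le_trans (@jensen_powR (fun y => `|wavg - u y| * rho y) c mwr _ _)).
- by move=> y Ey; rewrite mulr_ge0 ?rho0.
- by rewrite /c /Rintegral fineK//; exact: (integrable_fin_num mE iw).
have mrk : measurable_fun E (fun y => (rho y `^ p * k y)%:E).
  apply/measurable_EFinP; apply: measurable_funM => //.
  exact: measurableT_comp (measurable_powR _) mrho.
apply: ge0_le_integral => //.
- by move=> y Ey; rewrite lee_fin mulr_ge0 ?powR_ge0 ?k_ge0.
- apply/measurable_EFinP; apply: measurable_funM => //.
  exact: measurableT_comp (measurable_powR _) mwr.
- exact: emeasurable_funM.
- move=> y Ey; rewrite powRM ?rho0// -mulrA EFinM muleC.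
  rewrite lee_wpmul2l ?lee_fin ?mulr_ge0 ?powR_ge0 ?k_ge0//.
  by rewrite distrC; exact: wavg_jensen.
Qed.

End jensen.

End weighted_average.

(** * The kernel *)

Section kernel.
Context {R : realType} {n : nat}.
Implicit Types (x w z h : 'rV[R]_n) (eps : R) (m : nat).

Lemma dotpDr x w z : dotp x (w + z) = dotp x w + dotp x z.
Proof. by rewrite dotpC dotpDl !(dotpC x). Qed.

Lemma dotpZr a x w : dotp x (a *: w) = a * dotp x w.
Proof. by rewrite dotpC dotpZl dotpC. Qed.

Definition rho2 eps x w : R := eudist x w ^+ 2 + eps ^+ 2.

Definition rho eps x w : R := Num.sqrt (rho2 eps x w).

(** The even exponent makes the kernel a rational function of the squared distance, so no square
    root is differentiated. *)
Definition ker m eps x w : R := (rho2 eps x w)^-1 ^+ m.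

Definition dker m eps h x w : R := - (m.*2%:R * dotp (x - w) h) * (rho2 eps x w)^-1 ^+ m.+1.

Lemma rho2_ge0 eps x w : 0 <= rho2 eps x w.
Proof. by rewrite addr_ge0 ?sqr_ge0. Qed.

Lemma rho_ge0 eps x w : 0 <= rho eps x w. Proof. exact: sqrtr_ge0. Qed.

Lemma sqr_rho eps x w : rho eps x w ^+ 2 = rho2 eps x w.
Proof. by rewrite sqr_sqrtr ?rho2_ge0. Qed.

Lemma eudist_le_rho eps x w : eudist x w <= rho eps x w.
Proof.
rewrite -(@ler_sqr _ (eudist x w)) ?nnegrE ?rho_ge0 ?eudist_ge0// sqr_rho.
by rewrite lerDl sqr_ge0.
Qed.

Lemma eps_le_rho eps x w : eps <= rho eps x w.
Proof.
have [e0|e0] := leP 0 eps; last by rewrite (le_trans (ltW e0)) ?rho_ge0.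
rewrite -(@ler_sqr _ eps) ?nnegrE ?rho_ge0// sqr_rho.
by rewrite lerDr sqr_ge0.
Qed.

Lemma rho0E x w : rho 0 x w = eudist x w.
Proof. by rewrite /rho /rho2 expr0n addr0 sqrtr_sqr ger0_norm ?eudist_ge0. Qed.

Lemma rho_refl eps x : 0 <= eps -> rho eps x x = eps.
Proof. by move=> e0; rewrite /rho /rho2 eudistxx expr0n add0r sqrtr_sqr ger0_norm. Qed.

Lemma rho_triangle eps x w z : rho eps x z <= rho eps x w + eudist w z.
Proof.
rewrite -(@ler_sqr _ (rho eps x z)) ?nnegrE ?addr_ge0 ?rho_ge0 ?eudist_ge0// sqr_rho.
rewrite sqrrD sqr_rho /rho2.
have H1 : eudist x z ^+ 2 <= (eudist x w + eudist w z) ^+ 2.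
  by rewrite ler_sqr ?nnegrE ?addr_ge0 ?eudist_ge0// eudist_triangle.
have H2 : eudist x w * eudist w z <= rho eps x w * eudist w z.
  by rewrite ler_wpM2r ?eudist_ge0// eudist_le_rho.
rewrite sqrrD in H1; rewrite -mulr_natr in H1 *; rewrite -mulr_natr; lra.
Qed.

Lemma rho_le eps x w : 0 <= eps -> rho eps x w <= eudist x w + eps.
Proof.
move=> e0; rewrite -(@ler_sqr _ (rho eps x w)) ?nnegrE ?addr_ge0 ?rho_ge0 ?eudist_ge0// sqr_rho.
by rewrite sqrrD /rho2 lerD2r lerDl mulrn_wge0// mulr_ge0// eudist_ge0.
Qed.

Lemma ker_ge0 m eps x w : 0 <= ker m eps x w.
Proof. by rewrite exprn_ge0// invr_ge0 rho2_ge0. Qed.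

Lemma ker_powR m eps x w : 0 < rho eps x w -> ker m eps x w = rho eps x w `^ (- m.*2%:R).
Proof.
by move=> r0; rewrite /ker -sqr_rho powR_invn ?rho_ge0// -mul2n exprM exprVn.
Qed.

Lemma ker_gt0 m eps x w : 0 < rho eps x w -> 0 < ker m eps x w.
Proof. by move=> r0; rewrite ker_powR// powR_gt0. Qed.

(** Cauchy-Schwarz bounds [dotp (x - w) h] by [rho] times the norm of [h]; of the extra factor
    [rho^-2] one power remains. *)
Lemma norm_dker_le m eps h x w : 0 < rho eps x w ->
  `|dker m eps h x w| <= m.*2%:R * eunorm h * ((rho eps x w)^-1 * ker m eps x w).
Proof.
move=> r0; rewrite /dker normrM normrN normrM [`|m.*2%:R|]ger0_norm//.
rewrite exprS [`|_^-1 * _|]ger0_norm ?mulr_ge0 ?exprn_ge0 ?invr_ge0 ?rho2_ge0//.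
rewrite -/(ker m eps x w) !mulrA ler_wpM2r ?ker_ge0//.
rewrite -!mulrA ler_wpM2l//.
have H := dotp_le (x - w) h.
have E : eunorm h / rho eps x w = (rho eps x w * eunorm h) * (rho2 eps x w)^-1.
  by rewrite -sqr_rho; field; rewrite gt_eqF.
rewrite E ler_wpM2r ?invr_ge0 ?rho2_ge0// (le_trans H)// ler_wpM2r ?eunorm_ge0//.
exact: eudist_le_rho.
Qed.

(** Along a line [rho2] is a quadratic polynomial in [t], positive because [eps > 0]. *)
Lemma is_derive_ker m eps h x w t : 0 < eps ->
  is_derive t (1 : R) (fun s => ker m eps (x + s *: h) w) (dker m eps h (x + t *: h) w).
Proof.
move=> e0.
pose a := dotp h h; pose b := dotp (x - w) h; pose c := dotp (x - w) (x - w) + eps ^+ 2.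
have qE s : rho2 eps (x + s *: h) w = a * s ^+ 2 + 2 * b * s + c.
  rewrite /rho2 /eudist sqr_eunorm (_ : x + s *: h - w = (x - w) + s *: h); last by rewrite addrAC.
  rewrite /a /b /c; move: (x - w) => v.
  by rewrite dotpDl !dotpDr !dotpZl !dotpZr (dotpC h v); ring.
have qpos s : 0 < a * s ^+ 2 + 2 * b * s + c.
  by rewrite -qE ltr_wpDl ?sqr_ge0// exprn_gt0.
have bE : dotp (x + t *: h - w) h = a * t + b.
  have -> : x + t *: h - w = (x - w) + t *: h by rewrite addrAC.
  by rewrite dotpDl dotpZl -/a -/b; ring.
have -> : (fun s => ker m eps (x + s *: h) w) = (fun s => (a * s ^+ 2 + 2 * b * s + c)^-1) ^+ m.
  by apply/funext => s; rewrite /ker qE fctE.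
have dq : is_derive t (1 : R) (fun s : R => a * s ^+ 2 + 2 * b * s + c) (2 * (a * t + b)).
  have -> : (fun s : R => a * s ^+ 2 + 2 * b * s + c) = horner (a *: 'X^2 + (2 * b) *: 'X + c%:P).
    by apply/funext => s; rewrite !hornerE.
  apply: (is_derive_eq (is_derive_poly _ t)).
  by rewrite !derivD !derivZ derivXn derivX derivC !hornerE; ring.
have dV := @is_deriveV _ (fun s : R => a * s ^+ 2 + 2 * b * s + c) t _ _ (lt0r_neq0 (qpos t)) dq.
apply: (is_derive_eq (is_deriveX m dV)).
rewrite /dker qE bE /GRing.scale/=; case: m => [|m]; first by rewrite !mul0r oppr0 mul0r.
set q := (_ + c); rewrite -mul2n natrM.
have q0 : q != 0 by rewrite lt0r_neq0// qpos.
by rewrite !exprS expr0 mulr1 invfM; ring.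
Qed.

Lemma rho2_cvg x w (e : R^nat) : e k @[k --> \oo] --> 0 ->
  rho2 (e k) x w @[k --> \oo] --> rho2 0 x w.
Proof.
move=> e0; rewrite /rho2; apply: cvgD; first exact: cvg_cst.
by rewrite !expr2; under eq_fun do rewrite expr2; exact: cvgM.
Qed.

Lemma rho2_inv_expr_cvg j x w (e : R^nat) : 0 < eudist x w -> e k @[k --> \oo] --> 0 ->
  (rho2 (e k) x w)^-1 ^+ j @[k --> \oo] --> (rho2 0 x w)^-1 ^+ j.
Proof.
move=> xw e0; have q0 : rho2 0 x w != 0.
  by rewrite -sqr_rho rho0E gt_eqF// exprn_gt0.
have H : (rho2 (e k) x w)^-1 @[k --> \oo] --> (rho2 0 x w)^-1.
  by apply: cvgV => //; exact: rho2_cvg.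
exact: (cvg_comp _ _ H (@exprn_continuous R j _)).
Qed.

Lemma ker_cvg m x w (e : R^nat) : 0 < eudist x w -> e k @[k --> \oo] --> 0 ->
  ker m (e k) x w @[k --> \oo] --> ker m 0 x w.
Proof. exact: rho2_inv_expr_cvg. Qed.

Lemma dker_cvg m h x w (e : R^nat) : 0 < eudist x w -> e k @[k --> \oo] --> 0 ->
  dker m (e k) h x w @[k --> \oo] --> dker m 0 h x w.
Proof.
by move=> xw e0; apply: cvgM; [exact: cvg_cst|exact: rho2_inv_expr_cvg].
Qed.

End kernel.

Section measurable_euclidean.
Context d (X : measurableType d) (R : realType) (n : nat).
Implicit Types (f g : X -> 'rV[R]_n) (D : set X).

(** Coordinatewise measurability lets abstract measure spaces enter through maps into [R^n], whether
    they carry the Caratheodory structure of Hausdorff or of Lebesgue measure. *)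
Definition measurable_coords D f := forall i, measurable_fun D (fun x => f x 0 i).

Lemma measurable_dotp D f g : measurable_coords D f -> measurable_coords D g ->
  measurable_fun D (fun x => dotp (f x) (g x)).
Proof.
move=> mf mg; rewrite /dotp.
by apply: measurable_sum => i; exact: measurable_funM.
Qed.

Lemma measurable_coordsB D f g : measurable_coords D f -> measurable_coords D g ->
  measurable_coords D (fun x => f x - g x).
Proof.
move=> mf mg i; rewrite (_ : (fun x => _) = (fun x => f x 0 i - g x 0 i)).
  exact: measurable_funB.
by apply/funext => x; rewrite !mxE.
Qed.

Lemma measurable_eudist D f g : measurable_coords D f -> measurable_coords D g ->
  measurable_fun D (fun x => eudist (f x) (g x)).
Proof.
move=> mf mg.
have -> : (fun x => eudist (f x) (g x)) = (fun x => Num.sqrt (dotp (f x - g x) (f x - g x))).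
  by apply/funext => x; rewrite -sqr_eunorm sqrtr_sqr ger0_norm ?eunorm_ge0.
have md := measurable_dotp (measurable_coordsB mf mg) (measurable_coordsB mf mg).
exact: (measurableT_comp (continuous_measurable_fun (@sqrt_continuous R)) md).
Qed.

Lemma measurable_rho2_inv D eps j f g : measurable_coords D f -> measurable_coords D g ->
  measurable_fun D (fun x => (rho2 eps (f x) (g x))^-1 ^+ j).
Proof.
move=> mf mg.
have mq : measurable_fun D (fun x => rho2 eps (f x) (g x)).
  apply: measurable_funD => //; apply: measurable_funX; exact: measurable_eudist.
apply: measurable_funX.
have -> : (fun x => (rho2 eps (f x) (g x))^-1) = (fun x => (rho2 eps (f x) (g x)) `^ (-1)).
  by apply/funext => x; rewrite powR_inv1 ?rho2_ge0.
exact: measurableT_comp (measurable_powR _) mq.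
Qed.

Lemma measurable_ker D eps m f g : measurable_coords D f -> measurable_coords D g ->
  measurable_fun D (fun x => ker m eps (f x) (g x)).
Proof. exact: measurable_rho2_inv. Qed.

Lemma measurable_dker D eps m h f g : measurable_coords D f -> measurable_coords D g ->
  measurable_fun D (fun x => dker m eps h (f x) (g x)).
Proof.
move=> mf mg; apply: measurable_funM; last exact: measurable_rho2_inv.
apply: measurableT_comp => //; apply: measurable_funM => //.
apply: measurable_dotp; first exact: measurable_coordsB.
by move=> i; exact: measurable_cst.
Qed.

Lemma measurable_rho D eps f g : measurable_coords D f -> measurable_coords D g ->
  measurable_fun D (fun x => rho eps (f x) (g x)).
Proof.
move=> mf mg; have mq : measurable_fun D (fun x => rho2 eps (f x) (g x)).
  by apply: measurable_funD => //; apply: measurable_funX; exact: measurable_eudist.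
exact: (measurableT_comp (continuous_measurable_fun (@sqrt_continuous R)) mq).
Qed.

Lemma measurable_coords_cst D (v : 'rV[R]_n) : measurable_coords D (fun _ : X => v).
Proof. by move=> i; exact: measurable_cst. Qed.

End measurable_euclidean.

Section section_integral.
Context d d' (X : measurableType d) (Y : measurableType d') (R : realType).
Variable nu : {sigma_finite_measure set Y -> \bar R}.
Local Open Scope ereal_scope.

(** Folding [D] into the integrand as an indicator reduces to Tonelli's theorem on the full
    product. *)
Lemma measurable_section_integral_ge0 (D : set Y) (f : X * Y -> \bar R) : measurable D ->
  measurable_fun [set: X * Y] f -> (forall z, 0 <= f z) ->
  measurable_fun [set: X] (fun x => \int[nu]_(y in D) f (x, y)).
Proof.
move=> mD mf f0.
pose g (z : X * Y) := f z * (\1_(setT `*` D) z)%:E.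
have mTD : measurable (setT `*` D : set (X * Y)) by exact: measurableX.
have mg : measurable_fun [set: X * Y] g.
  by apply: emeasurable_funM => //; apply/measurable_EFinP; exact: measurable_indic.
have := @measurable_fun_fubini_tonelli_F _ _ X Y R nu g mg (fun z => mule_ge0 (f0 z) _).
have E : (fun x => \int[nu]_(y in D) f (x, y)) = fubini_F nu g.
  apply/funext => x; rewrite [LHS]integral_mkcond /fubini_F; apply: eq_integral => y _.
  rewrite /g patchE indicE; case: ifPn => yD; first by rewrite mem_set ?mule1//; split => //=; rewrite inE in yD.
  by rewrite memNset ?mule0//= => -[_ /=]; rewrite notin_setE in yD.
rewrite E; apply; by move=> z; rewrite lee_fin.
Qed.

Lemma measurable_section_Rintegral (D : set Y) (f : X * Y -> R) : measurable D ->
  measurable_fun [set: X * Y] f ->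
  measurable_fun [set: X] (fun x => (\int[nu]_(y in D) f (x, y))%R).
Proof.
move=> mD mf; rewrite /Rintegral.
have mfE : measurable_fun [set: X * Y] (EFin \o f) by exact/measurable_EFinP.
suff mI : measurable_fun [set: X] (fun x => \int[nu]_(y in D) (f (x, y))%:E).
  exact: (measurableT_comp (@fine_measurable R setT measurableT) mI).
under eq_fun do rewrite integralE.
apply: emeasurable_funB.
- have := @measurable_section_integral_ge0 D (EFin \o f)^\+ mD (measurable_funepos mfE) (funepos_ge0 _).
  congr measurable_fun; apply/funext => x; apply: eq_integral => y _.
  by rewrite !funeposE.
- have := @measurable_section_integral_ge0 D (EFin \o f)^\- mD (measurable_funeneg mfE) (funeneg_ge0 _).
  congr measurable_fun; apply/funext => x; apply: eq_integral => y _.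
  by rewrite !funenegE.
Qed.

End section_integral.

(* The case distinction is on which of the two points is closer: its weight is
   bounded by the plain estimate, and the excess is absorbed using that the
   exponent [s] is large. *)
Lemma two_point_weight_le (R : realType) (a b A B C Q p s : R) :
  0 < a -> 0 < b -> 0 <= Q -> 0 <= p -> 2 * Q + p <= s -> 0 <= C -> 0 <= A -> 0 <= B ->
  A <= C * a `^ (- Q) -> A <= C * (a `^ (- s) * b `^ (s - Q)) ->
  B <= C * b `^ (- Q) -> B <= C * (b `^ (- s) * a `^ (s - Q)) ->
  a `^ (- p) * (A * B) <= C ^+ 2 * Num.max a b `^ (- (p + 2 * Q)).
Proof.
move=> a0 b0 Q0 p0 sQp C0 A0 B0 A1 A2 B1 B2.
have Dp (t e f : R) : 0 < t -> t `^ (e + f) = t `^ e * t `^ f.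
  by move=> t0; rewrite powRD// (gt_eqF t0) implybT.
have s1 : 0 <= s - Q - Q by lra.
have s2 : 0 <= s - Q - Q - p by lra.
have C2 : 0 <= C ^+ 2 by exact: exprn_ge0.
have [ab|ba] := leP a b.
  have E1 : a `^ (s - Q - Q - p) = a `^ (- p) * (a `^ (- Q) * a `^ (s - Q)).
    by rewrite -!Dp//; congr (_ `^ _); ring.
  have E2 : b `^ (- (p + 2 * Q)) = b `^ (s - Q - Q - p) * b `^ (- s).
    by rewrite -Dp//; congr (_ `^ _); ring.
  have H1 : a `^ (s - Q - Q - p) <= b `^ (s - Q - Q - p).
    by apply: ge0_ler_powR => //; rewrite nnegrE ltW.
  have H2 := ler_pM A0 B0 A1 B2.
  have H3 := ler_wpM2l (powR_ge0 a (- p)) H2.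
  apply: (le_trans H3); rewrite E2.
  have H4 := ler_wpM2l C2 (ler_wpM2r (powR_ge0 b (- s)) H1).
  apply: le_trans H4; rewrite E1.
  move: (a `^ _) (a `^ _) (a `^ _) (b `^ _) => x1 x2 x3 x4.
  by rewrite le_eqVlt; apply/orP; left; apply/eqP; ring.
have E1 : b `^ (s - Q - Q) = b `^ (- Q) * b `^ (s - Q).
  by rewrite -!Dp//; congr (_ `^ _); ring.
have E2 : a `^ (- (p + 2 * Q)) = a `^ (s - Q - Q) * (a `^ (- p) * a `^ (- s)).
  by rewrite -!Dp//; congr (_ `^ _); ring.
have H1 : b `^ (s - Q - Q) <= a `^ (s - Q - Q).
  by apply: ge0_ler_powR => //; rewrite ?nnegrE ltW.
have H2 := ler_pM A0 B0 A2 B1.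
have H3 := ler_wpM2l (powR_ge0 a (- p)) H2.
apply: (le_trans H3); rewrite E2.
have H4 := ler_wpM2l C2 (ler_wpM2r (mulr_ge0 (powR_ge0 a (- p)) (powR_ge0 a (- s))) H1).
apply: le_trans H4; rewrite E1.
move: (a `^ _) (a `^ _) (b `^ _) (b `^ _) => x1 x2 x3 x4.
by rewrite le_eqVlt; apply/orP; left; apply/eqP; ring.
Qed.

(** * Pointwise bounds for kernel averages, uniform in the regularization *)

Section kernel_average.
Context d (X : measurableType d) (R : realType) (n : nat).
Variables (nu : {finite_measure set X -> \bar R}) (E : set X) (pt : X -> 'rV[R]_n).
Variables (m : nat) (Q c R1 p : R).
Hypotheses (mE : measurable E) (mpt : measurable_coords [set: X] pt).
Hypotheses (c_gt0 : 0 < c) (p_gt1 : 1 < p) (Q_gt0 : 0 < Q).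
Hypothesis m_large : 2 * Q + p <= m.*2%:R.
Hypothesis lower_regular : forall y r, E y -> 0 < r <= R1 ->
  ((c * r `^ Q)%:E <= nu (E `&` [set z | (eudist (pt y) (pt z) < r)%R]))%E.

Definition kmass eps x : R := \int[nu]_(y in E) ker m eps x (pt y).
Definition kap eps x y : R := ker m eps x (pt y) / kmass eps x.
Definition kavg eps (u : X -> R) x : R := wavg nu E (kap eps x) u.
(* The derivative of [kavg] in the direction [h]: the weights [kap] have total
   mass 1, so their derivatives integrate to 0 and the constant [kavg] may be
   subtracted. *)
Definition dkavg eps h (u : X -> R) x : R :=
  \int[nu]_(y in E) ((u y - kavg eps u x) * (dker m eps h x (pt y) / kmass eps x)).

Let nuE : (nu E < +oo)%E. Proof. by rewrite ltey_eq fin_num_measure. Qed.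

Let p_gt0 : 0 < p. Proof. exact: lt_trans ltr01 p_gt1. Qed.

Variables (eps delta : R) (x : 'rV[R]_n).
Hypotheses (delta_gt0 : 0 < delta) (E0 : E !=set0).
Hypothesis rhoE : forall y, E y -> delta <= rho eps x (pt y) <= R1.

Let r y := rho eps x (pt y).
Let k y := ker m eps x (pt y).
Let K := kmass eps x.
(** The factor [4^m] is the loss in the kernel when [rho] doubles, and [c] is the lower regularity
    constant. *)
Definition kconst : R := 4 ^+ m / c.

Lemma kconst_gt0 : 0 < kconst. Proof. by rewrite divr_gt0// exprn_gt0. Qed.

Let r_gt0 y : E y -> 0 < r y.
Proof. by move=> /rhoE/andP[dr _]; exact: lt_le_trans dr. Qed.

Let mk : measurable_fun [set: X] k.
Proof. exact: (measurable_ker _ _ (measurable_coords_cst x) mpt). Qed.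

Let k_ge0 y : 0 <= k y. Proof. exact: ker_ge0. Qed.

Let k_le y : E y -> k y <= (delta ^+ 2)^-1 ^+ m.
Proof.
move=> Ey; have /andP[dr _] := rhoE Ey.
rewrite /k /ker lerXn2r ?nnegrE ?invr_ge0 ?rho2_ge0 ?sqr_ge0//.
rewrite -sqr_rho lef_pV2 ?posrE ?exprn_gt0 ?r_gt0//.
by rewrite lerXn2r ?nnegrE ?(ltW delta_gt0) ?rho_ge0.
Qed.

Let ik : nu.-integrable E (EFin \o k).
Proof.
apply: (le_integrable mE _ _ (finite_measure_integrable_cst nu ((delta ^+ 2)^-1 ^+ m) mE)).
  by apply/measurable_EFinP; exact: measurable_funTS mk.
move=> y Ey; rewrite /= lee_fin ger0_norm// (le_trans (k_le Ey))//.
exact: ler_norm.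
Qed.

Let KE : (\int[nu]_(y in E) (k y)%:E = K%:E)%E.
Proof. by rewrite /K /kmass /Rintegral fineK//; exact: (integrable_fin_num mE ik). Qed.

Let mball (y : X) (s : R) : measurable (E `&` [set z | (eudist (pt y) (pt z) < s)%R]).
Proof.
have := measurable_eudist (@measurable_coords_cst _ X R n E (pt y)) (fun i => measurable_funTS (mpt i)).
move=> /(_ mE `]-oo, s[%classic (measurable_itv _)).
by rewrite (_ : _ @^-1` _ = [set z | eudist (pt y) (pt z) < s]).
Qed.

(** On the ball of radius [rho(y)] about [y] the triangle inequality gives [rho <= 2 rho(y)], so the
    kernel there is at least [4^-m] times its value at [y]; lower regularity measures the ball. *)
Lemma kmass_lower y : E y -> r y `^ Q * k y <= kconst * K.
Proof.
move=> Ey; have ry := r_gt0 Ey; have /andP[_ rR] := rhoE Ey.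
suff : (c * r y `^ Q * ((4 ^+ m)^-1 * k y) <= K).
  rewrite /kconst -ler_pdivrMl ?divr_gt0 ?exprn_gt0// invf_div.
  by apply: le_trans; rewrite le_eqVlt; apply/orP; left; apply/eqP; field; rewrite expf_neq0.
set B := E `&` [set z | (eudist (pt y) (pt z) < r y)%R].
have mB : measurable B by exact: mball.
rewrite -lee_fin -KE.
have ky0 : 0 <= (4 ^+ m)^-1 * k y by rewrite mulr_ge0// invr_ge0 exprn_ge0.
apply: (@le_trans _ _ (\int[nu]_(z in B) ((4 ^+ m)^-1 * k y)%:E)%E).
  rewrite integral_cst//= EFinM muleC lee_wpmul2l ?lee_fin//.
  by apply: lower_regular => //; rewrite ry rR.
apply: (@le_trans _ _ (\int[nu]_(z in B) (k z)%:E)%E).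
  apply: ge0_le_integral => //.
  - by apply/measurable_EFinP; exact: measurable_funTS mk.
  - move=> z [Ez /= yz]; rewrite lee_fin /k /ker -exprVn -exprMn.
    have rz := r_gt0 Ez.
    rewrite lerXn2r ?nnegrE ?mulr_ge0 ?invr_ge0 ?rho2_ge0// -invfM.
    rewrite lef_pV2 ?posrE ?mulr_gt0// -?sqr_rho ?exprn_gt0//.
    rewrite (_ : 4 * rho eps x (pt y) ^+ 2 = (2 * rho eps x (pt y)) ^+ 2); last by ring.
    rewrite lerXn2r ?nnegrE ?rho_ge0 ?mulr_ge0 ?rho_ge0//.
    rewrite (le_trans (rho_triangle eps x (pt y) (pt z)))// mulr_natl mulr2n lerD2l.
    exact: ltW.
apply: ge0_subset_integral => //; last exact: subIsetl.
  by apply/measurable_EFinP; exact: measurable_funTS mk.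
by move=> z _; rewrite lee_fin.
Qed.

Lemma kernel_mass_gt0 : 0 < kmass eps x.
Proof.
have [y Ey] := E0; rewrite -(pmulr_rgt0 _ kconst_gt0).
have ky : 0 < k y by apply: ker_gt0; exact: r_gt0.
by apply: lt_le_trans (kmass_lower Ey); rewrite mulr_gt0// powR_gt0// r_gt0.
Qed.

Let K_gt0 : 0 < K. Proof. exact: kernel_mass_gt0. Qed.

Local Notation ka := (kap eps x).

Lemma kap_ge0 y : 0 <= ka y. Proof. by apply: divr_ge0; [exact: ker_ge0|exact: ltW]. Qed.

Let mka : measurable_fun [set: X] ka.
Proof. exact: (measurable_funM mk (measurable_cst _)). Qed.

Let ka1 : (\int[nu]_(y in E) (ka y)%:E = 1)%E.
Proof.
under eq_integral do rewrite /kap mulrC EFinM.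
by rewrite integralZl// KE -EFinM mulVf ?gt_eqF.
Qed.

Lemma kap_le y : E y -> ka y <= kconst * r y `^ (- Q).
Proof.
move=> Ey; rewrite ler_pdivrMr// mulrAC powRN ler_pdivlMr ?powR_gt0 ?r_gt0// mulrC.
exact: kmass_lower.
Qed.

(** Bounding the total mass from below through a second point [z] keeps the full decay [rho^-(2m)]
    of the weight at [y]; with [z] much closer to [x] this beats [kap_le]. *)
Lemma kap_le_other y z : E y -> E z ->
  ka y <= kconst * (r y `^ (- m.*2%:R) * r z `^ (m.*2%:R - Q)).
Proof.
move=> Ey Ez; have ry := r_gt0 Ey; have rz := r_gt0 Ez.
pose t := r z `^ Q * k z.
have kz : 0 < k z by exact: (ker_gt0 m rz).
have rQ : 0 < r z `^ Q by exact: powR_gt0.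
have t0 : 0 < t by rewrite /t; exact: mulr_gt0.
have -> : r z `^ (m.*2%:R - Q) = t^-1.
  rewrite /t /k (ker_powR _ rz) -powRD; last by rewrite (gt_eqF rz) implybT.
  by rewrite -powRN opprD opprK addrC.
have HK : K^-1 <= kconst / t.
  by rewrite ler_pdivlMr// mulrC ler_pdivrMr//; exact: kmass_lower.
have -> : ka y = r y `^ (- m.*2%:R) * K^-1 by rewrite /kap (ker_powR _ ry).
move: HK (powR_ge0 (r y) (- m.*2%:R)).
move: (r y `^ _) (K^-1) (t^-1) kconst => a b e f bfe a0.
by rewrite (mulrCA f) ler_wpM2l.
Qed.

Lemma kap_prod_le y z : E y -> E z ->
  r y `^ (- p) * (ka y * ka z) <= kconst ^+ 2 * Num.max (r y) (r z) `^ (- (p + 2 * Q)).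
Proof.
move=> Ey Ez; apply: (@two_point_weight_le _ _ _ _ _ _ Q p m.*2%:R) => //.
- exact: r_gt0.
- exact: r_gt0.
- exact: ltW.
- exact: ltW.
- exact: ltW kconst_gt0.
- exact: kap_ge0.
- exact: kap_ge0.
- exact: kap_le.
- exact: kap_le_other.
- exact: kap_le.
- exact: kap_le_other.
Qed.

Let ka_le_bound y : E y -> ka y <= (delta ^+ 2)^-1 ^+ m / K.
Proof. by move=> Ey; rewrite /kap ler_wpM2r ?invr_ge0 ?(ltW K_gt0)// k_le. Qed.

Variable u : X -> R.
Hypotheses (mu_ : measurable_fun [set: X] u) (iu : nu.-integrable E (EFin \o u)).
Hypothesis x_far : forall y, E y -> 0 < eudist x (pt y).

Let m_ecl : measurable_fun [set: X] (fun y => eudist x (pt y)).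
Proof. exact: (measurable_eudist (measurable_coords_cst x) mpt). Qed.

Let mkaE : measurable_fun E ka. Proof. exact: measurable_funTS mka. Qed.

(** Jensen with comparison value 0, then [kap_le]; replacing [rho] by the smaller distance removes
    [eps] from the bound. *)
Lemma kavg_powR_le : ((`|kavg eps u x| `^ p)%:E <=
  kconst%:E * \int[nu]_(y in E) (`|u y| `^ p * eudist x (pt y) `^ (- Q))%:E)%E.
Proof.
have J := wavg_jensen mE p_gt1 mkaE (fun y _ => kap_ge0 y) ka1 iu ka_le_bound nuE 0.
rewrite sub0r normrN in J; apply: (le_trans J).
have mup : measurable_fun E (fun y => `|u y| `^ p).
  apply: (measurableT_comp (measurable_powR _)); apply: measurableT_comp => //.
  exact: measurable_funTS mu_.
have mup0 : measurable_fun E (fun y => `|0 - u y| `^ p).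
  by move: mup; under eq_fun do rewrite -normrN -sub0r.
have mg : measurable_fun E (fun y => (`|u y| `^ p * eudist x (pt y) `^ (- Q))%:E).
  apply/measurable_EFinP; apply: (measurable_funM mup).
  by apply: (measurableT_comp (measurable_powR _)); exact: measurable_funTS m_ecl.
rewrite -ge0_integralZl_EFin ?(ltW kconst_gt0)//; last first.
  by move=> y _; rewrite lee_fin mulr_ge0// powR_ge0.
apply: ge0_le_integral => [|y _|||y Ey].
- exact: mE.
- by rewrite lee_fin mulr_ge0 ?powR_ge0 ?kap_ge0.
- by apply/measurable_EFinP; exact: (measurable_funM mup0 mkaE).
- exact: (measurable_funeM _ mg).
- have H : ka y <= kconst * eudist x (pt y) `^ (- Q).
    apply: (le_trans (kap_le Ey)); apply: (ler_wpM2l (ltW kconst_gt0)).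
    by apply: powRN_le; rewrite ?(ltW Q_gt0) ?x_far ?eudist_le_rho.
  have {}H := ler_wpM2l (powR_ge0 `|u y| p) H.
  by rewrite sub0r normrN -EFinM lee_fin (le_trans H)// mulrCA.
Qed.

Let m_edX (D : set (X * X)) : measurable_fun D (fun w : X * X => eudist x (pt w.1)) /\
  measurable_fun D (fun w : X * X => eudist x (pt w.2)).
Proof.
by split; apply: measurable_funTS; [exact: (measurableT_comp m_ecl measurable_fst)
  |exact: (measurableT_comp m_ecl measurable_snd)].
Qed.

Let mu2 : measurable_fun [set: X * X] (fun w : X * X => `|u w.1 - u w.2| `^ p).
Proof.
apply: (measurableT_comp (measurable_powR _)); apply: measurableT_comp => //.
apply: measurable_funB; first exact: (measurableT_comp mu_ measurable_fst).
exact: (measurableT_comp mu_ measurable_snd).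
Qed.

Definition pair_weight (x : 'rV[R]_n) (y z : X) : R :=
  Num.max (eudist x (pt y)) (eudist x (pt z)) `^ (- (p + 2 * Q)).

Let m_pw : measurable_fun [set: X * X] (fun w => `|u w.1 - u w.2| `^ p * pair_weight x w.1 w.2).
Proof.
apply: (measurable_funM mu2); apply: (measurableT_comp (measurable_powR _)).
by have [? ?] := m_edX setT; exact: measurable_maxr.
Qed.

(** [norm_dker_le] allows [wavg_derivative_jensen] with multiplier [1 / rho]. The resulting product
    of two weights and [rho^-p] is what [kap_prod_le] bounds by the symmetric weight. *)
Lemma dkavg_powR_le h : ((`|dkavg eps h u x| `^ p)%:E <=
  ((m.*2%:R * eunorm h) `^ p * kconst ^+ 2)%:E *
  \int[nu]_(y in E) \int[nu]_(z in E) (`|u y - u z| `^ p * pair_weight x y z)%:E)%E.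
Proof.
have mJ : measurable_fun E (fun y => \int[nu]_(z in E) (`|u y - u z| `^ p * ka z)%:E)%E.
  have mf : measurable_fun [set: X * X] (fun w => (`|u w.1 - u w.2| `^ p * ka w.2)%:E).
    apply/measurable_EFinP; apply: (measurable_funM mu2).
    exact: (measurableT_comp mka measurable_snd).
  apply: measurable_funTS (measurable_section_integral_ge0 nu mE mf _).
  by move=> w; rewrite lee_fin mulr_ge0 ?powR_ge0 ?kap_ge0.
have mrE : measurable_fun E (fun y => (r y)^-1).
  have -> : (fun y => (r y)^-1) = (fun y => r y `^ (-1)).
    by apply/funext => y; rewrite powR_inv1 ?rho_ge0.
  apply: (measurableT_comp (measurable_powR _)); apply: measurable_funTS.
  exact: (measurable_rho eps (measurable_coords_cst x) mpt).
have mg : measurable_fun E (fun y => dker m eps h x (pt y) / K).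
  apply: measurable_funM => //; apply: measurable_funTS.
  exact: (measurable_dker eps m h (measurable_coords_cst x) mpt).
have rhoC y : E y -> 0 <= (r y)^-1 <= delta^-1.
  move=> Ey; rewrite invr_ge0 rho_ge0/= lef_pV2 ?posrE ?r_gt0//.
  by case/andP: (rhoE Ey).
have L0 : 0 <= m.*2%:R * eunorm h by rewrite mulr_ge0 ?eunorm_ge0.
have gL y : E y -> `|dker m eps h x (pt y) / K| <= m.*2%:R * eunorm h * ((r y)^-1 * ka y).
  move=> Ey; rewrite normrM (gtr0_norm (_ : 0 < K^-1)) ?invr_gt0//.
  rewrite /kap !mulrA ler_wpM2r ?invr_ge0 ?(ltW K_gt0)// -mulrA.
  exact: (norm_dker_le m h (r_gt0 Ey)).
have J := wavg_derivative_jensen mE p_gt1 mkaE (fun y _ => kap_ge0 y) ka1 iu ka_le_bound nuE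
  mg mrE mJ rhoC L0 gL.
apply: (le_trans J); rewrite EFinM -muleA.
rewrite lee_wpmul2l ?lee_fin ?powR_ge0//.
have c20 : 0 <= kconst ^+ 2 by rewrite exprn_ge0// ltW// kconst_gt0.
have m_in y : measurable_fun E (fun z => (`|u y - u z| `^ p * pair_weight x y z)%:E).
  apply/measurable_EFinP/measurable_funTS.
  exact: (measurableT_comp m_pw (measurable_pair1 y)).
have m_in' y : measurable_fun E (fun z => (`|u y - u z| `^ p * ka z)%:E).
  apply/measurable_EFinP; apply: measurable_funM => //; apply: measurable_funTS.
  exact: (measurableT_comp mu2 (measurable_pair1 y)).
have pw0 y z : (0 <= (`|u y - u z| `^ p * pair_weight x y z)%:E)%E.
  by rewrite lee_fin mulr_ge0 ?powR_ge0.
have in0 y : (0 <= \int[nu]_(z in E) (`|u y - u z| `^ p * pair_weight x y z)%:E)%E.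
  exact: integral_ge0.
have m_out : measurable_fun E
    (fun y => \int[nu]_(z in E) (`|u y - u z| `^ p * pair_weight x y z)%:E)%E.
  apply: measurable_funTS.
  apply: (measurable_section_integral_ge0 nu mE (proj2 (measurable_EFinP _ _) m_pw)).
  by move=> w; exact: pw0.
rewrite -(ge0_integralZl_EFin nu mE (fun y _ => in0 y) m_out c20).
apply: ge0_le_integral => [|y Ey|||y Ey].
- exact: mE.
- apply: mule_ge0; first by rewrite lee_fin mulr_ge0 ?powR_ge0 ?kap_ge0.
  by apply: integral_ge0 => z _; rewrite lee_fin mulr_ge0 ?powR_ge0 ?kap_ge0.
- apply: (emeasurable_funM _ mJ); apply/measurable_EFinP; apply: (measurable_funM _ mkaE).
  exact: (measurableT_comp (measurable_powR _) mrE).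
- exact: (measurable_funeM _ m_out).
- have rk0 : 0 <= (r y)^-1 `^ p * ka y by exact: mulr_ge0 (powR_ge0 _ _) (kap_ge0 _).
  have uk0 z : E z -> (0 <= (`|u y - u z| `^ p * ka z)%:E)%E.
    by move=> _; rewrite lee_fin; exact: mulr_ge0 (powR_ge0 _ _) (kap_ge0 _).
  rewrite -(ge0_integralZl_EFin nu mE uk0 (m_in' y) rk0).
  rewrite -(ge0_integralZl_EFin nu mE (fun z _ => pw0 y z) (m_in y) c20).
  apply: ge0_le_integral => [|z Ez|||z Ez].
  + exact: mE.
  + by apply: mule_ge0; rewrite ?lee_fin//; exact: uk0.
  + exact: (measurable_funeM _ (m_in' y)).
  + exact: (measurable_funeM _ (m_in y)).
  + rewrite -!EFinM lee_fin.
    have -> : (r y)^-1 `^ p = r y `^ (- p).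
      by rewrite -powR_inv1 ?rho_ge0// -powRrM mulN1r.
    have := kap_prod_le Ey Ez; move=> /(ler_wpM2l (powR_ge0 `|u y - u z| p)) H.
    rewrite [X in X <= _](_ : _ = `|u y - u z| `^ p * (r y `^ (- p) * (ka y * ka z))); last by ring.
    apply: (le_trans H); rewrite [X in _ <= X]mulrCA.
    apply: (ler_wpM2l (powR_ge0 _ _)); apply: (ler_wpM2l c20); apply: powRN_le.
    * by rewrite addr_ge0 ?mulr_ge0 ?(ltW Q_gt0) ?(ltW p_gt0).
    * by rewrite lt_max x_far.
    * by rewrite ge_max !le_max !eudist_le_rho orbT.
Qed.

Variables (A L : R).
Hypotheses (A_ge0 : 0 <= A) (L_ge0 : 0 <= L).
Hypothesis upper_regular : forall y t, E y -> 0 < t ->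
  (nu (E `&` [set z | (eudist (pt y) (pt z) < t)%R]) <= (A * t `^ Q)%:E)%E.
Hypothesis u_lip : forall y z, E y -> E z -> `|u y - u z| <= L * eudist (pt y) (pt z).

(** The summand 1 accounts for points closer to [x] than [y]. The rest is [kconst] times the dyadic
    tail constant, with sublevel constant [A 2^Q], growth exponent [Q] and decay [2 m - 1 - Q]. *)
Definition moment_const : R :=
  1 + kconst * (A * 2 `^ Q * 2 `^ Q / (1 - 2 `^ (- (m.*2%:R - 1 - Q)))).

Let mr : measurable_fun [set: X] r.
Proof. exact: (measurable_rho eps (measurable_coords_cst x) mpt). Qed.

(** The regularity bound concerns balls centred on [E], while [x] need not be there. A nonempty
    sublevel set lies in the ball of radius [2 t] about any of its points, whence [2^Q]. *)
Let nu_rho_lt t : 0 < t ->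
  (nu (E `&` [set z | (r z < t)%R]) <= (A * 2 `^ Q * t `^ Q)%:E)%E.
Proof.
move=> t0; have [->|/set0P[y [Ey /= ryt]]] := eqVneq (E `&` [set z | (r z < t)%R]) set0.
  by rewrite measure0 lee_fin !mulr_ge0 ?powR_ge0.
rewrite -mulrA -powRM ?(ltW t0)//.
have t20 : 0 < 2 * t by rewrite mulr_gt0.
apply: le_trans (upper_regular Ey t20); apply: le_measure; rewrite ?inE.
- rewrite (_ : [set z | _] = r @^-1` `]-oo, t[%classic); first exact: (measurable_funTS mr).
  by apply/seteqP; split => z /=; rewrite in_itv.
- exact: mball.
- move=> z [Ez /= rzt]; split => //=.
  rewrite (le_lt_trans (eudist_triangle x _ _))// [eudist (pt y) x]eudistC.
  have h1 := eudist_le_rho eps x (pt y); have h2 := eudist_le_rho eps x (pt z).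
  by rewrite mulr_natl mulr2n ltrD// ?(le_lt_trans h1) ?(le_lt_trans h2).
Qed.

Let s_gt0 : 0 < m.*2%:R - 1 - Q.
Proof. by move: m_large p_gt1 Q_gt0; move: (m.*2%:R : R) => a *; lra. Qed.

(** The integral is split at [rho(z) = rho(y)]. Below, [rho(z)] is replaced by [rho(y)] and the
    weights have mass 1; above, [kap_le_other] leaves a convergent tail of order [rho(y)]. *)
Lemma kap_moment y : E y -> (\int[nu]_(z in E) (r z * ka z)%:E <= (moment_const * r y)%:E)%E.
Proof.
move=> Ey; have ry := r_gt0 Ey.
pose D := E `&` [set z | (r y <= r z)%R].
have mD : measurable D.
  rewrite /D (_ : [set z | _] = r @^-1` `[r y, +oo[%classic); first exact: (measurable_funTS mr).
  by apply/seteqP; split => z /=; rewrite in_itv/= andbT.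
pose a := m.*2%:R : R.
have mk1 : measurable_fun [set: X] (fun z => (r y * ka z)%:E).
  by apply/measurable_EFinP; exact: measurable_funM.
have mp1 : measurable_fun [set: X] (fun z => (r z `^ (- (Q + (a - 1 - Q))))%:E).
  by apply/measurable_EFinP; exact: (measurableT_comp (measurable_powR _) mr).
have c0 : 0 <= kconst * r y `^ (a - Q) by exact: mulr_ge0 (ltW kconst_gt0) (powR_ge0 _ _).
apply: (@le_trans _ _ (\int[nu]_(z in E) ((r y * ka z)%:E + ((kconst * r y `^ (a - Q))%:E *
   ((fun z => (r z `^ (- (Q + (a - 1 - Q))))%:E) \_ D) z))))%E.
  apply: ge0_le_integral => [|z _|||z Ez].
  - exact: mE.
  - by rewrite lee_fin; exact: mulr_ge0 (rho_ge0 _ _ _) (kap_ge0 _).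
  - by apply/measurable_EFinP/measurable_funTS; exact: measurable_funM.
  - apply: emeasurable_funD; first exact: (measurable_funTS mk1).
    apply: measurable_funeM; apply: measurable_funTS.
    by apply/(measurable_restrictT _ mD); exact: (measurable_funTS mp1).
  - rewrite patchE; have rz := r_gt0 Ez; have [rzy|ryz] := ltP (r z) (r y).
      rewrite memNset ?mule0 ?adde0 ?lee_fin; first exact: (ler_wpM2r (kap_ge0 z) (ltW rzy)).
      by move=> -[_ /=]; rewrite leNgt rzy.
    rewrite mem_set; last by [].
    rewrite -EFinM -EFinD lee_fin.
    have H := ler_wpM2l (ltW rz) (kap_le_other Ez Ey).
    have ry0 := mulr_ge0 (ltW ry) (kap_ge0 z).
    apply: (le_trans H); rewrite -[X in X <= _]add0r; apply: (lerD ry0).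
    have E1 : r z `^ (- (Q + (a - 1 - Q))) = r z * r z `^ (- a).
      by rewrite -{2}(powRr1 (ltW rz)) -powRD ?(gt_eqF rz) ?implybT//; congr (_ `^ _); ring.
    rewrite E1 -/a; move: (r z `^ _) (r y `^ _) => e f.
    by rewrite le_eqVlt; apply/orP; left; apply/eqP; ring.
rewrite ge0_integralD; last 5 first.
- exact: mE.
- by move=> z _; rewrite lee_fin; exact: mulr_ge0 (rho_ge0 _ _ _) (kap_ge0 _).
- exact: (measurable_funTS mk1).
- move=> z _; apply: mule_ge0; first by rewrite lee_fin.
  by rewrite patchE; case: ifP => _; rewrite lee_fin ?powR_ge0.
- apply: measurable_funeM; apply: measurable_funTS.
  by apply/(measurable_restrictT _ mD); exact: (measurable_funTS mp1).
rewrite /moment_const mulrDl mul1r EFinD; apply: leeD.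
  under eq_integral do rewrite EFinM.
  rewrite ge0_integralZl_EFin ?rho_ge0//; last 2 first.
  - by move=> z _; rewrite lee_fin; exact: kap_ge0.
  - by apply/measurable_EFinP.
  by rewrite ka1 mule1.
rewrite ge0_integralZl_EFin//; last 2 first.
- by move=> z _; rewrite patchE; case: ifP => _; rewrite lee_fin ?powR_ge0.
- apply: measurable_funTS; apply/(measurable_restrictT _ mD); exact: (measurable_funTS mp1).
rewrite -integral_mkcondr.
have DE : E `&` D = D by rewrite /D setIA setIid.
rewrite DE.
have A0 : 0 <= A * 2 `^ Q by rewrite mulr_ge0 ?powR_ge0.
have mrE : measurable_fun E r by exact: (measurable_funTS mr).
have F := integral_powRN_far mE mrE A0 (ltW Q_gt0) nu_rho_lt s_gt0 ry.
have H : (0 <= (kconst * r y `^ (a - Q))%:E)%E by rewrite lee_fin.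
apply: (le_trans (lee_wpmul2l H F)).
rewrite -EFinM lee_fin -/a.
have Er : r y = r y `^ (a - Q) * r y `^ (- (a - 1 - Q)).
  rewrite -powRD ?(gt_eqF ry) ?implybT//.
  by rewrite (_ : a - Q + - (a - 1 - Q) = 1) ?powRr1 ?(ltW ry)//; ring.
rewrite [X in _ <= _ * X]Er; move: (_ / (1 - 2 `^ _)) (r y `^ _) (r y `^ _) => e f g.
by rewrite le_eqVlt; apply/orP; left; apply/eqP; ring.
Qed.

Let moment_const_ge1 : 1 <= moment_const.
Proof.
have /andP[_ h] := powR2N_itv s_gt0.
rewrite lerDl; apply: (mulr_ge0 (ltW kconst_gt0)).
by rewrite divr_ge0 ?mulr_ge0 ?powR_ge0// subr_ge0 ltW.
Qed.

(** The distance from [y] to [z] is at most [rho(y) + rho(z)], and [kap_moment] bounds the average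
    of [rho(z)]. *)
Lemma kavg_lipschitz_le y : E y -> `|u y - kavg eps u x| <= L * (1 + moment_const) * r y.
Proof.
move=> Ey; have C0 : 0 <= moment_const by rewrite (le_trans ler01).
apply: (le_trans (wavg_norm_le mE mkaE (fun y _ => kap_ge0 y) ka1 iu ka_le_bound nuE (u y))).
pose I := (\int[nu]_(z in E) (`|u y - u z| * ka z)%:E)%E.
have I0 : (0 <= I)%E.
  by apply: integral_ge0 => z _; rewrite lee_fin; exact: mulr_ge0 (normr_ge0 _) (kap_ge0 _).
suff IL : (I <= (L * (1 + moment_const) * r y)%:E)%E.
  rewrite -lee_fin /Rintegral fineK// ge0_fin_numE//.
  exact: le_lt_trans IL (ltry _).
have mrk : measurable_fun E (fun z => (r z * ka z)%:E).
  by apply/measurable_EFinP/measurable_funTS; exact: measurable_funM.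
have mrk1 : measurable_fun E (fun z => (r y * ka z)%:E).
  by apply/measurable_EFinP/measurable_funTS; exact: measurable_funM.
have H0 z : (0 <= (r y * ka z)%:E)%E by rewrite lee_fin; exact: mulr_ge0 (rho_ge0 _ _ _) (kap_ge0 _).
have H1 z : (0 <= (r z * ka z)%:E)%E by rewrite lee_fin; exact: mulr_ge0 (rho_ge0 _ _ _) (kap_ge0 _).
apply: (@le_trans _ _ (\int[nu]_(z in E) (L%:E * ((r y * ka z)%:E + (r z * ka z)%:E)))%E).
  apply: ge0_le_integral => [|z _|||z Ez].
  - exact: mE.
  - by rewrite lee_fin; exact: mulr_ge0 (normr_ge0 _) (kap_ge0 _).
  - apply/measurable_EFinP/measurable_funTS; apply: measurable_funM => //.
    by apply: measurableT_comp => //; exact: measurable_funB.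
  - by apply: measurable_funeM; exact: emeasurable_funD.
  - rewrite -EFinD -EFinM lee_fin -mulrDl mulrA; apply: (ler_wpM2r (kap_ge0 z)).
    apply: (le_trans (u_lip Ey Ez)); apply: (ler_wpM2l L_ge0).
    apply: (le_trans (eudist_triangle x _ _)); rewrite [eudist (pt y) x]eudistC.
    exact: lerD (eudist_le_rho _ _ _) (eudist_le_rho _ _ _).
rewrite ge0_integralZl_EFin//; last 2 first.
- by move=> z _; apply: adde_ge0.
- exact: emeasurable_funD.
rewrite -mulrA EFinM lee_wpmul2l ?lee_fin// ge0_integralD//.
rewrite mulrDl mul1r EFinD; apply: leeD; last exact: kap_moment.
under eq_integral do rewrite EFinM.
rewrite ge0_integralZl_EFin ?rho_ge0//; last 2 first.
- by move=> z _; rewrite lee_fin; exact: kap_ge0.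
- by apply/measurable_EFinP.
by rewrite ka1 mule1.
Qed.

(** The factor [1 / rho(y)] from the derivative of the kernel cancels the factor [rho(y)] of
    [kavg_lipschitz_le], leaving a bound independent of [eps]. *)
Lemma dkavg_lipschitz_le h :
  `|dkavg eps h u x| <= m.*2%:R * eunorm h * (L * (1 + moment_const)).
Proof.
pose M := m.*2%:R * eunorm h * (L * (1 + moment_const)).
have gL y : E y ->
    `|(u y - kavg eps u x) * (dker m eps h x (pt y) / K)| <= M * ka y.
  move=> Ey; have ry := r_gt0 Ey; rewrite normrM.
  have H1 := kavg_lipschitz_le Ey.
  have H2 : `|dker m eps h x (pt y) / K| <= m.*2%:R * eunorm h * ((r y)^-1 * ka y).
    rewrite normrM (gtr0_norm (_ : 0 < K^-1)) ?invr_gt0//.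
    rewrite /kap !mulrA ler_wpM2r ?invr_ge0 ?(ltW K_gt0)// -mulrA.
    exact: (norm_dker_le m h (r_gt0 Ey)).
  apply: (le_trans (ler_pM (normr_ge0 _) (normr_ge0 _) H1 H2)).
  rewrite le_eqVlt; apply/orP; left; apply/eqP; rewrite /M.
  move: ry; move: (r y) (ka y) => ry ky ry0.
  by field; rewrite gt_eqF.
have ika : nu.-integrable E (EFin \o ka).
  apply/integrableP; split; first by apply/measurable_EFinP.
  under eq_integral => y _ do rewrite /= ger0_norm ?kap_ge0//.
  by rewrite ka1 ltry.
have icka : nu.-integrable E (EFin \o (fun y => M * ka y)).
  by apply: eq_integrable (integrableZl mE M ika) => // y _; rewrite /= EFinM.
have mg : measurable_fun E (fun y => (u y - kavg eps u x) * (dker m eps h x (pt y) / K)).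
  apply: measurable_funTS; apply: measurable_funM; first exact: measurable_funB.
  apply: measurable_funM => //.
  exact: (measurable_dker eps m h (measurable_coords_cst x) mpt).
have ig : nu.-integrable E (EFin \o (fun y => (u y - kavg eps u x) * (dker m eps h x (pt y) / K))).
  apply: (le_integrable mE _ _ icka); first exact/measurable_EFinP.
  by move=> y Ey; rewrite /= lee_fin (le_trans (gL y Ey))// ler_norm.
apply: (le_trans (le_normr_Rintegral mE ig)).
apply: (@le_trans _ _ (\int[nu]_(y in E) (M * ka y))).
  by apply: le_Rintegral => //; exact: integrable_norm ig.
by rewrite RintegralZl// /Rintegral ka1/= mulr1.
Qed.

End kernel_average.

(** * Averages at a fixed positive scale: differentiability and global bounds *)

Section kernel_average_smooth.
Context d (X : measurableType d) (R : realType) (n : nat).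
Variables (nu : {finite_measure set X -> \bar R}) (E : set X) (pt : X -> 'rV[R]_n).
Variables (m : nat) (D eps : R).
Hypotheses (mE : measurable E) (mpt : measurable_coords [set: X] pt).
Hypotheses (eps_gt0 : 0 < eps) (nuE_gt0 : (0 < nu E)%E).
Hypothesis diamD : forall y z, E y -> E z -> eudist (pt y) (pt z) <= D.

Let rho_gt0 x y : 0 < rho eps x (pt y).
Proof. exact: lt_le_trans (eps_le_rho _ _ _). Qed.

Let M0 : R := (eps ^+ 2)^-1 ^+ m.

Let ker_le x y : ker m eps x (pt y) <= M0.
Proof.
rewrite /ker /M0 lerXn2r ?nnegrE ?invr_ge0 ?rho2_ge0 ?sqr_ge0//.
rewrite -sqr_rho lef_pV2 ?posrE ?exprn_gt0//.
by rewrite lerXn2r ?nnegrE ?(ltW eps_gt0) ?rho_ge0// eps_le_rho.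
Qed.

Let dker_le h x y : `|dker m eps h x (pt y)| <= m.*2%:R * eunorm h * (eps^-1 * ker m eps x (pt y)).
Proof.
apply: (le_trans (norm_dker_le m h (rho_gt0 x y))).
rewrite ler_wpM2l ?mulr_ge0 ?eunorm_ge0// ler_wpM2r ?ker_ge0//.
by rewrite lef_pV2 ?posrE// eps_le_rho.
Qed.

(** A Harnack-type constant: kernel values at two points of the bounded set [E] are comparable
    uniformly in [x], even far away where both tend to 0. This keeps the normalized weights bounded
    on all of [R^n]. *)
Let Lam : R := ((1 + D / eps) ^+ 2) ^+ m.

Let ker_compare x y z : E y -> E z -> ker m eps x (pt y) <= Lam * ker m eps x (pt z).
Proof.
move=> Ey Ez; have D0 : 0 <= D by apply: le_trans (diamD Ey Ez); exact: eudist_ge0.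
have H : rho eps x (pt z) <= (1 + D / eps) * rho eps x (pt y).
  apply: (le_trans (rho_triangle eps x (pt y) (pt z))); rewrite mulrDl mul1r lerD2l.
  apply: (le_trans (diamD Ey Ez)); rewrite -{1}(divfK (lt0r_neq0 eps_gt0) D).
  by rewrite ler_wpM2l ?divr_ge0 ?(ltW eps_gt0)// eps_le_rho.
have q_gt0 w : 0 < rho2 eps x (pt w) by rewrite -sqr_rho exprn_gt0.
rewrite /Lam /ker -exprMn; apply: lerXn2r.
- by rewrite nnegrE invr_ge0 rho2_ge0.
- by rewrite nnegrE mulr_ge0 ?sqr_ge0// invr_ge0 rho2_ge0.
rewrite ler_pdivlMr// mulrC ler_pdivrMr// -!sqr_rho.
rewrite -exprMn lerXn2r ?nnegrE ?mulr_ge0 ?rho_ge0//.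
by rewrite addr_ge0 ?divr_ge0 ?(ltW eps_gt0).
Qed.

Let mk x : measurable_fun E (fun y => ker m eps x (pt y)).
Proof. exact: (measurable_funTS (measurable_ker _ _ (measurable_coords_cst x) mpt)). Qed.

Let mdk h x : measurable_fun E (fun y => dker m eps h x (pt y)).
Proof. exact: (measurable_funTS (measurable_dker _ _ _ (measurable_coords_cst x) mpt)). Qed.

Let iuk u x : nu.-integrable E (EFin \o u) ->
  nu.-integrable E (EFin \o (fun y => u y * ker m eps x (pt y))).
Proof.
move=> iu; apply: (@integrable_mul_bounded _ _ _ nu _ mE _ _ M0 iu (mk x)) => y _.
by rewrite ger0_norm ?ker_ge0.
Qed.

Let iudk u h x : nu.-integrable E (EFin \o u) ->
  nu.-integrable E (EFin \o (fun y => u y * dker m eps h x (pt y))).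
Proof.
move=> iu; apply: (@integrable_mul_bounded _ _ _ nu _ mE _ _
  (m.*2%:R * eunorm h * (eps^-1 * M0)) iu (mdk h x)) => y _.
apply: (le_trans (dker_le h x y)); rewrite ler_wpM2l ?mulr_ge0 ?eunorm_ge0//.
by rewrite ler_wpM2l ?invr_ge0 ?(ltW eps_gt0).
Qed.

Let i1 : nu.-integrable E (EFin \o (fun=> 1)).
Proof. exact: (finite_measure_integrable_cst nu 1 mE). Qed.

Let ik x : nu.-integrable E (EFin \o (fun y => ker m eps x (pt y))).
Proof. by apply: eq_integrable (iuk x i1) => // y _; rewrite /= mul1r. Qed.

Let idk h x : nu.-integrable E (EFin \o (fun y => dker m eps h x (pt y))).
Proof. by apply: eq_integrable (iudk h x i1) => // y _; rewrite /= mul1r. Qed.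

Let nE : R := fine (nu E).
Let nE_gt0 : 0 < nE.
Proof. by rewrite /nE fine_gt0// nuE_gt0 ltey_eq fin_num_measure. Qed.

Let ker_le_kmass x y : E y -> ker m eps x (pt y) <= Lam / nE * kmass nu E pt m eps x.
Proof.
move=> Ey; rewrite mulrAC ler_pdivlMr// /kmass -RintegralZl//.
have -> : ker m eps x (pt y) * nE = \int[nu]_(z in E) (ker m eps x (pt y)).
  by rewrite Rintegral_cst.
apply: le_Rintegral => //.
- exact: (finite_measure_integrable_cst nu _ mE).
- by apply: eq_integrable (integrableZl mE Lam (ik x)) => // z _; rewrite /= EFinM.
- by move=> z Ez; exact: ker_compare.
Qed.

Let Lam_ge0 : 0 <= Lam. Proof. by rewrite exprn_ge0// sqr_ge0. Qed.

Lemma kmass_gt0 x : 0 < kmass nu E pt m eps x.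
Proof.
have [y Ey] : E !=set0.
  by apply/set0P; apply: contraTN nuE_gt0 => /eqP ->; rewrite measure0 ltxx.
have H := lt_le_trans (ker_gt0 m (rho_gt0 x y)) (ker_le_kmass x Ey).
rewrite lt_neqAle Rintegral_ge0 ?andbT; last by move=> z _; exact: ker_ge0.
by apply: contraTneq H => <-; rewrite mulr0 ltxx.
Qed.

Let kap_le_cst x y : E y -> kap nu E pt m eps x y <= Lam / nE.
Proof. by move=> Ey; rewrite ler_pdivrMr ?kmass_gt0//; exact: ker_le_kmass. Qed.

Variable u : X -> R.
Hypothesis iu : nu.-integrable E (EFin \o u).

Lemma kavgE x : kavg nu E pt m eps u x =
  (\int[nu]_(y in E) (u y * ker m eps x (pt y))) / kmass nu E pt m eps x.
Proof.
rewrite /kavg /wavg -RintegralZr//; last exact: iuk.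
by apply: eq_Rintegral => y _; rewrite /kap mulrA.
Qed.

Let is_derive_integral_ker v (h x : 'rV[R]_n) : nu.-integrable E (EFin \o v) ->
  is_derive (0 : R) (1 : R) (fun t => \int[nu]_(y in E) (v y * ker m eps (x + t *: h) (pt y)))
    (\int[nu]_(y in E) (v y * dker m eps h x (pt y))).
Proof.
move=> iv; pose f t y := v y * ker m eps (x + t *: h) (pt y).
pose c := m.*2%:R * eunorm h * (eps^-1 * M0).
have c0 : 0 <= c.
  by rewrite !mulr_ge0 ?eunorm_ge0 ?invr_ge0 ?(ltW eps_gt0)// exprn_ge0// invr_ge0 sqr_ge0.
have df t y : is_derive t (1 : R) (f ^~ y) (v y * dker m eps h (x + t *: h) (pt y)).
  have H := @is_derive_ker R n m eps h x (pt y) t eps_gt0.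
  exact: (is_derive_eq (is_deriveZ (v y) H)).
(* The dominating function does not depend on [t], so any open interval around 0 would serve. *)
have I0 : `]-1, 1[%classic (0 : R) by rewrite /= in_itv/= ltr01 ltrN10.
have fint t : `]-1, 1[%classic t -> nu.-integrable E (EFin \o f t) by move=> _; exact: iuk.
have fder t y : `]-1, 1[%classic t -> E y -> derivable (f ^~ y) t 1 by move=> _ _; case: (df t y).
have G0 y : 0 <= `|v y| * c by rewrite mulr_ge0.
have iG : nu.-integrable E (EFin \o (fun y => `|v y| * c)).
  apply: eq_integrable (integrableZl mE c (integrable_norm iv)) => // y _.
  by rewrite /= mulrC EFinM.
have pE t y : partial1of2 f t y = v y * dker m eps h (x + t *: h) (pt y).
  by rewrite partial1of2E; have [_ ->] := df t y.
have Gub t y : `]-1, 1[%classic t -> E y -> `|partial1of2 f t y| <= `|v y| * c.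
  move=> _ _; rewrite pE normrM ler_wpM2l// (le_trans (dker_le _ _ _))//.
  by rewrite ler_wpM2l ?mulr_ge0 ?eunorm_ge0// ler_wpM2l ?invr_ge0 ?(ltW eps_gt0).
have H1 := derivable_under_integral mE I0 fint fder G0 iG Gub.
have H2 := differentiation_under_integral mE I0 fint fder G0 iG Gub.
apply: DeriveDef; first exact: H1.
rewrite -derive1E H2; apply: eq_Rintegral => y _.
by rewrite pE scale0r addr0.
Qed.

(** The quotient rule gives [(I - a J) / k] with [a] the average itself, which is the centred form
    of [dkavg]. *)
Lemma is_derive_kavg h x :
  is_derive (0 : R) (1 : R) (dir_along (kavg nu E pt m eps u) x h) (dkavg nu E pt m eps h u x).
Proof.
pose N t := \int[nu]_(y in E) (u y * ker m eps (x + t *: h) (pt y)).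
(* The factor 1 lets one differentiation lemma serve both the numerator and the mass. *)
pose K t := \int[nu]_(y in E) (1 * ker m eps (x + t *: h) (pt y)).
have KE t : K t = kmass nu E pt m eps (x + t *: h).
  by apply: eq_Rintegral => y _; rewrite mul1r.
have -> : dir_along (kavg nu E pt m eps u) x h = N * (fun t => (K t)^-1).
  by apply/funext => t; rewrite /dir_along kavgE -KE.
pose I := \int[nu]_(y in E) (u y * dker m eps h x (pt y)).
pose J := \int[nu]_(y in E) (1 * dker m eps h x (pt y)).
have dN : is_derive (0 : R) (1 : R) N I by exact: is_derive_integral_ker.
have dK : is_derive (0 : R) (1 : R) K J by exact: is_derive_integral_ker.
have K0 : K 0 != 0 by rewrite KE gt_eqF// kmass_gt0.
have dV := is_deriveV K0 dK.
apply: (is_derive_eq (is_deriveM dN dV)).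
rewrite /dkavg; set k := kmass _ _ _ _ _ _; set a := kavg _ _ _ _ _ _ _.
have k0 : k != 0 by rewrite gt_eqF// kmass_gt0.
have KEx : K 0 = k by rewrite KE scale0r addr0.
have NE : N 0 = a * k by rewrite /N scale0r addr0 /a kavgE divfK.
have -> : \int[nu]_(y in E) ((u y - a) * (dker m eps h x (pt y) / k)) = k^-1 * (I - a * J).
  have iad : nu.-integrable E (EFin \o (fun y => a * (1 * dker m eps h x (pt y)))).
    by apply: eq_integrable (integrableZl mE a (iudk h x i1)) => // y _; rewrite /= EFinM.
  rewrite -RintegralZl//; last exact: iudk.
  rewrite -RintegralB//; last exact: iudk.
  rewrite -RintegralZl//; last first.
    by apply: eq_integrable (integrableB mE (iudk h x iu) iad) => // y _; rewrite /= EFinB.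
  by apply: eq_Rintegral => y _; rewrite mul1r; ring.
rewrite KEx NE -/I -/J /GRing.scale/=.
by field.
Qed.

Lemma kavg_bounded : exists C, forall x, `|kavg nu E pt m eps u x| <= C.
Proof.
exists (Lam / nE * \int[nu]_(y in E) `|u y|) => x.
have ka0 y : 0 <= kap nu E pt m eps x y by rewrite divr_ge0 ?ker_ge0 ?(ltW (kmass_gt0 _)).
have iuka : nu.-integrable E (EFin \o (fun y => u y * kap nu E pt m eps x y)).
  apply: (@integrable_mul_bounded _ _ _ nu _ mE _ _ (Lam / nE) iu).
    exact: (measurable_funM (mk x) (measurable_cst _)).
  by move=> y Ey; rewrite ger0_norm// kap_le_cst.
apply: (le_trans (le_normr_Rintegral mE iuka)).
rewrite -RintegralZl//; last exact: integrable_norm iu.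
apply: le_Rintegral => //.
- exact: integrable_norm iuka.
- by apply: eq_integrable (integrableZl mE _ (integrable_norm iu)) => // y _; rewrite /= EFinM.
- move=> y Ey; rewrite normrM mulrC (ger0_norm (ka0 y)).
  by apply: (ler_wpM2r (normr_ge0 _)); exact: kap_le_cst.
Qed.

Lemma dkavg_bounded h : exists C, forall x, `|dkavg nu E pt m eps h u x| <= C.
Proof.
have [C uC] := kavg_bounded.
have C0 : 0 <= C by apply: le_trans (uC 0); exact: normr_ge0.
pose b := m.*2%:R * eunorm h * (eps^-1 * (Lam / nE)).
have b0 : 0 <= b.
  by rewrite !mulr_ge0 ?eunorm_ge0 ?invr_ge0 ?(ltW eps_gt0) ?(ltW nE_gt0).
exists (b * \int[nu]_(y in E) (`|u y| + C)) => x.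
pose g y := dker m eps h x (pt y) / kmass nu E pt m eps x.
have gb y : E y -> `|g y| <= b.
  move=> Ey; rewrite /g normrM (gtr0_norm (_ : 0 < (kmass nu E pt m eps x)^-1)) ?invr_gt0 ?kmass_gt0//.
  apply: (le_trans (ler_wpM2r _ (dker_le h x y))); first by rewrite invr_ge0 ltW// kmass_gt0.
  rewrite /b -!mulrA; apply: ler_wpM2l => //; apply: (ler_wpM2l (eunorm_ge0 _)).
  apply: ler_wpM2l; first by rewrite invr_ge0 ltW.
  exact: kap_le_cst.
have iuv : nu.-integrable E (EFin \o (fun y => u y - kavg nu E pt m eps u x)).
  apply: eq_integrable (integrableB mE iu
    (finite_measure_integrable_cst nu (kavg nu E pt m eps u x) mE)) => // y _.
have iC : nu.-integrable E (EFin \o (fun y => `|u y| + C)).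
  apply: eq_integrable (integrableD mE (integrable_norm iu)
    (finite_measure_integrable_cst nu C mE)) => // y _.
have mg : measurable_fun E g by exact: (measurable_funM (mdk h x) (measurable_cst _)).
have ig : nu.-integrable E (EFin \o (fun y => (u y - kavg nu E pt m eps u x) * g y)).
  exact: (integrable_mul_bounded mE iuv mg gb).
apply: (le_trans (le_normr_Rintegral mE ig)).
rewrite -RintegralZl//.
apply: le_Rintegral => //.
- exact: integrable_norm ig.
- by apply: eq_integrable (integrableZl mE b iC) => // y _; rewrite /= EFinM.
- move=> y Ey; rewrite normrM mulrC; apply: ler_pM => //; first exact: gb.
  by rewrite (le_trans (ler_normB _ _))// lerD2l.
Qed.

End kernel_average_smooth.

(** * Convergence of the averages at positive distance from the set *)

Section kernel_average_limit.
Context d (X : measurableType d) (R : realType) (n : nat).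
Variables (nu : {finite_measure set X -> \bar R}) (E : set X) (pt : X -> 'rV[R]_n).
Variables (m : nat) (u : X -> R).
Hypotheses (mE : measurable E) (mpt : measurable_coords [set: X] pt).
Hypothesis iu : nu.-integrable E (EFin \o u).

Lemma integral_mul_cvg (v : X -> R) (g_ : (X -> R)^nat) (g : X -> R) (C : R) :
  nu.-integrable E (EFin \o v) ->
  (forall j, measurable_fun E (g_ j)) -> (forall j y, E y -> `|g_ j y| <= C) ->
  measurable_fun E g -> (forall y, E y -> g_ j y @[j --> \oo] --> g y) ->
  \int[nu]_(y in E) (v y * g_ j y) @[j --> \oo] --> \int[nu]_(y in E) (v y * g y).
Proof.
move=> iv mg gC mgl gg.
have mv : measurable_fun E v by have /measurable_int/measurable_EFinP := iv.
have C0 y : E y -> 0 <= C by move=> Ey; apply: le_trans (gC 0%N _ Ey); exact: normr_ge0.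
have iG : nu.-integrable E (EFin \o (fun y => C * `|v y|)).
  by apply: eq_integrable (integrableZl mE C (integrable_norm iv)) => // y _; rewrite /= EFinM.
have mf j : measurable_fun E (fun y => (v y * g_ j y)%:E).
  by apply/measurable_EFinP; exact: measurable_funM.
have ff y : E y -> (v y * g_ j y)%:E @[j --> \oo] --> (v y * g y)%:E.
  by move=> Ey; apply: cvg_EFin; [exact: nearW|apply: cvgM; [exact: cvg_cst|exact: gg]].
have fG j y : E y -> (`|(v y * g_ j y)%:E| <= (C * `|v y|)%:E)%E.
  move=> Ey; rewrite /= lee_fin normrM mulrC ler_wpM2r//; exact: gC.
have mfg : measurable_fun E (fun y => (v y * g y)%:E) by apply/measurable_EFinP; exact: measurable_funM.
have [it _ cv] := dominated_convergence mE mf mfg (aeW _ ff) iG (aeW _ (fun y j => fG j y)).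
apply: fine_cvg; rewrite fineK; last exact: (integrable_fin_num mE it).
exact: cv.
Qed.

Lemma kavg_dominated eps x :
  nu.-integrable E (EFin \o (fun y => u y * ker m eps x (pt y))) ->
  kavg nu E pt m eps u x =
    (\int[nu]_(y in E) (u y * ker m eps x (pt y))) / kmass nu E pt m eps x.
Proof.
move=> iuk; rewrite /kavg /wavg -RintegralZr//.
by apply: eq_Rintegral => y _; rewrite /kap mulrA.
Qed.

Lemma dkavg_dominated eps h x :
  nu.-integrable E (EFin \o (fun y => u y * dker m eps h x (pt y))) ->
  nu.-integrable E (EFin \o (fun y => 1 * dker m eps h x (pt y))) ->
  dkavg nu E pt m eps h u x =
    (\int[nu]_(y in E) (u y * dker m eps h x (pt y)) -
      kavg nu E pt m eps u x * \int[nu]_(y in E) (1 * dker m eps h x (pt y)))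
    / kmass nu E pt m eps x.
Proof.
move=> iudk idk; rewrite /dkavg; set a := kavg _ _ _ _ _ _ _; set k := kmass _ _ _ _ _ _.
have iad : nu.-integrable E (EFin \o (fun y => a * (1 * dker m eps h x (pt y)))).
  by apply: eq_integrable (integrableZl mE a idk) => // y _; rewrite /= EFinM.
rewrite -RintegralZl// -RintegralB// -RintegralZr//; last first.
  by apply: eq_integrable (integrableB mE iudk iad) => // y _; rewrite /= EFinB.
by apply: eq_Rintegral => y _; rewrite mul1r; ring.
Qed.

Variables (x : 'rV[R]_n) (delta : R) (e : R^nat).
Hypotheses (delta_gt0 : 0 < delta) (x_far : forall y, E y -> delta <= eudist x (pt y)).
Hypothesis e0 : e j @[j --> \oo] --> 0.
Hypothesis K0 : kmass nu E pt m 0 x != 0.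

Let M0 : R := (delta ^+ 2)^-1 ^+ m.

Let rho_ge eps y : E y -> delta <= rho eps x (pt y).
Proof. by move=> Ey; rewrite (le_trans (x_far Ey))// eudist_le_rho. Qed.

Let rho_gt0 eps y : E y -> 0 < rho eps x (pt y).
Proof. by move=> Ey; rewrite (lt_le_trans delta_gt0)// rho_ge. Qed.

Let ker_le eps y : E y -> `|ker m eps x (pt y)| <= M0.
Proof.
move=> Ey; rewrite ger0_norm ?ker_ge0// /ker /M0; apply: lerXn2r.
- by rewrite nnegrE invr_ge0 rho2_ge0.
- by rewrite nnegrE invr_ge0 sqr_ge0.
rewrite -sqr_rho lef_pV2 ?posrE ?exprn_gt0 ?rho_gt0//.
by rewrite lerXn2r ?nnegrE ?(ltW delta_gt0) ?rho_ge0// rho_ge.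
Qed.

Let dker_le eps h y : E y -> `|dker m eps h x (pt y)| <= m.*2%:R * eunorm h * (delta^-1 * M0).
Proof.
move=> Ey; apply: (le_trans (norm_dker_le m h (rho_gt0 eps Ey))).
rewrite ler_wpM2l ?mulr_ge0 ?eunorm_ge0// ler_pM ?ker_ge0 ?invr_ge0 ?rho_ge0//.
  by rewrite lef_pV2 ?posrE ?rho_gt0// rho_ge.
by rewrite (le_trans (ler_norm _))// ker_le.
Qed.

Let mk eps : measurable_fun E (fun y => ker m eps x (pt y)).
Proof. exact: (measurable_funTS (measurable_ker _ _ (measurable_coords_cst x) mpt)). Qed.

Let mdk eps h : measurable_fun E (fun y => dker m eps h x (pt y)).
Proof. exact: (measurable_funTS (measurable_dker _ _ _ (measurable_coords_cst x) mpt)). Qed.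

Let i1 : nu.-integrable E (EFin \o (fun=> 1)).
Proof. exact: (finite_measure_integrable_cst nu 1 mE). Qed.

Let iuk eps := integrable_mul_bounded mE iu (mk eps) (ker_le eps).
Let iudk eps h := integrable_mul_bounded mE iu (mdk eps h) (dker_le eps h).
Let idk eps h := integrable_mul_bounded mE i1 (mdk eps h) (dker_le eps h).

Let eudist_gt0' y : E y -> 0 < eudist x (pt y).
Proof. by move=> Ey; rewrite (lt_le_trans delta_gt0)// x_far. Qed.

Let kmass_cvg : kmass nu E pt m (e j) x @[j --> \oo] --> kmass nu E pt m 0 x.
Proof.
have H := integral_mul_cvg i1 (fun j => mk (e j)) (fun j => @ker_le (e j)) (mk 0)
  (fun y Ey => ker_cvg (eudist_gt0' Ey) e0).
have E1 eps : kmass nu E pt m eps x = \int[nu]_(y in E) (1 * ker m eps x (pt y)).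
  by apply: eq_Rintegral => y _; rewrite mul1r.
by rewrite E1; under eq_fun do rewrite E1.
Qed.

Lemma kavg_cvg : kavg nu E pt m (e j) u x @[j --> \oo] --> kavg nu E pt m 0 u x.
Proof.
rewrite kavg_dominated//; under eq_fun do rewrite kavg_dominated//.
apply: cvgM; last exact: cvgV.
exact: (integral_mul_cvg iu (fun j => mk (e j)) (fun j => @ker_le (e j)) (mk 0)
  (fun y Ey => ker_cvg (eudist_gt0' Ey) e0)).
Qed.

Lemma dkavg_cvg h : dkavg nu E pt m (e j) h u x @[j --> \oo] --> dkavg nu E pt m 0 h u x.
Proof.
rewrite dkavg_dominated//; under eq_fun do rewrite dkavg_dominated//.
have H v : nu.-integrable E (EFin \o v) ->
    \int[nu]_(y in E) (v y * dker m (e j) h x (pt y)) @[j --> \oo] -->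
    \int[nu]_(y in E) (v y * dker m 0 h x (pt y)).
  move=> iv; exact: (integral_mul_cvg iv (fun j => mdk (e j) h) (fun j => @dker_le (e j) h) (mdk 0 h)
    (fun y Ey => dker_cvg (eudist_gt0' Ey) e0)).
apply: cvgM; last exact: cvgV.
by apply: cvgB; [exact: H|apply: cvgM; [exact: kavg_cvg|exact: H]].
Qed.

End kernel_average_limit.

(** * Measurable dependence of the averages on the point *)

Section measurable_kernel_average.
Context d (X : measurableType d) d' (Y : measurableType d') (R : realType) (n : nat).
Variables (nu : {finite_measure set X -> \bar R}) (E : set X).
Variables (pt : X -> 'rV[R]_n) (sp : Y -> 'rV[R]_n) (m : nat) (u : X -> R) (eps : R).
Hypotheses (mE : measurable E) (mpt : measurable_coords [set: X] pt).
Hypotheses (msp : measurable_coords [set: Y] sp) (mu : measurable_fun [set: X] u).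

Lemma measurable_coords_fst : measurable_coords [set: Y * X] (fun z => sp z.1).
Proof. by move=> i; exact: (measurableT_comp (msp i) measurable_fst). Qed.

Lemma measurable_coords_snd : measurable_coords [set: Y * X] (fun z => pt z.2).
Proof. by move=> i; exact: (measurableT_comp (mpt i) measurable_snd). Qed.

Let mu' : measurable_fun [set: Y * X] (fun z => u z.2).
Proof. exact: (measurableT_comp mu measurable_snd). Qed.

Let mkm : measurable_fun [set: Y] (fun z => (kmass nu E pt m eps (sp z))^-1).
Proof.
have -> : (fun z => (kmass nu E pt m eps (sp z))^-1) =
    (fun z => kmass nu E pt m eps (sp z) `^ (-1)).
  apply/funext => z; rewrite powR_inv1//.
  by apply: Rintegral_ge0 => y _; exact: ker_ge0.
apply: (measurableT_comp (measurable_powR _)).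
exact: (measurable_section_Rintegral nu mE (measurable_ker eps m measurable_coords_fst measurable_coords_snd)).
Qed.

Let mkm' : measurable_fun [set: Y * X] (fun z => (kmass nu E pt m eps (sp z.1))^-1).
Proof. exact: (measurableT_comp mkm measurable_fst). Qed.

Lemma measurable_kavg : measurable_fun [set: Y] (fun z => kavg nu E pt m eps u (sp z)).
Proof.
have mf : measurable_fun [set: Y * X]
    (fun z => u z.2 * (ker m eps (sp z.1) (pt z.2) / kmass nu E pt m eps (sp z.1))).
  apply: (measurable_funM mu' (measurable_funM _ mkm')).
  exact: (measurable_ker eps m measurable_coords_fst measurable_coords_snd).
exact: (measurable_section_Rintegral nu mE mf).
Qed.

Lemma measurable_dkavg h : measurable_fun [set: Y] (fun z => dkavg nu E pt m eps h u (sp z)).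
Proof.
have mf : measurable_fun [set: Y * X]
    (fun z => (u z.2 - kavg nu E pt m eps u (sp z.1)) *
       (dker m eps h (sp z.1) (pt z.2) / kmass nu E pt m eps (sp z.1))).
  apply: measurable_funM.
    by apply: (measurable_funB mu'); exact: (measurableT_comp measurable_kavg measurable_fst).
  apply: (measurable_funM _ mkm').
  exact: (measurable_dker eps m h measurable_coords_fst measurable_coords_snd).
exact: (measurable_section_Rintegral nu mE mf).
Qed.

End measurable_kernel_average.

(** Restricting [lam] to [D] makes it finite, and the restriction to [D] and [E] is encoded as an
    indicator on the product, so the full Tonelli theorem applies. *)
Lemma tonelli_on d d' (Y : measurableType d) (X : measurableType d') (R : realType)
    (lam : {measure set Y -> \bar R}) (nu : {finite_measure set X -> \bar R})
    (D : set Y) (E : set X) (f : Y * X -> \bar R) :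
  measurable D -> measurable E -> (lam D < +oo)%E ->
  measurable_fun [set: Y * X] f -> (forall z, 0 <= f z)%E ->
  (\int[lam]_(w in D) \int[nu]_(y in E) f (w, y) =
   \int[nu]_(y in E) \int[lam]_(w in D) f (w, y))%E.
Proof.
move=> mD mE Doo mf f0.
pose lamD : {finite_measure set Y -> \bar R} := mfrestr mD Doo.
have lamE g : (\int[lam]_(w in D) g w = \int[lamD]_(w in D) g w)%E.
  apply: eq_measure_integral => A mA AD.
  by rewrite /lamD /= /mfrestr /mrestr setIidl.
pose g (z : Y * X) : \bar R := (f z * (\1_(D `*` E) z)%:E)%E.
have mg : measurable_fun [set: Y * X] g.
  apply: emeasurable_funM => //; apply/measurable_EFinP; apply: measurable_indic.
  exact: measurableX.
have g0 z : (0 <= g z)%E by apply: mule_ge0 => //; rewrite lee_fin.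
have T := @fubini_tonelli _ _ Y X R lamD nu g mg g0.
have gin w y : g (w, y) = ((fun w => ((fun y => f (w, y)) \_ E) y) \_ D) w.
  rewrite /g indicE !patchE; case: ifPn => [Dw|Dw].
    case: ifPn => [Ey|Ey].
      by rewrite mem_set ?mule1//; split => /=; rewrite -inE.
    by rewrite memNset ?mule0//= => -[_ /= /mem_set]; exact/negP.
  by rewrite memNset ?mule0//= => -[/= /mem_set Dw' _]; move: Dw; rewrite Dw'.
transitivity (\int[lamD]_w \int[nu]_y g (w, y))%E.
  rewrite lamE integral_mkcond; apply: eq_integral => w _.
  rewrite patchE; case: ifPn => Dw.
    rewrite integral_mkcond; apply: eq_integral => y _.
    by rewrite gin !patchE Dw.
  rewrite integral0_eq// => y _; by rewrite gin !patchE (negbTE Dw).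
rewrite T [RHS]integral_mkcond; apply: eq_integral => y _.
rewrite patchE; case: ifPn => Ey.
  rewrite lamE [RHS]integral_mkcond; apply: eq_integral => w _.
  by rewrite gin !patchE; case: ifP => // _; rewrite Ey.
rewrite integral0_eq// => w _; rewrite gin !patchE; case: ifP => // _.
by rewrite (negbTE Ey).
Qed.

(** * Integrals of the two potentials over the complement of the set *)

Section weighted_integrals.
Context d (Y : measurableType d) d' (X : measurableType d') (R : realType) (n : nat).
Variables (lam : {measure set Y -> \bar R}) (nu : {finite_measure set X -> \bar R}).
Variables (D : set Y) (E : set X) (sp : Y -> 'rV[R]_n) (pt : X -> 'rV[R]_n).
Variables (A N Q p R2 : R) (u : X -> R).
Hypotheses (mD : measurable D) (mE : measurable E) (Doo : (lam D < +oo)%E).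
Hypotheses (msp : measurable_coords [set: Y] sp) (mpt : measurable_coords [set: X] pt).
Hypotheses (mu : measurable_fun [set: X] u).
Hypotheses (A_ge0 : 0 <= A) (Q_gt0 : 0 < Q) (QN : Q < N) (p_gt1 : 1 < p).
Hypothesis growth : forall y (r : R), E y -> 0 < r ->
  (lam (D `&` [set w | (eudist (sp w) (pt y) < r)%R]) <= (A * r `^ N)%:E)%E.
Hypothesis R2_gt0 : 0 < R2.
Hypothesis far : forall w y, D w -> E y -> 0 < eudist (sp w) (pt y) < R2.

Let med y : measurable_fun [set: Y] (fun w => eudist (sp w) (pt y)).
Proof. exact: (measurable_eudist msp (measurable_coords_cst (pt y))). Qed.

Let med2 : measurable_fun [set: Y * X] (fun z => eudist (sp z.1) (pt z.2)).
Proof. exact: (measurable_eudist (measurable_coords_fst msp) (measurable_coords_snd mpt)). Qed.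

(** The constant of [integral_powRN_near] for the exponent [N - Q] and radius [R2]. *)
Definition near_const : R := A * 2 `^ Q / (1 - 2 `^ (- (N - Q))) * R2 `^ (N - Q).

(** After Tonelli the inner integral of the distance to the power [-Q] converges at [y] because
    [Q < N], and [R2] bounds the distances. *)
Lemma integral_powR_weight_le :
  (\int[lam]_(w in D) \int[nu]_(y in E) (`|u y| `^ p * eudist (sp w) (pt y) `^ (- Q))%:E <=
   near_const%:E * \int[nu]_(y in E) (`|u y| `^ p)%:E)%E.
Proof.
have mup : measurable_fun [set: X] (fun y => `|u y| `^ p).
  by apply: (measurableT_comp (measurable_powR _)); exact: measurableT_comp.
have mf : measurable_fun [set: Y * X]
    (fun z => (`|u z.2| `^ p * eudist (sp z.1) (pt z.2) `^ (- Q))%:E).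
  apply/measurable_EFinP; apply: measurable_funM; first exact: (measurableT_comp mup measurable_snd).
  exact: (measurableT_comp (measurable_powR _) med2).
have f0 z : (0 <= (`|u z.2| `^ p * eudist (sp z.1) (pt z.2) `^ (- Q))%:E)%E.
  by rewrite lee_fin mulr_ge0 ?powR_ge0.
rewrite (tonelli_on nu mD mE Doo mf f0).
have s0 : 0 < N - Q by rewrite subr_gt0.
have C0 : 0 <= near_const.
  have /andP[_ h] := powR2N_itv s0.
  by rewrite mulr_ge0 ?powR_ge0// divr_ge0 ?mulr_ge0 ?powR_ge0// subr_ge0 ltW.
rewrite -(ge0_integralZl_EFin nu mE _ _ C0); last 2 first.
- by move=> y _; rewrite lee_fin powR_ge0.
- by apply/measurable_EFinP; exact: (measurable_funTS mup).
have mw y : measurable_fun D (fun w => (eudist (sp w) (pt y) `^ (- Q))%:E).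
  apply/measurable_EFinP; exact: (measurableT_comp (measurable_powR _) (measurable_funTS (med y))).
apply: ge0_le_integral => [|y Ey|||y Ey].
- exact: mE.
- by apply: integral_ge0 => w _; rewrite lee_fin mulr_ge0 ?powR_ge0.
- pose nuR : {sigma_finite_measure set Y -> \bar R} := mfrestr mD Doo.
  have ms := measurable_section_integral_ge0 nuR mD (measurableT_comp mf (measurable_swap (T1 := X) (T2 := Y))) (fun z => f0 (z.2, z.1)).
  apply: measurable_funTS; move: ms; congr measurable_fun; apply/funext => y.
  apply: eq_measure_integral => B mB BD.
  by rewrite /= /mfrestr /mrestr setIidl.
- apply: (measurable_funeM near_const%:E); apply/measurable_EFinP; exact: (measurable_funTS mup).
have E1 : D `&` [set w | (0 < eudist (sp w) (pt y) < R2)%R] = D.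
  by apply/seteqP; split => [w []//|w Dw]; split => //=; exact: far.
have F := integral_powRN_near mD (measurable_funTS (med y)) A_ge0
  (fun r => @growth y r Ey) s0 _ R2_gt0.
rewrite E1 in F.
rewrite /=; under eq_integral do rewrite EFinM.
have mw0 w : D w -> (0 <= (eudist (sp w) (pt y) `^ (- Q))%:E)%E by rewrite lee_fin powR_ge0.
rewrite (ge0_integralZl_EFin lam mD mw0 (mw y)) ?powR_ge0//.
rewrite muleC lee_wpmul2r ?lee_fin ?powR_ge0//.
have E2 : N - (N - Q) = Q by ring.
rewrite E2 in F; apply: F.
by rewrite gerBl ltW.
Qed.

Variable theta : R.
Hypotheses (theta_gt0 : 0 < theta) (theta_ge : p + 2 * Q <= theta * p + Q + N).
Hypothesis u_diag : forall y z, E y -> E z -> eudist (pt y) (pt z) = 0 -> u y = u z.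

Let s := theta * p + Q.
Let e := s + N - (p + 2 * Q).
Let s_gt0 : 0 < s. Proof. by rewrite addr_gt0// mulr_gt0// (lt_trans ltr01). Qed.
Let e_ge0 : 0 <= e. Proof. by rewrite subr_ge0. Qed.

(** The power [R2^e] pays for raising the exponent from [p + 2 Q] to [N + s]; the factor 2 counts
    the tails about [y] and [z], and [2^s] comes from starting them at half the distance. *)
Definition far_const : R :=
  R2 `^ e * (2 * (A * 2 `^ N / (1 - 2 `^ (- s)) * 2 `^ s)).

Let far_const_ge0 : 0 <= far_const.
Proof.
have /andP[_ h] := powR2N_itv s_gt0.
rewrite /far_const mulr_ge0 ?powR_ge0// mulr_ge0// mulr_ge0 ?powR_ge0//.
by rewrite divr_ge0 ?mulr_ge0 ?powR_ge0// subr_ge0 ltW.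
Qed.

Let far_weight_le (a t : R) : 0 < a < R2 -> t <= a ->
  a `^ (- (p + 2 * Q)) <= R2 `^ e * a `^ (- (N + s)).
Proof.
move=> /andP[a0 aR] ta.
have -> : a `^ (- (p + 2 * Q)) = a `^ e * a `^ (- (N + s)).
  by rewrite -powRD ?(gt_eqF a0) ?implybT//; congr (_ `^ _); rewrite /e; ring.
rewrite ler_wpM2r ?powR_ge0//; apply: ge0_ler_powR => //; rewrite ?nnegrE ltW//.
Qed.

(** The farther of the two points is at least half their mutual distance from [w], so the symmetric
    weight is dominated by the sum of two far tails. *)
Lemma integral_pair_weight_le y z : E y -> E z -> 0 < eudist (pt y) (pt z) ->
  (\int[lam]_(w in D) (pair_weight pt Q p (sp w) y z)%:E <=
   (far_const * eudist (pt y) (pt z) `^ (- s))%:E)%E.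
Proof.
move=> Ey Ez yz; pose t := eudist (pt y) (pt z) / 2.
have t0 : 0 < t by rewrite divr_gt0.
pose a y w := eudist (sp w) (pt y).
pose S y := [set w | (t <= a y w)%R].
have mS y' : measurable (S y').
  rewrite /S (_ : [set w | _] = a y' @^-1` `[t, +oo[%classic).
    by rewrite -[X in measurable X]setTI; exact: (med y').
  by apply/seteqP; split => w /=; rewrite in_itv/= andbT.
pose g y w : \bar R := (a y w `^ (- (N + s)))%:E.
have mg y' : measurable_fun [set: Y] (g y').
  by apply/measurable_EFinP; exact: (measurableT_comp (measurable_powR _) (med y')).
have mgS y' : measurable_fun D (g y' \_ (S y')).
  apply: measurable_funTS; apply/(measurable_restrictT _ (mS y')); exact: (measurable_funTS (mg y')).
have gS0 y' w : (0 <= (g y' \_ (S y')) w)%E.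
  by rewrite patchE; case: ifP => _; rewrite lee_fin ?powR_ge0.
have Re0 : 0 <= R2 `^ e by exact: powR_ge0.
have I y' : E y' -> (\int[lam]_(w in D) (g y' \_ (S y')) w <=
    (A * 2 `^ N / (1 - 2 `^ (- s)) * t `^ (- s))%:E)%E.
  move=> Ey'; rewrite -integral_mkcondr.
  have N0 : 0 <= N by rewrite (le_trans (ltW Q_gt0)) ?ltW.
  exact: (integral_powRN_far mD (measurable_funTS (med y')) A_ge0 N0 (fun r => @growth y' r Ey') s_gt0 t0).
apply: (@le_trans _ _ (\int[lam]_(w in D)
    ((R2 `^ e)%:E * ((g y \_ (S y)) w + (g z \_ (S z)) w)))%E).
  apply: ge0_le_integral => [|w _|||w Dw].
  - exact: mD.
  - by rewrite lee_fin powR_ge0.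
  - apply: measurable_funTS; apply/measurable_EFinP; apply: (measurableT_comp (measurable_powR _)).
    exact: measurable_maxr.
  - by apply: measurable_funeM; exact: emeasurable_funD.
  - have H1 := far Dw Ey; have H2 := far Dw Ez.
    have tr : eudist (pt y) (pt z) <= a y w + a z w.
      by rewrite (le_trans (eudist_triangle (sp w) _ _))// eudistC.
    rewrite /pair_weight; have [ab|ba] := leP (eudist (sp w) (pt y)) (eudist (sp w) (pt z)).
      have tz : t <= a z w by rewrite /t ler_pdivrMr// (le_trans tr)// mulr_natr mulr2n lerD2r.
      have Fz : (g z \_ (S z)) w = g z w by rewrite patchE mem_set.
      rewrite Fz; apply: (@le_trans _ _ ((R2 `^ e)%:E * g z w)%E).
        by rewrite -EFinM lee_fin; exact: (far_weight_le H2 tz).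
      by apply: (lee_wpmul2l (x := (R2 `^ e)%:E)); [rewrite lee_fin|rewrite leeDr].
    have ty : t <= a y w by rewrite /t ler_pdivrMr// (le_trans tr)// mulr_natr mulr2n lerD2l ltW.
    have Fy : (g y \_ (S y)) w = g y w by rewrite patchE mem_set.
    rewrite Fy; apply: (@le_trans _ _ ((R2 `^ e)%:E * g y w)%E).
      by rewrite -EFinM lee_fin; exact: (far_weight_le H1 ty).
    by apply: (lee_wpmul2l (x := (R2 `^ e)%:E)); [rewrite lee_fin|rewrite leeDl].
rewrite (ge0_integralZl_EFin lam mD _ _ Re0); last 2 first.
- by move=> w _; exact: adde_ge0.
- exact: emeasurable_funD.
rewrite (ge0_integralD lam mD (fun w _ => gS0 y w) (mgS y) (fun w _ => gS0 z w) (mgS z)).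
have Re0' : (0 <= (R2 `^ e)%:E)%E by rewrite lee_fin.
apply: (le_trans (lee_wpmul2l Re0' (leeD (I y Ey) (I z Ez)))).
rewrite -EFinD -EFinM lee_fin /far_const -!mulrA; apply: (ler_wpM2l Re0).
have -> : t `^ (- s) = 2 `^ s * eudist (pt y) (pt z) `^ (- s).
  rewrite /t powRM ?eudist_ge0 ?invr_ge0// mulrC; congr (_ * _).
  by rewrite -powR_inv1// -powRrM mulrN mulN1r opprK.
by rewrite le_eqVlt; apply/orP; left; apply/eqP; ring.
Qed.

Lemma integral_pair_powR_weight_le :
  (\int[lam]_(w in D) \int[nu]_(y in E) \int[nu]_(z in E)
     (`|u y - u z| `^ p * pair_weight pt Q p (sp w) y z)%:E <=
   far_const%:E * \int[nu]_(y in E) \int[nu]_(z in E)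
     (`|u y - u z| `^ p * eudist (pt y) (pt z) `^ (- s))%:E)%E.
Proof.
have p0 : p != 0 by rewrite gt_eqF// (lt_trans ltr01).
have mu2 : measurable_fun [set: X * X] (fun w : X * X => `|u w.1 - u w.2| `^ p).
  apply: (measurableT_comp (measurable_powR _)); apply: measurableT_comp => //.
  apply: measurable_funB; first exact: (measurableT_comp mu measurable_fst).
  exact: (measurableT_comp mu measurable_snd).
pose f (v : (Y * X) * X) : \bar R :=
  (`|u v.1.2 - u v.2| `^ p * pair_weight pt Q p (sp v.1.1) v.1.2 v.2)%:E.
have f0 v : (0 <= f v)%E by rewrite lee_fin mulr_ge0 ?powR_ge0.
have mf : measurable_fun [set: (Y * X) * X] f.
  apply/measurable_EFinP; apply: measurable_funM.
    exact: (measurableT_comp mu2 (measurable_fun_pair (measurableT_comp measurable_snd measurable_fst) measurable_snd)).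
  apply: (measurableT_comp (measurable_powR _)); apply: measurable_maxr.
    exact: (measurableT_comp med2 measurable_fst).
  exact: (measurableT_comp med2 (measurable_fun_pair (measurableT_comp measurable_fst measurable_fst) measurable_snd)).
have mF := measurable_section_integral_ge0 nu mE mf f0.
have F0 (z : Y * X) : (0 <= \int[nu]_(x in E) f (z, x))%E by apply: integral_ge0.
rewrite (tonelli_on nu mD mE Doo mF F0).
have mS : measurable_fun [set: X * X]
    (fun z => (`|u z.1 - u z.2| `^ p * eudist (pt z.1) (pt z.2) `^ (- s))%:E).
  apply/measurable_EFinP; apply: (measurable_funM mu2); apply: (measurableT_comp (measurable_powR _)).
  exact: (measurable_eudist (measurable_coords_fst mpt) (measurable_coords_snd mpt)).
have S0 z : (0 <= (`|u z.1 - u z.2| `^ p * eudist (pt z.1) (pt z.2) `^ (- s))%:E)%E.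
  by rewrite lee_fin mulr_ge0 ?powR_ge0.
have mIS := measurable_section_integral_ge0 nu mE mS S0.
have IS0 y : (0 <= \int[nu]_(z in E) (`|u y - u z| `^ p * eudist (pt y) (pt z) `^ (- s))%:E)%E.
  by apply: integral_ge0 => z _; exact: (S0 (y, z)).
rewrite -(ge0_integralZl_EFin nu mE (fun y _ => IS0 y) (measurable_funTS mIS) far_const_ge0).
pose lamD : {sigma_finite_measure set Y -> \bar R} := mfrestr mD Doo.
have lamE h : (\int[lam]_(w in D) h w = \int[lamD]_(w in D) h w)%E.
  apply: eq_measure_integral => B mB BD.
  by rewrite /= /mfrestr /mrestr setIidl.
apply: ge0_le_integral => [|y Ey|||y Ey].
- exact: mE.
- by apply: integral_ge0 => w _; exact: F0.
- have ms := measurable_section_integral_ge0 lamD mD (measurableT_comp mF (measurable_swap (T1 := X) (T2 := Y))) (fun z => F0 (z.2, z.1)).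
  apply: measurable_funTS; move: ms; congr measurable_fun; apply/funext => y.
  by rewrite lamE.
- exact: (measurable_funeM _ (measurable_funTS mIS)).
have mfy : measurable_fun [set: Y * X] (fun v : Y * X => f ((v.1, y), v.2)).
  exact: (measurableT_comp mf (measurable_fun_pair (measurable_fun_pair measurable_fst (measurable_cst _)) measurable_snd)).
rewrite (tonelli_on nu mD mE Doo mfy (fun v => f0 _)).
have mISy := measurableT_comp mS (measurable_pair1 y).
rewrite -(ge0_integralZl_EFin nu mE (fun z _ => S0 (y, z)) (measurable_funTS mISy) far_const_ge0).
apply: ge0_le_integral => [|z Ez|||z Ez].
- exact: mE.
- by apply: integral_ge0 => w _; exact: f0.
- have ms := measurable_section_integral_ge0 lamD mD (measurableT_comp mfy (measurable_swap (T1 := X) (T2 := Y))) (fun z => f0 _).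
  apply: measurable_funTS; move: ms; congr measurable_fun; apply/funext => z.
  by rewrite lamE.
- exact: (measurable_funeM _ (measurable_funTS mISy)).
rewrite /f/=; under eq_integral do rewrite EFinM.
rewrite (ge0_integralZl_EFin lam mD) ?powR_ge0//; last 2 first.
- by move=> w _; rewrite lee_fin powR_ge0.
- apply: measurable_funTS; apply/measurable_EFinP; apply: (measurableT_comp (measurable_powR _)).
  exact: measurable_maxr.
have [yz0|yzN0] := eqVneq (eudist (pt y) (pt z)) 0.
  by rewrite (u_diag Ey Ez yz0) subrr normr0 powR0// !mul0e mul0r mule0.
have yz : 0 < eudist (pt y) (pt z) by rewrite lt_neqAle eq_sym yzN0 eudist_ge0.
have H := integral_pair_weight_le Ey Ez yz.
have u0 : (0 <= (`|u y - u z| `^ p)%:E)%E by rewrite lee_fin powR_ge0.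
apply: (le_trans (lee_wpmul2l u0 H)).
by rewrite -!EFinM lee_fin mulrCA.
Qed.

End weighted_integrals.

(** * Regularity at all scales *)

Section ahlfors_regular_compact.
Context {R : realType} {n : nat}.
Variables (Q : R) (E : set 'rV[R]_n).
Hypotheses (Q_gt0 : 0 < Q) (cE : compact E) (regE : ahlfors_regular Q E).
Hypotheses (diamE_gt0 : (0 < diam E)%E) (diamE_le1 : (diam E <= 1)%E).

Let dE : R := fine (diam E).

Let diamE : diam E = dE%:E.
Proof.
rewrite /dE fineK// ge0_fin_numE ?(ltW diamE_gt0)//.
exact: le_lt_trans diamE_le1 (ltry _).
Qed.

Let dE_gt0 : 0 < dE. Proof. by rewrite -lte_fin -diamE. Qed.

Lemma diam_eudist_le y z : E y -> E z -> eudist y z <= fine (diam E).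
Proof. by move=> Ey Ez; rewrite -/dE -lee_fin -diamE; apply: ereal_sup_ubound; exists y, z. Qed.

Lemma nonempty_of_diam : E !=set0.
Proof.
apply/set0P; apply: contraTN diamE_gt0 => /eqP ->; rewrite -leNgt.
by apply: ge_ereal_sup => a [y [z [/= []]]].
Qed.

(** The largest admissible radius is the diameter, and an open ball of that radius may miss points
    of [E] at exactly this distance; hence a finite subcover rather than a single ball. *)
Lemma hausdorff_compact_fin : (hausdorff Q E < +oo)%E.
Proof.
have [C C1 regC] := regE.
have cov : E `<=` cover E (fun y => eball y dE).
  by move=> y Ey; exists y => //=; rewrite /eball/= eudistxx.
move: (cE); rewrite compact_cover => /(_ _ _ _ (fun y _ => @eball_open R n y dE) cov) [F FE EF].
have fin (s : seq 'rV[R]_n) : (forall y, y \in s -> E y) ->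
    (hausdorff Q (E `&` [set z | exists2 y, y \in s & eball y dE z]) <= ((size s)%:R * (C * dE `^ Q))%:E)%E.
  elim: s => [_|y s ih sE].
    rewrite (_ : _ `&` _ = set0); first by rewrite outer_measure0 mul0r.
    by apply/seteqP; split => // z [_ []].
  have -> : E `&` [set z | exists2 y0, y0 \in y :: s & eball y0 dE z] =
      (E `&` eball y dE) `|` (E `&` [set z | exists2 y, y \in s & eball y dE z]).
    apply/seteqP; split => z.
      move=> [Ez [w]]; rewrite inE => /predU1P[->|ws] wz; [by left|right; split => //; by exists w].
    move=> [[Ez yz]|[Ez [w ws wz]]]; split => //; [exists y => //|exists w => //]; by rewrite inE ?eqxx ?ws ?orbT.
  apply: (le_trans (outer_measureU2 _ _ _)).
  have -> : (size (y :: s))%:R * (C * dE `^ Q) = C * dE `^ Q + (size s)%:R * (C * dE `^ Q).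
    by rewrite /= -natr1; ring.
  rewrite EFinD; apply: leeD.
    have Ey : E y by apply: sE; rewrite inE eqxx.
    have dd : (dE%:E <= diam E)%E by rewrite diamE.
    by have /andP[_] := regC _ _ Ey dE_gt0 dd.
  by apply: ih => z zs; apply: sE; rewrite inE zs orbT.
pose F' : seq 'rV[R]_n := finmap.enum_fset F.
have sub : E `<=` E `&` [set z | exists2 y, y \in F' & eball y dE z].
  by move=> t Et; split => //; have [v /= vF vt] := EF t Et; exists v.
have h y : y \in F' -> E y by move=> yF; have := FE y yF; rewrite inE.
by apply: (le_lt_trans (le_outer_measure _ _ _ sub)); apply: (le_lt_trans (fin _ h)); exact: ltry.
Qed.

(** Beyond the diameter the total mass is the bound, and [(t / dE)^Q >= 1] absorbs it into the
    constant. *)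
Lemma hausdorff_upper_regular : exists2 A : R, 0 <= A & forall y t, E y -> 0 < t ->
  (hausdorff Q (E `&` eball y t) <= (A * t `^ Q)%:E)%E.
Proof.
have [C C1 regC] := regE.
pose H := fine (hausdorff Q E).
have H0 : 0 <= H by apply: fine_ge0; exact: outer_measure_ge0.
have HE : hausdorff Q E = H%:E.
  by rewrite /H fineK// ge0_fin_numE ?hausdorff_compact_fin// outer_measure_ge0.
have C0 : 0 <= C by exact: le_trans C1.
exists (C + H * dE `^ (- Q)); first by rewrite addr_ge0 ?mulr_ge0 ?powR_ge0.
move=> y t Ey t0; have [tD|Dt] := leP t dE.
  have tD' : (t%:E <= diam E)%E by rewrite diamE lee_fin.
  have /andP[_ h] := regC y t Ey t0 tD'; apply: (le_trans h).
  by rewrite lee_fin ler_wpM2r ?powR_ge0// lerDl mulr_ge0 ?powR_ge0.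
apply: (@le_trans _ _ H%:E); first by rewrite -HE; apply: le_outer_measure; exact: subIsetl.
rewrite lee_fin; apply: (@le_trans _ _ (H * dE `^ (- Q) * t `^ Q)).
  rewrite -mulrA ler_peMr// powRN ler_pdivlMl ?powR_gt0// mulr1.
  by apply: ge0_ler_powR; rewrite ?nnegrE ?ltW.
by rewrite ler_wpM2r ?powR_ge0// lerDr.
Qed.

(** Radii between the diameter and [R1] use the ball of radius [dE], at the cost of the factor
    [(dE / R1)^Q]. *)
Lemma hausdorff_lower_regular (R1 : R) : fine (diam E) <= R1 ->
  exists2 c : R, 0 < c & forall y t, E y -> 0 < t <= R1 ->
    ((c * t `^ Q)%:E <= hausdorff Q (E `&` eball y t))%E.
Proof.
have [C C1 regC] := regE; move=> dR; have R0 : 0 < R1 by exact: lt_le_trans dR.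
have C0 : 0 < C by exact: lt_le_trans C1.
exists (C^-1 * (dE `^ Q * R1 `^ (- Q))).
  by rewrite mulr_gt0 ?invr_gt0// mulr_gt0 ?powR_gt0.
move=> y t Ey /andP[t0 tR]; have [tD|Dt] := leP t dE.
  have tD' : (t%:E <= diam E)%E by rewrite diamE lee_fin.
  have /andP[h _] := regC y t Ey t0 tD'; apply: le_trans h.
  rewrite lee_fin ler_wpM2r ?powR_ge0// ler_piMr ?invr_ge0 ?(ltW C0)//.
  rewrite powRN ler_pdivrMr ?powR_gt0// mul1r.
  by apply: ge0_ler_powR => //; rewrite ?nnegrE ltW.
have dd : (dE%:E <= diam E)%E by rewrite diamE.
have /andP[h _] := regC y dE Ey dE_gt0 dd.
apply: (@le_trans _ _ (hausdorff Q (E `&` eball y dE))); last first.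
  by apply: le_outer_measure => z [Ez yz]; split => //; exact: lt_trans Dt.
apply: le_trans h; rewrite lee_fin -mulrA ler_wpM2l ?invr_ge0 ?(ltW C0)//.
rewrite -mulrA ler_piMr ?powR_ge0// powRN ler_pdivrMl ?powR_gt0// mulr1.
by apply: ge0_ler_powR => //; rewrite ?nnegrE ltW.
Qed.

End ahlfors_regular_compact.

Section growth.
Context {R : realType} {n : nat}.
Local Notation leb := (lebesgue_measure_rV R n).
Local Notation T := (lebesgue_space R n).

Lemma lebesgue_open_measurable (U : set 'rV[R]_n) : open U -> measurable (U : set T).
Proof. exact: (open_measurable_cara (@lebesgue_coord_measurable R n)). Qed.

Lemma lebesgue_closed_measurable (U : set 'rV[R]_n) : closed U -> measurable (U : set T).
Proof. exact: (closed_measurable_cara (@lebesgue_coord_measurable R n)). Qed.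

Lemma eball_sub_cbox (x0 : 'rV[R]_n) (r : R) :
  eball x0 r `<=` cbox (x0 - const_mx r) (x0 + const_mx r).
Proof.
move=> x xr i; have := coord_le_eudist x x0 i; rewrite !mxE => h.
have {h} : `|x 0 i - x0 0 i| <= r by rewrite (le_trans h)// eudistC ltW.
by rewrite ler_norml => /andP[]; lra.
Qed.

Lemma density_null (mu : {measure set T -> \bar R}) w (A : set T) : has_density mu w ->
  leb A = 0%E -> measurable A -> mu A = 0%E.
Proof.
move=> [w0 [mw _] muE] A0 mA; rewrite (muE A mA).
apply: (null_set_integral mA _ A0); apply/measurable_EFinP; exact: (measurable_funTS mw).
Qed.

Section ball.
Variables (E : set 'rV[R]_n) (x0 : 'rV[R]_n) (r0 : R).
Hypothesis mE : measurable (E : set T).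
Let B := eball x0 r0.

Let mB : measurable (B : set T).
Proof. by apply: lebesgue_open_measurable; exact: eball_open. Qed.

Let mBE y (r : R) : measurable ((B `\` E) `&` [set w | (eudist w y < r)%R] : set T).
Proof.
apply: measurableI; first exact: measurableD.
rewrite (_ : [set w | _] = eball y r); first by apply: lebesgue_open_measurable; exact: eball_open.
by apply/seteqP; split => w; rewrite /eball/= eudistC.
Qed.

Lemma density_eball_fin (mu : {measure set T -> \bar R}) w : has_density mu w ->
  (mu B < +oo)%E.
Proof.
move=> [w0 [mw wK] muE].
pose K := cbox (x0 - const_mx r0) (x0 + const_mx r0).
have mK : measurable (K : set T) by apply: lebesgue_closed_measurable; exact: cbox_closed.
have cK : compact K by exact: cbox_compact.
have mKB : (mu B <= mu K)%E by apply: le_measure; rewrite ?inE//; exact: eball_sub_cbox.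
apply: (le_lt_trans mKB); rewrite (muE K mK); have := wK K cK (@subsetT _ K).
by congr (_ < _)%E; apply: eq_integral => x _; rewrite ger0_norm.
Qed.

Lemma lebesgue_eball_fin : (leb B < +oo)%E.
Proof.
have [r00|r0N] := leP 0 r0; first by rewrite (le_lt_trans (lebesgue_eball_le _ r00))// ltry.
rewrite (_ : B = set0) ?measure0//; apply/seteqP; split => // x /= xr.
by have := lt_trans (le_lt_trans (eudist_ge0 _ _) xr) r0N; rewrite ltxx.
Qed.

(** For radii above [r1] the finite mass of the ball [B] takes over. *)
Let growth_ext (lam : {measure set T -> \bar R}) (C N r1 : R) : 0 < N -> 0 < r1 -> 0 <= C ->
  (lam B < +oo)%E ->
  (forall y r, E y -> 0 < r <= r1 -> (lam (eball y r) <= (C * r `^ N)%:E)%E) ->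
  exists2 A : R, 0 <= A & forall y (r : R), E y -> 0 < r ->
    (lam ((B `\` E) `&` [set w | (eudist w y < r)%R]) <= (A * r `^ N)%:E)%E.
Proof.
move=> N0 r10 C0 Boo small; pose M := fine (lam B).
have M0 : 0 <= M by apply: fine_ge0; exact: measure_ge0.
have ME : lam B = M%:E by rewrite /M fineK// ge0_fin_numE// measure_ge0.
exists (C + M * r1 `^ (- N)); first by rewrite addr_ge0 ?mulr_ge0 ?powR_ge0.
move=> y r Ey rp.
have [rr|rr] := leP r r1.
  apply: (@le_trans _ _ (C * r `^ N)%:E); last first.
    by rewrite lee_fin ler_wpM2r ?powR_ge0// lerDl mulr_ge0 ?powR_ge0.
  have h : 0 < r <= r1 by rewrite rp rr.
  apply: le_trans (small y r Ey h); apply: le_measure.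
  - by rewrite inE; exact: mBE.
  - by rewrite inE; apply: lebesgue_open_measurable; exact: eball_open.
  - by move=> x [_ /= xy]; rewrite /eball/= eudistC.
apply: (@le_trans _ _ M%:E).
  rewrite -ME; apply: le_measure; last by move=> x [[]].
  - by rewrite inE; exact: mBE.
  - by rewrite inE; exact: mB.
rewrite lee_fin; apply: (@le_trans _ _ (M * r1 `^ (- N) * r `^ N)).
  rewrite -mulrA ler_peMr// powRN ler_pdivlMl ?powR_gt0// mulr1.
  by apply: ge0_ler_powR; rewrite ?nnegrE ?ltW.
by rewrite ler_wpM2r ?powR_ge0// lerDr.
Qed.

Lemma density_growth (mu : {measure set T -> \bar R}) w N : has_density mu w -> 0 < N ->
  ball_growth E mu N ->
  exists2 A : R, 0 <= A & forall y (r : R), E y -> 0 < r ->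
    (mu ((B `\` E) `&` [set w | (eudist w y < r)%R]) <= (A * r `^ N)%:E)%E.
Proof.
move=> dmu N0 [C C1 grow]; apply: (@growth_ext mu C N 10) => //.
- exact: le_trans C1.
- exact: density_eball_fin dmu.
- by move=> y r Ey r10; have /andP[] := grow y r Ey r10.
Qed.

(** For [r <= 1] one has [r^n <= r^N] because [N <= n]; with [N = n + alpha] this is where the sign
    of [alpha] enters. *)
Lemma lebesgue_growth N : 0 < N -> N <= n%:R ->
  exists2 A : R, 0 <= A & forall y (r : R), E y -> 0 < r ->
    (leb ((B `\` E) `&` [set w | (eudist w y < r)%R]) <= (A * r `^ N)%:E)%E.
Proof.
move=> N0 Nn; apply: (@growth_ext leb (2 ^+ n) N 1) => //; first exact: lebesgue_eball_fin.
move=> y r _ /andP[rp r1]; apply: (le_trans (lebesgue_eball_le _ (ltW rp))).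
rewrite lee_fin exprMn ler_wpM2l ?exprn_ge0// -powR_mulrn ?(ltW rp)//.
rewrite -(subrK N n%:R) powRD; last by rewrite (gt_eqF rp) implybT.
have h : r `^ (n%:R - N) <= 1 `^ (n%:R - N).
  by apply: ge0_ler_powR; rewrite ?nnegrE ?subr_ge0 ?(ltW rp).
by rewrite powR1 in h; rewrite ler_piMl ?powR_ge0.
Qed.

End ball.

End growth.

(** * Norms in [L^p] as integrals of powers *)

Section Lp.
Context d {T : measurableType d} {R : realType}.
Implicit Types (mu : {measure set T -> \bar R}) (p : R) (D : set T) (f : T -> R).

Lemma ae_imply mu (P P' : T -> Prop) : (forall x, P x -> P' x) ->
  {ae mu, forall x, P x} -> {ae mu, forall x, P' x}.
Proof. by move=> PP'; apply: filterS. Qed.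

(* No measurability is needed, since the integral of a nonnegative function is
   a supremum over the simple functions below it. *)
Lemma ge0_le_integral_sup mu D (f g : T -> \bar R) :
  (forall x, D x -> 0 <= f x)%E -> (forall x, D x -> f x <= g x)%E ->
  (\int[mu]_(x in D) f x <= \int[mu]_(x in D) g x)%E.
Proof.
move=> f0 fg; have g0 x : D x -> (0 <= g x)%E by move=> Dx; apply: le_trans (fg x Dx); exact: f0.
rewrite !ge0_integralE//; apply: le_ereal_sup => _ [h hf <-]; exists h => // x.
by apply: (le_trans (hf x)); rewrite !patchE; case: ifPn => //; rewrite inE; exact: fg.
Qed.

Lemma Lp_normE mu p D f : 0 < p ->
  Lp_norm mu p D f = ((\int[mu]_(x in D) (`|f x| `^ p)%:E) `^ p^-1)%E.
Proof.
move=> p0; rewrite /Lp_norm unlock; apply: (congr1 (fun z => poweR z p^-1)).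
rewrite [RHS]integral_mkcond; apply: eq_integral => x _ /=.
rewrite !patchE; case: ifPn => // _.
by rewrite normr0 powR0// gt_eqF.
Qed.

Lemma Lp_onP mu p D f : 0 < p -> measurable D -> Lp_on mu p D f <->
  measurable_fun D f /\ (\int[mu]_(x in D) (`|f x| `^ p)%:E < +oo)%E.
Proof.
move=> p0 mD; have pV : 0 < p^-1 by rewrite invr_gt0.
have fin : finite_norm mu p%:E (f \_ D) <-> (\int[mu]_(x in D) (`|f x| `^ p)%:E < +oo)%E.
  rewrite /finite_norm -/(Lp_norm mu p D f) Lp_normE//; split; last exact: poweR_lty.
  by apply: lty_poweRy; rewrite gt_eqF.
have mfD : measurable_fun D f <-> measurable_fun [set: T] (f \_ D) by exact: measurable_restrictT.
split=> [/andP[]|[mf foo]].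
  rewrite inE => /= mf /set_mem/= foo; split; first exact/mfD.
  exact/fin.
apply/andP; split; first by rewrite inE; apply/mfD.
by rewrite inE /=; apply/fin.
Qed.

(** On sets of finite measure this turns [L^p] bounds into [L^1] bounds and majorants, replacing
    Hölder's inequality. *)
Lemma norm_le_1powR (a p : R) : 1 < p -> 0 <= a -> a <= 1 + a `^ p.
Proof.
move=> p1 a0; have [a1|a1] := leP a 1; first by rewrite (le_trans a1)// lerDl powR_ge0.
rewrite (@le_trans _ _ (a `^ p))// ?lerDr//.
by rewrite -{1}(powRr1 a0) ler_powR ?ltW.
Qed.

Lemma integral_norm_lty mu p D f : 1 < p -> measurable D -> (mu D < +oo)%E ->
  measurable_fun D f -> (\int[mu]_(x in D) (`|f x| `^ p)%:E < +oo)%E ->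
  (\int[mu]_(x in D) `|f x|%:E < +oo)%E.
Proof.
move=> p1 mD Doo mf foo.
have mfp : measurable_fun D (fun x => (`|f x| `^ p)%:E).
  by apply/measurable_EFinP; apply: (measurableT_comp (measurable_powR _)); exact: measurableT_comp.
apply: (@le_lt_trans _ _ (\int[mu]_(x in D) (1 + (`|f x| `^ p)%:E))%E).
  apply: ge0_le_integral_sup => x _; first by rewrite lee_fin.
  by rewrite -EFinD lee_fin norm_le_1powR.
rewrite ge0_integralD//; first by rewrite integral_cst// mul1e lte_add_pinfty.
Qed.

Lemma Lp_norm_ae_eq mu p D f g : 0 < p -> measurable D ->
  measurable_fun D f -> measurable_fun D g ->
  {ae mu, forall x, D x -> f x = g x} -> Lp_norm mu p D f = Lp_norm mu p D g.
Proof.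
move=> p0 mD mf mg fg; rewrite (Lp_normE _ _ f p0) (Lp_normE _ _ g p0); apply: (congr1 (fun z => poweR z p^-1)).
have mp (h : T -> R) : measurable_fun D h -> measurable_fun D (fun x => (`|h x| `^ p)%:E).
  move=> mh; apply/measurable_EFinP; apply: (measurableT_comp (measurable_powR _)).
  exact: (measurableT_comp (@normr_measurable R setT) mh).
apply: ae_eq_integral; [exact: mD|exact: mp|exact: mp|].
by apply: ae_imply fg => x h Dx; rewrite h.
Qed.

End Lp.

Section weak_gradient_unique.
Context {R : realType} {n : nat}.
Local Notation leb := (lebesgue_measure_rV R n).
Local Notation T := (lebesgue_space R n).

Lemma test_function_mul_integrable (U : set 'rV[R]_n) g phi :
  open U -> loc_integrable U g -> test_function U phi ->
  leb.-integrable (U : set T) (EFin \o (fun x : T => g x * phi x)).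
Proof.
move=> oU [mg gK] [cphi [K [cK KU phi0]]].
have mU : measurable (U : set T) := lebesgue_open_measurable oU.
have mK : measurable (K : set T).
  by apply: lebesgue_closed_measurable; apply: compact_closed => //; exact: norm_hausdorff.
have [phic _] := cphi 0%N.
have mphi : measurable_fun [set: T] (phi : T -> R).
  exact: (continuous_measurable_cara (@lebesgue_coord_measurable R n) phic).
have [C C0 phiC] := compactly_supported_bounded phic cK phi0.
have mgK : measurable_fun (K : set T) g by apply: measurable_funS mg.
have igK : leb.-integrable (K : set T) (EFin \o g).
  by apply/integrableP; split; [exact/measurable_EFinP|exact: gK].
have iK := integrable_mul_bounded mK igK (measurable_funTS mphi) (fun x _ => phiC x).
have E : (EFin \o (fun x => g x * phi x)) \_ U = (EFin \o (fun x => g x * phi x)) \_ K.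
  apply/funext => x; rewrite !patchE; case: ifPn => xU; case: ifPn => xK //.
    by rewrite /= phi0 ?mulr0//; move: xK; rewrite notin_setE.
  by move: xU; rewrite notin_setE => -[]; apply: KU; rewrite -inE.
apply/(integrable_mkcond _ mU); rewrite E.
by apply/(integrable_mkcond _ mK).
Qed.

(** Coordinate differences of two weak gradients annihilate all test functions, so the fundamental
    lemma applies to each. *)
Lemma weak_gradient_unique (U : set 'rV[R]_n) f g1 g2 : open U ->
  is_weak_gradient U f g1 -> is_weak_gradient U f g2 ->
  {ae leb, forall x, U x -> g1 x = g2 x}.
Proof.
move=> oU [_ w1] [_ w2]; have mU : measurable (U : set T) := lebesgue_open_measurable oU.
have coord i : {ae leb, forall x, U x -> g1 x 0 i - g2 x 0 i = 0}.
  have [l1 e1] := w1 i; have [l2 e2] := w2 i.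
  apply: (@fundamental_lemma_calculus_of_variations _ _ U (fun x => g1 x 0 i - g2 x 0 i) oU).
    have [m1 K1] := l1; have [m2 K2] := l2; split; first exact: measurable_funB.
    move=> K cK KU.
    have mK : measurable (K : set T).
      by apply: lebesgue_closed_measurable; apply: compact_closed => //; exact: norm_hausdorff.
    apply: (@le_lt_trans _ _ (\int[leb]_(x in K) (`|g1 x 0%R i|%:E + `|g2 x 0%R i|%:E))%E).
      apply: ge0_le_integral_sup => x _; first by rewrite lee_fin.
      by rewrite -EFinD lee_fin ler_normB.
    rewrite (ge0_integralD leb mK); last 4 first.
    - by move=> x _; rewrite lee_fin.
    - by apply/measurable_EFinP; exact: (measurableT_comp (@normr_measurable R setT) (measurable_funS mU KU m1)).
    - by move=> x _; rewrite lee_fin.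
    - by apply/measurable_EFinP; exact: (measurableT_comp (@normr_measurable R setT) (measurable_funS mU KU m2)).
    by apply: lte_add_pinfty; [exact: K1|exact: K2].
  move=> phi tphi.
  have i1 := test_function_mul_integrable oU l1 tphi.
  have i2 := test_function_mul_integrable oU l2 tphi.
  under eq_integral do rewrite mulrBl EFinB.
  rewrite (integralB mU i1 i2).
  have := e1 phi tphi; rewrite (e2 phi tphi) => /oppe_inj ->.
  by rewrite subee//; exact: (integrable_fin_num mU i1).
(* The coordinates are quantified through [nat], so that a countable union of null sets applies;
   indices from [n] on are vacuous. *)
have all_coord : {ae leb, forall x, forall k : nat, forall i : 'I_n, val i = k ->
    U x -> g1 x 0 i - g2 x 0 i = 0}.
  apply: ae_foralln => k; have [kn|nk] := ltnP k n.
    apply: ae_imply (coord (Ordinal kn)) => x h i ik Ux.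
    have -> : i = Ordinal kn by exact: val_inj.
    exact: h.
  by apply: aeW => x i ik; have := ltn_ord i; rewrite -[X in (X < _)%N]/(val i) ik ltnNge nk.
apply: ae_imply all_coord => x h Ux; apply/rowP => i.
by apply/eqP; rewrite -subr_eq0; apply/eqP; exact: (h (val i) i erefl Ux).
Qed.

End weak_gradient_unique.

(** * Limit of the regularized averages *)

Section kernel_extension.
Context d (X : measurableType d) (R : realType) (n : nat).
Variables (nu : {finite_measure set X -> \bar R}) (F : set X) (pt : X -> 'rV[R]_n).
Variables (m : nat) (Q c p : R) (E : set 'rV[R]_n) (x0 : 'rV[R]_n) (r0 : R).
Local Notation leb := (lebesgue_measure_rV R n).
Local Notation T := (lebesgue_space R n).
Let B := eball x0 r0.
(** Points of [B] and [E] are less than [2 * r0] apart and [eps] is at most 1, so [R1] bounds every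
    [rho] that occurs. *)
Let R1 := 2 * r0 + 1.
Hypotheses (mF : measurable F) (mpt : measurable_coords [set: X] pt).
Hypotheses (c_gt0 : 0 < c) (p_gt1 : 1 < p) (Q_gt0 : 0 < Q) (r0_gt0 : 0 < r0).
Hypothesis m_large : 2 * Q + p <= m.*2%:R.
Hypothesis lower_regular : forall y r, F y -> 0 < r <= R1 ->
  ((c * r `^ Q)%:E <= nu (F `&` [set z | (eudist (pt y) (pt z) < r)%R]))%E.
Hypotheses (cE : closed E) (FE : forall y, F y -> E (pt y)) (F0 : F !=set0).
Hypothesis E_half : E `<=` eball x0 (2^-1 * r0).

Let ball_dist w y : B w -> F y -> eudist w (pt y) < 2 * r0.
Proof.
move=> Bw Fy; have h1 : eudist x0 (pt y) < 2^-1 * r0 := E_half (FE Fy).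
have h2 : eudist x0 w < r0 := Bw.
apply: (le_lt_trans (eudist_triangle x0 _ _)); rewrite eudistC.
have h3 : 2^-1 * r0 < r0 by rewrite gtr_pMl// invf_lt1// ltr1n.
by rewrite mulr_natl mulr2n ltrD// (lt_trans h1).
Qed.

Let far w y : (B `\` E) w -> F y -> 0 < eudist w (pt y) < 2 * r0.
Proof.
move=> [Bw nEw] Fy; apply/andP; split.
  by rewrite lt_neqAle eudist_ge0 andbT eq_sym; apply/eqP => /eudist_eq0 wy; apply: nEw; rewrite wy; exact: FE.
exact: ball_dist.
Qed.

Let rho_le_R1 eps w y : 0 <= eps <= 1 -> B w -> F y -> rho eps w (pt y) <= R1.
Proof.
move=> /andP[e0 e1] Bw Fy; apply: (le_trans (rho_le w (pt y) e0)).
by apply: lerD => //; rewrite ltW// ball_dist.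
Qed.

Lemma off_closed_dist w : ~ E w -> exists2 delta, 0 < delta & forall y, F y -> delta <= eudist w (pt y).
Proof.
move=> nEw; have oE : open (~` E) by rewrite openC.
have [r rp rE] := (open_eballP (~` E)).1 oE w nEw.
exists r => // y Fy; rewrite leNgt; apply/negP => h.
by have := rE (pt y) h; apply; exact: FE.
Qed.

Variable u : X -> R.
Hypotheses (mu_ : measurable_fun [set: X] u) (iu : nu.-integrable F (EFin \o u)).

Local Notation avg eps := (kavg nu F pt m eps u).
Local Notation davg eps h := (dkavg nu F pt m eps h u).

(** Up to constants, this and [pair_potential] are the [eps]-free majorants of the averages and of
    their derivatives, to the power [p]. Integrated for Lebesgue measure they justify dominated
    convergence. *)
Definition near_potential (w : 'rV[R]_n) : \bar R :=
  (\int[nu]_(y in F) (`|u y| `^ p * eudist w (pt y) `^ (- Q))%:E)%E.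
Definition pair_potential (w : 'rV[R]_n) : \bar R :=
  (\int[nu]_(y in F) \int[nu]_(z in F) (`|u y - u z| `^ p * pair_weight pt Q p w y z)%:E)%E.

Let rho_itv eps w : 0 <= eps <= 1 -> (B `\` E) w ->
  exists2 delta, 0 < delta & forall y, F y -> delta <= rho eps w (pt y) <= R1.
Proof.
move=> e01 [Bw nEw]; have [delta d0 dle] := off_closed_dist nEw.
exists delta => // y Fy; rewrite rho_le_R1// andbT (le_trans (dle y Fy))//.
exact: eudist_le_rho.
Qed.

Lemma avg_powR_le eps w : 0 <= eps <= 1 -> (B `\` E) w ->
  ((`|avg eps w| `^ p)%:E <= (kconst m c)%:E * near_potential w)%E.
Proof.
move=> e01 Dw; have [delta d0 dle] := rho_itv e01 Dw.
have x_far y : F y -> 0 < eudist w (pt y) by move=> Fy; have /andP[] := far Dw Fy.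
exact: (kavg_powR_le m mF mpt c_gt0 p_gt1 Q_gt0 lower_regular d0 F0 dle mu_ iu x_far).
Qed.

Lemma davg_powR_le eps h w : 0 <= eps <= 1 -> (B `\` E) w ->
  ((`|davg eps h w| `^ p)%:E <=
    ((m.*2%:R * eunorm h) `^ p * kconst m c ^+ 2)%:E * pair_potential w)%E.
Proof.
move=> e01 Dw; have [delta d0 dle] := rho_itv e01 Dw.
have x_far y : F y -> 0 < eudist w (pt y) by move=> Fy; have /andP[] := far Dw Fy.
exact: (dkavg_powR_le mF mpt c_gt0 p_gt1 Q_gt0 m_large lower_regular d0 F0 dle mu_ iu x_far).
Qed.

Let mass0 w : (B `\` E) w -> kmass nu F pt m 0 w != 0.
Proof.
move=> Dw; have e01 : 0 <= (0 : R) <= 1 by rewrite lexx ler01.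
have [delta d0 dle] := rho_itv e01 Dw.
by rewrite gt_eqF//; exact: (kernel_mass_gt0 m mF mpt c_gt0 lower_regular d0 F0 dle).
Qed.

Let e_ j : R := j.+1%:R^-1.

Let e_cvg : e_ j @[j --> \oo] --> 0. Proof. exact: cvg_harmonic. Qed.

Let e_01 j : 0 <= e_ j <= 1.
Proof. by rewrite /e_ invr_ge0 ler0n/= invf_le1// ler1n. Qed.

Let e_gt0 j : 0 < e_ j. Proof. by rewrite invr_gt0. Qed.

Lemma avg_cvg w : (B `\` E) w -> avg (e_ j) w @[j --> \oo] --> avg 0 w.
Proof.
move=> Dw; have [delta d0 dle] := off_closed_dist Dw.2.
exact: (kavg_cvg mF mpt iu d0 dle e_cvg (mass0 Dw)).
Qed.

Lemma davg_cvg h w : (B `\` E) w -> davg (e_ j) h w @[j --> \oo] --> davg 0 h w.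
Proof.
move=> Dw; have [delta d0 dle] := off_closed_dist Dw.2.
exact: (dkavg_cvg mF mpt iu d0 dle e_cvg (mass0 Dw)).
Qed.

Let msp : measurable_coords [set: T] (fun w : T => (w : 'rV[R]_n)).
Proof. by move=> i; exact: (measurable_coord (@lebesgue_coord_measurable R n)). Qed.

Lemma measurable_avg eps : measurable_fun [set: T] (avg eps : T -> R).
Proof. exact: (measurable_kavg nu m eps mF mpt msp mu_). Qed.

Lemma measurable_davg eps h : measurable_fun [set: T] (davg eps h : T -> R).
Proof. exact: (measurable_dkavg nu m eps mF mpt msp mu_). Qed.

Let mX : measurable_fun [set: X] (fun y => `|u y| `^ p).
Proof.
apply: (measurableT_comp (measurable_powR _)).
exact: (measurableT_comp (@normr_measurable R setT) mu_).
Qed.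

Let med : measurable_fun [set: T * X] (fun z => eudist (z.1 : 'rV[R]_n) (pt z.2)).
Proof. exact: (measurable_eudist (measurable_coords_fst msp) (measurable_coords_snd mpt)). Qed.

Lemma measurable_near_potential : measurable_fun [set: T] (near_potential : T -> \bar R).
Proof.
pose f (z : T * X) := (`|u z.2| `^ p * eudist (z.1 : 'rV[R]_n) (pt z.2) `^ (- Q))%:E.
have mf : measurable_fun [set: T * X] f.
  apply/measurable_EFinP; apply: (measurable_funM (measurableT_comp mX measurable_snd)).
  exact: (measurableT_comp (measurable_powR _) med).
apply: (measurable_section_integral_ge0 nu mF mf).
by move=> z; rewrite lee_fin mulr_ge0 ?powR_ge0.
Qed.

Lemma measurable_pair_potential : measurable_fun [set: T] (pair_potential : T -> \bar R).
Proof.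
have mu2 : measurable_fun [set: X * X] (fun w : X * X => `|u w.1 - u w.2| `^ p).
  apply: (measurableT_comp (measurable_powR _)); apply: (measurableT_comp (@normr_measurable R setT)).
  apply: measurable_funB; first exact: (measurableT_comp mu_ measurable_fst).
  exact: (measurableT_comp mu_ measurable_snd).
pose f (v : (T * X) * X) : \bar R :=
  (`|u v.1.2 - u v.2| `^ p * pair_weight pt Q p v.1.1 v.1.2 v.2)%:E.
have f0 v : (0 <= f v)%E by rewrite lee_fin mulr_ge0 ?powR_ge0.
have mf : measurable_fun [set: (T * X) * X] f.
  apply/measurable_EFinP; apply: measurable_funM.
    exact: (measurableT_comp mu2 (measurable_fun_pair (measurableT_comp measurable_snd measurable_fst) measurable_snd)).
  apply: (measurableT_comp (measurable_powR _)); apply: measurable_maxr.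
    exact: (measurableT_comp med measurable_fst).
  exact: (measurableT_comp med (measurable_fun_pair (measurableT_comp measurable_fst measurable_fst) measurable_snd)).
have mG := measurable_section_integral_ge0 nu mF mf f0.
apply: (measurable_section_integral_ge0 nu mF mG).
by move=> z; apply: integral_ge0 => y _; exact: f0.
Qed.

Let M_ge0 w : (0 <= near_potential w)%E.
Proof. by apply: integral_ge0 => y _; rewrite lee_fin mulr_ge0 ?powR_ge0. Qed.

Let W_ge0 w : (0 <= pair_potential w)%E.
Proof. by do 2 (apply: integral_ge0 => ? _); rewrite lee_fin mulr_ge0 ?powR_ge0. Qed.

Section weighted.
Variables (lam : {measure set T -> \bar R}) (A N : R).
Hypotheses (mE : measurable (E : set T)) (Boo : (lam B < +oo)%E) (A_ge0 : 0 <= A) (QN : Q < N).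
Hypothesis growth : forall y (r : R), E y -> 0 < r ->
  (lam ((B `\` E) `&` [set w | (eudist w y < r)%R]) <= (A * r `^ N)%:E)%E.

Let mB : measurable (B : set T).
Proof. by apply: lebesgue_open_measurable; exact: eball_open. Qed.

Let mD : measurable (B `\` E : set T). Proof. exact: measurableD. Qed.

Let Doo : (lam (B `\` E) < +oo)%E.
Proof.
apply: le_lt_trans Boo; apply: le_measure; last by move=> x [].
- by rewrite inE; exact: mD.
- by rewrite inE; exact: mB.
Qed.

Let growth' y (r : R) (Fy : F y) (rp : 0 < r) := growth (FE Fy) rp.
Let r20 : 0 < 2 * r0. Proof. by rewrite mulr_gt0. Qed.

Lemma integral_near_potential_le : (\int[lam]_(w in B `\` E) near_potential w <=
  (near_const A N Q (2 * r0))%:E * \int[nu]_(y in F) (`|u y| `^ p)%:E)%E.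
Proof.
exact: (integral_powR_weight_le nu p mD mF Doo msp mpt mu_ A_ge0 Q_gt0 QN growth' r20 far).
Qed.

Variable theta : R.
Hypotheses (theta_gt0 : 0 < theta) (theta_ge : p + 2 * Q <= theta * p + Q + N).
Hypothesis u_diag : forall y z, F y -> F z -> eudist (pt y) (pt z) = 0 -> u y = u z.

Lemma integral_pair_potential_le : (\int[lam]_(w in B `\` E) pair_potential w <=
  (far_const A N Q p (2 * r0) theta)%:E * \int[nu]_(y in F) \int[nu]_(z in F)
     (`|u y - u z| `^ p * eudist (pt y) (pt z) `^ (- (theta * p + Q)))%:E)%E.
Proof.
exact: (integral_pair_powR_weight_le nu mD mF Doo msp mpt mu_ A_ge0 Q_gt0 QN p_gt1 growth' r20 far
  theta_gt0 theta_ge u_diag).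
Qed.

End weighted.

Section extension_gradient.
Hypothesis E_null : leb E = 0%E.
Hypotheses (M_fin : (\int[leb]_(w in B `\` E) near_potential w < +oo)%E).
Hypotheses (W_fin : (\int[leb]_(w in B `\` E) pair_potential w < +oo)%E).
Hypothesis nuF_gt0 : (0 < nu F)%E.

Let oB : open B. Proof. exact: eball_open. Qed.
Let mB : measurable (B : set T). Proof. exact: lebesgue_open_measurable. Qed.
Let mE : measurable (E : set T). Proof. exact: lebesgue_closed_measurable. Qed.
Let mD : measurable (B `\` E : set T). Proof. exact: measurableD. Qed.

Let Boo : (leb B < +oo)%E. Proof. exact: lebesgue_eball_fin. Qed.
Let Doo : (leb (B `\` E) < +oo)%E.
Proof.
apply: le_lt_trans Boo; apply: le_measure; last by move=> x [].
- by rewrite inE; exact: mD.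
- by rewrite inE; exact: mB.
Qed.

Let notE (P : T -> Prop) : (forall w, ~ E w -> P w) -> {ae leb, forall w, P w}.
Proof.
move=> nEP; exists (E : set T); split; [exact: mE|exact: E_null|].
by move=> w /= nP; apply: contrapT => /nEP.
Qed.

Let null_integral (f : T -> \bar R) : measurable_fun (B : set T) f -> (forall w, 0 <= f w)%E ->
  (\int[leb]_(w in B) f w = \int[leb]_(w in B `\` E) f w)%E.
Proof. by move=> mf f0; apply: (ge0_negligible_integral mE mB mf _ E_null) => w _; exact: f0. Qed.

(** Since [E] is null, convergence and domination need checking only off [E], where the majorant is
    available. *)
Let weak_cvg (f_ : nat -> T -> R) (f psi : T -> R) (G : T -> \bar R) (C : R) :
  (forall j, measurable_fun [set: T] (f_ j)) -> measurable_fun (B : set T) f ->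
  measurable_fun [set: T] psi -> 0 <= C -> (forall w, `|psi w| <= C) ->
  measurable_fun [set: T] G -> (forall w, 0 <= G w)%E ->
  (\int[leb]_(w in B `\` E) G w < +oo)%E ->
  (forall w, (B `\` E) w -> f_ j w @[j --> \oo] --> f w) ->
  (forall j w, (B `\` E) w -> `|f_ j w|%:E <= G w)%E ->
  (\int[leb]_(w in B) (f_ j w * psi w)%:E @[j --> \oo] -->
   \int[leb]_(w in B) (f w * psi w)%:E)%E.
Proof.
move=> mf_ mf mpsi C0 psiC mG G0 Goo f_f fG.
have m1 j : measurable_fun (B : set T) (fun w => (f_ j w * psi w)%:E).
  by apply/measurable_EFinP; apply: measurable_funTS; exact: (measurable_funM (mf_ j) mpsi).
have m2 : measurable_fun (B : set T) (fun w => (f w * psi w)%:E).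
  by apply/measurable_EFinP; exact: (measurable_funM mf (measurable_funTS mpsi)).
have mCG : measurable_fun (B : set T) (fun w => C%:E * G w)%E.
  by apply: measurable_funeM; exact: (measurable_funTS mG).
have iG : leb.-integrable (B : set T) (fun w => C%:E * G w)%E.
  apply/integrableP; split; first exact: mCG.
  under eq_integral => w _ do rewrite gee0_abs ?mule_ge0 ?lee_fin//.
  rewrite (ge0_integralZl_EFin leb mB (fun w _ => G0 w) (measurable_funTS mG) C0).
  by rewrite (null_integral (measurable_funTS mG) G0) lte_mul_pinfty.
have c1 : {ae leb, forall w, (B : set T) w ->
    (f_ j w * psi w)%:E @[j --> \oo] --> (f w * psi w)%:E}.
  apply: notE => w nEw Bw; apply: cvg_EFin; first exact: nearW.
  by apply: cvgM; [apply: f_f|exact: cvg_cst].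
have c2 : {ae leb, forall w j, (B : set T) w -> (`|(f_ j w * psi w)%:E| <= C%:E * G w)%E}.
  apply: notE => w nEw j Bw; rewrite /= normrM mulrC EFinM.
  by apply: lee_pmul; rewrite ?lee_fin//; exact: fG.
by have [_ _] := dominated_convergence mB m1 m2 c1 iG c2.
Qed.

(** The values on [E] are arbitrary, but the part of a preimage inside [E] is a null set, and these
    are Caratheodory measurable. *)
Lemma measurable_off_null (v v' : T -> R) : measurable_fun [set: T] v' ->
  (forall w, ~ E w -> v w = v' w) -> measurable_fun (B : set T) v.
Proof.
move=> mv' vv' _ Y mY.
have -> : (B : set T) `&` v @^-1` Y = ((B `\` E) `&` v' @^-1` Y) `|` ((B `&` E) `&` v @^-1` Y).
  apply/seteqP; split => w.
    move=> [Bw Yw]; have [Ew|nEw] := pselect (E w); first by right.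
    by left; split => //=; rewrite -vv'.
  by move=> [[[Bw nEw] Yw]|[[Bw Ew] Yw]]; split => //=; rewrite vv'.
apply: measurableU; first by have := mv' measurableT Y mY; rewrite setTI => H; exact: (measurableI _ _ mD H).
apply: lebesgue_null_measurable; apply/eqP; rewrite eq_le outer_measure_ge0 andbT -E_null.
by apply: le_outer_measure => w [[]].
Qed.

Lemma integral_avg_powR_le (lam : {measure set T -> \bar R}) eps : 0 <= eps <= 1 ->
  (\int[lam]_(w in B `\` E) (`|avg eps w| `^ p)%:E <=
   (kconst m c)%:E * \int[lam]_(w in B `\` E) near_potential w)%E.
Proof.
move=> e01; rewrite -(ge0_integralZl_EFin lam mD (fun w _ => M_ge0 w) (measurable_funTS measurable_near_potential)); last first.
  by rewrite ltW// kconst_gt0.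
apply: ge0_le_integral_sup => w Dw; first by rewrite lee_fin powR_ge0.
exact: avg_powR_le.
Qed.

Lemma integral_davg_powR_le (lam : {measure set T -> \bar R}) eps h : 0 <= eps <= 1 ->
  (\int[lam]_(w in B `\` E) (`|davg eps h w| `^ p)%:E <=
   ((m.*2%:R * eunorm h) `^ p * kconst m c ^+ 2)%:E * \int[lam]_(w in B `\` E) pair_potential w)%E.
Proof.
move=> e01; rewrite -(ge0_integralZl_EFin lam mD (fun w _ => W_ge0 w) (measurable_funTS measurable_pair_potential)); last first.
  by rewrite mulr_ge0 ?powR_ge0// exprn_ge0// ltW// kconst_gt0.
apply: ge0_le_integral_sup => w Dw; first by rewrite lee_fin powR_ge0.
exact: davg_powR_le.
Qed.

Let e01 : 0 <= (0 : R) <= 1. Proof. by rewrite lexx ler01. Qed.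

Let loc_integrable_off (v v' : T -> R) : measurable_fun [set: T] v' ->
  (forall w, ~ E w -> v w = v' w) ->
  (\int[leb]_(w in B `\` E) (`|v' w| `^ p)%:E < +oo)%E -> loc_integrable B v.
Proof.
move=> mv' vv' v'oo; have mv := measurable_off_null mv' vv'; split; first exact: mv.
move=> K cK KB; have mK : measurable (K : set T).
  by apply: lebesgue_closed_measurable; apply: compact_closed => //; exact: norm_hausdorff.
have mav : measurable_fun (B : set T) (fun w => `|v w|%:E).
  by apply/measurable_EFinP; exact: (measurableT_comp (@normr_measurable R setT) mv).
apply: (@le_lt_trans _ _ (\int[leb]_(w in B) `|v w|%:E)%E).
  apply: (ge0_subset_integral leb mK mB mav _ KB) => w _.
  by rewrite lee_fin.
rewrite null_integral//.
have -> : (\int[leb]_(w in B `\` E) `|v w|%:E = \int[leb]_(w in B `\` E) `|v' w|%:E)%E.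
  by apply: eq_integral => w; rewrite inE => -[_ nEw]; rewrite vv'.
exact: (integral_norm_lty p_gt1 mD Doo (measurable_funTS mv') v'oo).
Qed.

(** Both sides of the integration by parts formula for [eps > 0] converge by domination, and limits
    are unique. *)
Lemma weak_gradient_avg (v : 'rV[R]_n -> R) : (forall w, ~ E w -> v w = avg 0 w) ->
  is_weak_gradient B v (fun w => \row_i davg 0 (delta_mx 0 i) w).
Proof.
move=> vE; have mavg eps := measurable_avg eps; have mdavg eps h := measurable_davg eps h.
have avgoo : (\int[leb]_(w in B `\` E) (`|avg 0 w| `^ p)%:E < +oo)%E.
  apply: (le_lt_trans (integral_avg_powR_le leb e01)); apply: (lte_mul_pinfty _ _ M_fin); last by [].
  by rewrite lee_fin ltW// kconst_gt0.
have davgoo h : (\int[leb]_(w in B `\` E) (`|davg 0 h w| `^ p)%:E < +oo)%E.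
  apply: (le_lt_trans (integral_davg_powR_le leb h e01)); apply: (lte_mul_pinfty _ _ W_fin); last by [].
  by rewrite lee_fin mulr_ge0 ?powR_ge0// exprn_ge0// ltW// kconst_gt0.
split; first exact: (loc_integrable_off (mavg 0) vE avgoo).
move=> i; set h : 'rV[R]_n := delta_mx 0 i.
have gE w : (\row_i davg 0 (delta_mx 0 i) w) 0 i = davg 0 h w by rewrite mxE.
split.
  exact: (@loc_integrable_off (fun w => (\row_i0 davg 0 (delta_mx 0 i0) w) 0 i) (davg 0 h)
    (mdavg 0 h) (fun w _ => gE w) (davgoo h)).
move=> phi tphi; under [in RHS]eq_integral do rewrite gE.
have [cphi0 [K [cK KB phi0]]] := tphi.
have [cphi /(_ i)[dphi [cdphi _]]] := cphi0 1%N.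
have dphi0 := partial_eq0_off_compact i cK phi0.
have [C1 C10 phiC] := compactly_supported_bounded cphi cK phi0.
have [C2 C20 dphiC] := compactly_supported_bounded cdphi cK dphi0.
have mphi : measurable_fun [set: T] (phi : T -> R).
  exact: (continuous_measurable_cara (@lebesgue_coord_measurable R n) cphi).
have mdphi : measurable_fun [set: T] (partial i phi : T -> R).
  exact: (continuous_measurable_cara (@lebesgue_coord_measurable R n) cdphi).
(* For positive [eps] the average has bounded derivatives on all of [R^n], so [E] causes no boundary
   term. *)
have ibp j : (\int[leb]_(w in B) (avg (e_ j) w * partial i phi w)%:E =
    - \int[leb]_(w in B) (davg (e_ j) h w * phi w)%:E)%E.
  have diam y z : F y -> F z -> eudist (pt y) (pt z) <= 2 * r0.
    move=> Fy Fz; have H := E_half (FE Fy); apply: ltW; apply: ball_dist => //.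
    rewrite /B /eball/=; apply: lt_le_trans H _; rewrite ger_pMl//.
    by rewrite invf_le1// ler1n.
  have [A1 A1P] := kavg_bounded m mF mpt (e_gt0 j) nuF_gt0 diam iu.
  have [A2 A2P] := dkavg_bounded m mF mpt (e_gt0 j) nuF_gt0 diam iu h.
  have b1 w : `|avg (e_ j) w| <= Num.max A1 A2 by rewrite le_max A1P.
  have b2 w : `|davg (e_ j) h w| <= Num.max A1 A2 by rewrite le_max A2P orbT.
  have dv w : is_derive (0 : R) (1 : R) (along (avg (e_ j)) w i) (davg (e_ j) h w).
    exact: (is_derive_kavg m mF mpt (e_gt0 j) nuF_gt0 diam iu h w).
  have H := integral_mul_partial oB (mavg (e_ j)) (mdavg (e_ j) h) b1 b2 dv tphi.
  exact: H.
pose k1 := kconst m c; pose k2 := (m.*2%:R * eunorm h) `^ p * kconst m c ^+ 2.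
have k10 : 0 <= k1 by rewrite ltW// kconst_gt0.
have k20 : 0 <= k2 by rewrite mulr_ge0 ?powR_ge0// exprn_ge0// ltW// kconst_gt0.
have dom (Z : T -> \bar R) (k : R) : measurable_fun [set: T] Z -> (forall w, 0 <= Z w)%E -> 0 <= k ->
    (\int[leb]_(w in B `\` E) Z w < +oo)%E ->
    [/\ measurable_fun [set: T] (fun w => 1 + k%:E * Z w)%E,
        (forall w, 0 <= 1 + k%:E * Z w)%E &
        (\int[leb]_(w in B `\` E) (1 + k%:E * Z w) < +oo)%E].
  move=> mZ Z0 k0 Zoo; have mkZ : measurable_fun [set: T] (fun w => k%:E * Z w)%E by exact: measurable_funeM.
  have kZ0 w : (0 <= k%:E * Z w)%E by rewrite mule_ge0// lee_fin.
  split; first exact: (emeasurable_funD (measurable_cst _) mkZ).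
    by move=> w; rewrite adde_ge0.
  rewrite (ge0_integralD leb mD _ (measurable_cst _) _ (measurable_funTS mkZ))//.
  rewrite integral_cst; last exact: mD.
  rewrite mul1e (ge0_integralZl_EFin leb mD (fun w _ => Z0 w) (measurable_funTS mZ) k0).
  by apply: lte_add_pinfty; [exact: Doo|apply: lte_mul_pinfty].
have [mG1 G10 G1oo] := dom near_potential k1 measurable_near_potential M_ge0 k10 M_fin.
have [mG2 G20 G2oo] := dom pair_potential k2 measurable_pair_potential W_ge0 k20 W_fin.
(* The potentials bound [p]-th powers; adding 1, integrable over the bounded ball, gives a majorant
   of the functions themselves. *)
have le1 (a : R) (Z : \bar R) : ((`|a| `^ p)%:E <= Z)%E -> (`|a|%:E <= 1 + Z)%E.
  move=> aZ; apply: (@le_trans _ _ (1 + (`|a| `^ p)%:E)%E); last exact: leeD2l.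
  by rewrite -EFinD lee_fin; exact: norm_le_1powR.
have lim1 := @weak_cvg (fun j => avg (e_ j)) v (partial i phi) _ C2 (fun j => mavg (e_ j))
  (measurable_off_null (mavg 0) vE) mdphi C20 dphiC mG1 G10 G1oo.
have lim2 := @weak_cvg (fun j => davg (e_ j) h) (davg 0 h) phi _ C1 (fun j => mdavg (e_ j) h)
  (measurable_funTS (mdavg 0 h)) mphi C10 phiC mG2 G20 G2oo.
have {}lim1 := lim1 (fun w Dw => eq_ind_r (fun a => _ --> a) (avg_cvg Dw) (vE w Dw.2))
  (fun j w Dw => le1 _ _ (avg_powR_le (e_01 j) Dw)).
have {}lim2 := lim2 (fun w Dw => davg_cvg Dw) (fun j w Dw => le1 _ _ (davg_powR_le h (e_01 j) Dw)).
have {}lim2 := cvgeN lim2.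
have ibpE := funext ibp; rewrite ibpE in lim1.
exact: (cvg_unique (@ereal_hausdorff R) lim1 (lim2 _)).
Qed.

End extension_gradient.

Section extension_lipschitz.
Variables (A L : R).
Hypotheses (A_ge0 : 0 <= A) (L_ge0 : 0 <= L) (nuF_gt0 : (0 < nu F)%E).
Hypothesis upper_regular : forall y t, F y -> 0 < t ->
  (nu (F `&` [set z | (eudist (pt y) (pt z) < t)%R]) <= (A * t `^ Q)%:E)%E.
Hypothesis u_lip : forall y z, F y -> F z -> `|u y - u z| <= L * eudist (pt y) (pt z).

Let K0 := L * (1 + moment_const m Q c A).

Let rho_itv_pos eps w : 0 < eps <= 1 -> B w -> forall y, F y -> eps <= rho eps w (pt y) <= R1.
Proof.
move=> /andP[e0 e1] Bw y Fy; rewrite eps_le_rho rho_le_R1//.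
by rewrite (ltW e0).
Qed.

(** Mean value theorem on the segment from [w] to [w'], with the gradient bound that does not depend
    on [eps]. *)
Let avg_lip eps w w' : 0 < eps <= 1 -> B w -> B w' ->
  `|avg eps w' - avg eps w| <= m.*2%:R * eunorm (w' - w) * K0.
Proof.
move=> e01 Bw Bw'; have /andP[e0 e1] := e01; pose h := w' - w.
have diam y z : F y -> F z -> eudist (pt y) (pt z) <= 2 * r0.
  move=> Fy Fz; have H := E_half (FE Fy); apply: ltW; apply: ball_dist => //.
  rewrite /B /eball/=; apply: lt_le_trans H _; rewrite ger_pMl//.
  by rewrite invf_le1// ler1n.
have dv x := is_derive_kavg m mF mpt e0 nuF_gt0 diam iu h x.
have := dir_along_lipschitz (C := m.*2%:R * eunorm h * K0) dv (x := w) ltr01.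
rewrite scale1r /h [w + _]addrC subrK mulr1; apply => s /andP[s0 s1].
apply: (dkavg_lipschitz_le mF mpt c_gt0 p_gt1 Q_gt0 m_large lower_regular e0 F0 _ mu_ iu
  A_ge0 L_ge0 upper_regular u_lip) => y Fy.
apply: rho_itv_pos => //; rewrite /B /eball/= /eudist.
(* The convex combination shows that the segment stays in the ball, where the gradient bound is
   available. *)
have -> : x0 - (w + s *: (w' - w)) = (1 - s) *: (x0 - w) + s *: (x0 - w').
  by apply/rowP => i; rewrite !mxE; ring.
apply: (le_lt_trans (eunormD _ _)); rewrite !eunormZ ger0_norm ?subr_ge0// (ger0_norm s0).
have h1 : eunorm (x0 - w) < r0 := Bw; have h2 : eunorm (x0 - w') < r0 := Bw'.
have [->|sN0] := eqVneq s 0; first by rewrite mul0r addr0 subr0 mul1r.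
have sp : 0 < s by rewrite lt_neqAle eq_sym sN0.
have -> : r0 = (1 - s) * r0 + s * r0 by ring.
by rewrite ler_ltD ?ltr_pM2l// ler_wpM2l ?subr_ge0 ?(ltW h1).
Qed.

(** On all of [B], including [E], the function is a pointwise limit of the regularized averages,
    which share one Lipschitz constant. *)
Lemma extension_lipschitz (v : 'rV[R]_n -> R) :
  (forall w, ~ E w -> v w = avg 0 w) -> (forall y, F y -> v (pt y) = u y) ->
  (forall w, E w -> exists2 y, F y & w = pt y) -> lipschitz_fun B v.
Proof.
move=> vE vF EF.
have lim w : B w -> avg (e_ j) w @[j --> \oo] --> v w.
  move=> Bw; have [Ew|nEw] := pselect (E w); last by rewrite vE//; exact: avg_cvg.
  have [y Fy wy] := EF w Ew; rewrite wy vF//.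
  (* At a point of [E] its own [rho] equals [eps], so [kavg_lipschitz_le] becomes a bound of order
     [eps]. *)
  have close j : `|u y - avg (e_ j) (pt y)| <= K0 * e_ j.
    have Bpt : B (pt y) by rewrite -wy.
    have e01 : 0 < e_ j <= 1 by rewrite e_gt0; have /andP[] := e_01 j.
    have := kavg_lipschitz_le mF mpt c_gt0 p_gt1 Q_gt0 m_large lower_regular (e_gt0 j) F0
      (rho_itv_pos e01 Bpt) mu_ iu A_ge0 L_ge0 upper_regular u_lip Fy.
    by rewrite rho_refl// ltW.
  have K0e : K0 * e_ j @[j --> \oo] --> (0 : R).
    by rewrite -(mulr0 K0); apply: cvgM; [exact: cvg_cst|exact: e_cvg].
  have lo : u y - K0 * e_ j @[j --> \oo] --> u y.
    by rewrite -[X in _ --> X]subr0; apply: cvgB => //; exact: cvg_cst.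
  have hi : u y + K0 * e_ j @[j --> \oo] --> u y.
    by rewrite -[X in _ --> X]addr0; apply: cvgD => //; exact: cvg_cst.
  apply: (squeeze_cvgr _ lo hi); apply: nearW => j.
  by have := close j; rewrite distrC ler_distl.
exists (m.*2%:R * K0) => w w' Bw Bw'.
have lim_sub : `|avg (e_ j) w - avg (e_ j) w'| @[j --> \oo] --> `|v w - v w'|.
  by apply: cvg_norm; apply: cvgB; exact: lim.
rewrite -(cvg_lim (@Rhausdorff R) lim_sub); apply: limr_le.
  by apply/cvg_ex; exists (`|v w - v w'|).
apply: nearW => j; have e01 : 0 < e_ j <= 1 by rewrite e_gt0; have /andP[] := e_01 j.
by apply: (le_trans (avg_lip e01 Bw' Bw)); rewrite mulrAC.
Qed.

End extension_lipschitz.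

End kernel_extension.

Lemma poweR_scale_le (R : realType) (I J : \bar R) (C q : R) : 0 <= q -> 0 <= C ->
  (0 <= I)%E -> (0 <= J)%E -> (I <= C%:E * J)%E -> (I `^ q <= (C `^ q)%:E * J `^ q)%E.
Proof.
move=> q0 C0 I0 J0 IJ; rewrite -poweR_EFin -poweRM ?lee_fin//.
apply: gt0_ler_poweR => //; rewrite in_itv/= leey andbT//.
by rewrite mule_ge0// lee_fin.
Qed.

(** The norm is at most the sum of the coordinates, whence the factor [n]; positivity of [n]
    provides a coordinate that excludes a negative [Z]. *)
Lemma eunorm_powR_le (R : realType) (n : nat) (v : 'rV[R]_n) (p : R) (Z : \bar R) :
  (0 < n)%N -> 0 < p -> (forall i, (`|v 0 i| `^ p)%:E <= Z)%E ->
  ((eunorm v `^ p)%:E <= (n%:R `^ p)%:E * Z)%E.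
Proof.
move=> n0 p0; case: Z => [z| |] vZ; last 1 first.
- by have := vZ (Ordinal n0); rewrite leeNy_eq.
- have z0 : 0 <= z by rewrite -lee_fin (le_trans _ (vZ (Ordinal n0)))// lee_fin powR_ge0.
  have vz i : `|v 0 i| <= z `^ p^-1.
    have := vZ i; rewrite lee_fin => h.
    have -> : `|v 0 i| = (`|v 0 i| `^ p) `^ p^-1.
      by rewrite -powRrM mulfV ?gt_eqF// powRr1.
    by apply: ge0_ler_powR => //; rewrite ?nnegrE ?powR_ge0 ?invr_ge0 ?(ltW p0).
  rewrite -EFinM lee_fin.
  have -> : n%:R `^ p * z = (n%:R * z `^ p^-1) `^ p.
    by rewrite powRM ?powR_ge0// -powRrM mulVf ?gt_eqF// powRr1.
  apply: ge0_ler_powR; rewrite ?nnegrE ?eunorm_ge0 ?mulr_ge0 ?powR_ge0 ?(ltW p0)//.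
  apply: (le_trans (eunorm_le_sum v)).
  rewrite (@le_trans _ _ (\sum_(i < n) z `^ p^-1)) ?ler_sum//.
  by rewrite sumr_const card_ord mulr_natl.
- by rewrite mulry gtr0_sg ?mul1e ?leey// powR_gt0// ltr0n.
Qed.

Section lipschitz_measurable.
Context {R : realType} {n : nat} (H : {outer_measure set 'rV[R]_n -> \bar R}).
Hypothesis Hc : coord_measurable H.
Local Notation X := (caratheodory_type H).

(** On [E], the set where [u > a] is the trace of the open set of points [x] with
    [L |x - y| < u y - a] for some [y] in [E]. *)
Lemma lipschitz_measurable (E : set 'rV[R]_n) (u : 'rV[R]_n -> R) (L : R) : 0 < L ->
  measurable (E : set X) ->
  (forall y z, E y -> E z -> `|u y - u z| <= L * eudist y z) ->
  measurable_fun (E : set X) (u : X -> R).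
Proof.
move=> L0 mE lip; apply: (measurability _ (RGenOInfty.measurableE R)).
move=> _ [_ [a ->] <-].
pose U := [set x | exists y, E y /\ L * eudist x y < u y - a].
have oU : open U.
  apply/open_eballP => x [y [Ey xy]]; exists ((u y - a) / L - eudist x y).
    by rewrite subr_gt0 ltr_pdivlMr// mulrC.
  move=> z; rewrite /eball/= => xz; exists y; split => //.
  rewrite -ltr_pdivlMl// mulrC (le_lt_trans (eudist_triangle x z y))//.
  by rewrite eudistC -ltrBrDr.
suff -> : E `&` u @^-1` `]a, +oo[%classic = E `&` U.
  by apply: measurableI => //; exact: (open_measurable_cara Hc oU).
apply/seteqP; split => x [Ex]; rewrite /= in_itv/= andbT => h; split => //.
  by exists x; rewrite eudistxx mulr0 subr_gt0.
have [y [Ey xy]] := h.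
have := le_lt_trans (lip y x Ey Ex); rewrite (eudistC y x) => /(_ _ xy).
by move=> /(le_lt_trans (ler_norm _)); rewrite ltrD2l ltrN2.
Qed.

End lipschitz_measurable.

(** * The extension operator *)

Section besov_energy.
Context {R : realType} {n : nat}.
Variables (Q theta p A c : R) (E : set 'rV[R]_n).
Local Notation H := (hausdorff_on Q E).
Local Notation X := (caratheodory_type H).
Variable nu : {finite_measure set X -> \bar R}.
Hypothesis nuE : forall D : set X, measurable D -> nu D = H D.
Hypotheses (mE : measurable (E : set X)) (Q_gt0 : 0 < Q) (theta_gt0 : 0 < theta) (p_gt0 : 0 < p).
Hypotheses (A_ge0 : 0 <= A) (c_gt0 : 0 < c).
Hypothesis upper : forall y t, E y -> 0 < t -> (hausdorff Q (E `&` eball y t) <= (A * t `^ Q)%:E)%E.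
Hypothesis lower : forall y t, E y -> 0 < t <= fine (diam E) ->
  ((c * t `^ Q)%:E <= hausdorff Q (E `&` eball y t))%E.
Hypothesis le_diam : forall y z, E y -> E z -> eudist y z <= fine (diam E).

Lemma integral_nuE (D : set X) (f : X -> \bar R) : measurable D ->
  (\int[nu]_(y in D) f y = \int[cara_measure H]_(y in D) f y)%E.
Proof. by move=> mD; apply: eq_measure_integral => B mB _; exact: nuE. Qed.

(** Upper regularity bounds the mass of the ball in the denominator by [A] times the distance to the
    power [Q]; lower regularity makes it nonzero, so that its inverse is a real number. *)
Lemma besov_energy_ge (u : X -> R) :
  (\int[nu]_(y in E) \int[nu]_(z in E)
    (A^-1 * (`|u y - u z| `^ p * eudist y z `^ (- (theta * p + Q))))%:E <=
    besov_energy H theta p E u)%E.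
Proof.
rewrite integral_nuE//; apply: ge0_le_integral_sup => y Ey.
  by apply: integral_ge0 => z _; rewrite lee_fin !mulr_ge0 ?invr_ge0 ?powR_ge0.
rewrite integral_nuE//; apply: ge0_le_integral_sup => z Ez.
  by rewrite lee_fin !mulr_ge0 ?invr_ge0 ?powR_ge0.
have s0 : 0 < theta * p + Q by rewrite addr_gt0// mulr_gt0.
(* At distance 0 the convention that a nonzero power of 0 is 0, with inverse 0, makes the left side
   vanish. *)
have [yz0|yzN0] := eqVneq (eudist y z) 0.
  rewrite yz0 powRN powR0 ?gt_eqF// invr0 !mulr0; apply: mule_ge0.
    by rewrite lee_fin divr_ge0 ?powR_ge0.
  by rewrite inve_ge0 outer_measure_ge0.
have r0 : 0 < eudist y z by rewrite lt_neqAle eq_sym yzN0 eudist_ge0.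
have rd : 0 < eudist y z <= fine (diam E) by rewrite r0 le_diam.
have HB : H (eball y (eudist y z)) = hausdorff Q (E `&` eball y (eudist y z)).
  by rewrite /hausdorff_on setIC.
have lo := lower Ey rd; have up := upper Ey r0; rewrite -HB in lo up.
move: lo up; rewrite distrC; case hE: (H _) => [h| |] lo up; last 2 first.
- by move: up; rewrite leye_eq.
- by move: lo; rewrite leeNy_eq.
have cr : 0 < c * eudist y z `^ Q by rewrite mulr_gt0// powR_gt0.
rewrite lee_fin in lo; rewrite lee_fin in up.
have h0 := lt_le_trans cr lo.
rewrite [X in (_ <= _ / X)%E](_ : _ = h%:E); last exact: hE.
rewrite inver (gt_eqF h0) -EFinM lee_fin.
have rq : 0 < eudist y z `^ Q by exact: powR_gt0.
have A0 : 0 < A by have := lt_le_trans h0 up; rewrite pmulr_lgt0.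
apply: (@le_trans _ _ (`|u z - u y| `^ p / eudist y z `^ (theta * p) * (A * eudist y z `^ Q)^-1)).
  rewrite opprD powRD ?(gt_eqF r0) ?implybT// !powRN.
  by rewrite le_eqVlt; apply/orP; left; apply/eqP; field; rewrite !gt_eqF ?powR_gt0.
by rewrite ler_wpM2l ?divr_ge0 ?powR_ge0// lef_pV2 ?posrE ?mulr_gt0.
Qed.

End besov_energy.

Section extension_operator.
Context {R : realType} {n : nat}.
Variables (Q p theta N : R) (E : set 'rV[R]_n) (x0 : 'rV[R]_n) (r0 : R).
Local Notation leb := (lebesgue_measure_rV R n).
Local Notation T := (lebesgue_space R n).
Local Notation H := (hausdorff_on Q E).
Local Notation X := (caratheodory_type H).
Local Notation nu' := (cara_measure H).
Variables (mu : {measure set T -> \bar R}) (wt : T -> R).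
Hypotheses (Q_gt0 : 0 < Q) (Q_ltn : Q < n%:R) (cE : compact E).
Hypotheses (p_gt1 : 1 < p) (theta_gt0 : 0 < theta) (r0_gt0 : 0 < r0).
Hypothesis E_half : E `<=` eball x0 (2^-1 * r0).
Hypotheses (QN : Q < N) (theta_ge : p + 2 * Q <= theta * p + Q + N).
Hypothesis mu_density : has_density mu wt.
Hypothesis E0 : E !=set0.
Hypothesis hausdorff_fin : (hausdorff Q E < +oo)%E.
Variables (nu : {finite_measure set X -> \bar R}) (m : nat) (A c Amu Aleb : R).
Hypothesis nuE : forall D : set X, measurable D -> nu D = H D.
Hypotheses (A_gt0 : 0 < A) (c_gt0 : 0 < c) (Amu_ge0 : 0 <= Amu) (Aleb_ge0 : 0 <= Aleb).
Hypothesis m_large : 2 * Q + p <= m.*2%:R.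
Let R1 := 2 * r0 + 1.
Hypothesis diamE_le : fine (diam E) <= R1.
Hypothesis upper : forall y t, E y -> 0 < t -> (hausdorff Q (E `&` eball y t) <= (A * t `^ Q)%:E)%E.
Hypothesis lower : forall y t, E y -> 0 < t <= R1 ->
  ((c * t `^ Q)%:E <= hausdorff Q (E `&` eball y t))%E.
Hypothesis le_diam : forall y z, E y -> E z -> eudist y z <= fine (diam E).
Let B := eball x0 r0.
Hypothesis growth_mu : forall y (r : R), E y -> 0 < r ->
  (mu ((B `\` E) `&` [set w | (eudist w y < r)%R]) <= (Amu * r `^ N)%:E)%E.
Hypothesis growth_leb : forall y (r : R), E y -> 0 < r ->
  (leb ((B `\` E) `&` [set w | (eudist w y < r)%R]) <= (Aleb * r `^ N)%:E)%E.

Let p_gt0 : 0 < p. Proof. exact: lt_trans ltr01 p_gt1. Qed.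
Let Hc : coord_measurable H. Proof. by apply: hausdorff_on_coord_measurable; exact: ltW. Qed.
Let mEX : measurable (E : set X). Proof. exact: (compact_measurable_cara Hc cE). Qed.
Let closedE : closed E. Proof. by apply: compact_closed => //; exact: norm_hausdorff. Qed.
Let mET : measurable (E : set T). Proof. exact: lebesgue_closed_measurable. Qed.
Let mB : measurable (B : set T). Proof. by apply: lebesgue_open_measurable; exact: eball_open. Qed.
Let mD : measurable (B `\` E : set T). Proof. exact: measurableD. Qed.
Let leb_E : leb E = 0%E. Proof. exact: (hausdorff_lebesgue_null (ltW Q_gt0) Q_ltn hausdorff_fin). Qed.
Let mu_E : mu E = 0%E. Proof. exact: (density_null mu_density leb_E mET). Qed.

Let pt (y : X) : 'rV[R]_n := y.
Let mpt : measurable_coords [set: X] pt. Proof. by move=> i; exact: measurable_coord. Qed.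

Let measurable_EB y t : measurable (E `&` [set z : X | (eudist (pt y) (pt z) < t)%R] : set X).
Proof. by apply: (measurableI _ _ mEX); apply: (open_measurable_cara Hc); exact: eball_open. Qed.

Let nu_ball y t : nu (E `&` [set z : X | (eudist (pt y) (pt z) < t)%R]) = hausdorff Q (E `&` eball y t).
Proof. by rewrite nuE// /hausdorff_on setIAC setIid. Qed.

Let nu_lower y r : E y -> 0 < r <= R1 ->
  ((c * r `^ Q)%:E <= nu (E `&` [set z : X | (eudist (pt y) (pt z) < r)%R]))%E.
Proof. by rewrite nu_ball; exact: lower. Qed.

Let nu_upper y t : E y -> 0 < t ->
  (nu (E `&` [set z : X | (eudist (pt y) (pt z) < t)%R]) <= (A * t `^ Q)%:E)%E.
Proof. by rewrite nu_ball; exact: upper. Qed.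

Let R1_gt0 : 0 < R1. Proof. by rewrite addr_gt0// mulr_gt0. Qed.

Let nuE_gt0 : (0 < nu E)%E.
Proof.
have [y Ey] := E0; have h : 0 < R1 <= R1 by rewrite R1_gt0 lexx.
apply: (lt_le_trans _ (le_trans (nu_lower Ey h) _)).
  by rewrite lte_fin mulr_gt0 ?powR_gt0.
by apply: le_measure; rewrite ?inE//; exact: subIsetl.
Qed.

Let FE (y : X) : E y -> E (pt y). Proof. by []. Qed.

(* The values on [E] are kept, so that the extension of a Lipschitz function is
   an extension everywhere and not only almost everywhere. *)
Definition kernel_extension (u : 'rV[R]_n -> R) (x : 'rV[R]_n) : R :=
  if x \in E then u x else kavg nu E pt m 0 u x.

Local Notation S := kernel_extension.
(** Membership in the Besov space gives measurability on [E] only, while the kernel lemmas ask for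
    it on the whole space; extension by 0 supplies it without changing averages over [E]. *)
Let rE (u : 'rV[R]_n -> R) : X -> R := u \_ E.

Let kavg_restrict u eps x : kavg nu E pt m eps (rE u) x = kavg nu E pt m eps u x.
Proof. by apply: eq_Rintegral => y yE; rewrite /rE patchE yE. Qed.

Let S_off u w : ~ E w -> S u w = kavg nu E pt m 0 (rE u) w.
Proof. by move=> nEw; rewrite /kernel_extension memNset// kavg_restrict. Qed.

Let S_on u w : E w -> S u w = u w.
Proof. by move=> Ew; rewrite /kernel_extension mem_set. Qed.

Let nuE_fin : (nu E < +oo)%E. Proof. by rewrite ltey_eq fin_num_measure. Qed.

Let besov_measurable u : besov H theta p E u ->
  [/\ measurable_fun [set: X] (rE u), nu.-integrable (E : set X) (EFin \o rE u),
      (\int[nu]_(y in E) (`|rE u y| `^ p)%:E < +oo)%E &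
      Lp_norm nu' p E u = ((\int[nu]_(y in E) (`|rE u y| `^ p)%:E) `^ p^-1)%E].
Proof.
move=> [/(Lp_onP _ _ p_gt0 mEX)[mu_ uoo] _].
have IE : (\int[nu]_(y in E) (`|rE u y| `^ p)%:E = \int[nu']_(y in E) (`|u y| `^ p)%:E)%E.
  rewrite (integral_nuE nuE _ mEX); apply: eq_integral => y yE.
  by rewrite /rE patchE yE.
have mr : measurable_fun [set: X] (rE u) by exact/(measurable_restrictT _ mEX).
have Ioo : (\int[nu]_(y in E) (`|rE u y| `^ p)%:E < +oo)%E by rewrite IE.
split => //; last by rewrite (Lp_normE _ _ _ p_gt0) IE.
apply/integrableP; split; first exact/measurable_EFinP/(measurable_funTS mr).
exact: (integral_norm_lty p_gt1 mEX nuE_fin (measurable_funTS mr) Ioo).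
Qed.

Let energy u : \bar R := (\int[nu]_(y in E) \int[nu]_(z in E)
  (`|rE u y - rE u z| `^ p * eudist (pt y) (pt z) `^ (- (theta * p + Q)))%:E)%E.

Let energy_ge0 u : (0 <= energy u)%E.
Proof. by do 2 (apply: integral_ge0 => ? _); rewrite lee_fin mulr_ge0 ?powR_ge0. Qed.

Let energy_le u : measurable_fun [set: X] (rE u) -> (energy u <= A%:E * besov_energy H theta p E u)%E.
Proof.
move=> mr; have low y t : E y -> 0 < t <= fine (diam E) ->
    ((c * t `^ Q)%:E <= hausdorff Q (E `&` eball y t))%E.
  by move=> Ey /andP[t0 td]; apply: lower => //; rewrite t0 (le_trans td).
have Hge := besov_energy_ge nuE mEX Q_gt0 theta_gt0 p_gt0 (ltW A_gt0) c_gt0 upper low le_diam u.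
pose f (z : X * X) : \bar R :=
  (`|rE u z.1 - rE u z.2| `^ p * eudist (pt z.1) (pt z.2) `^ (- (theta * p + Q)))%:E.
have f0 z : (0 <= f z)%E by rewrite lee_fin mulr_ge0 ?powR_ge0.
have mf : measurable_fun [set: X * X] f.
  apply/measurable_EFinP; apply: measurable_funM.
    apply: (measurableT_comp (measurable_powR _)).
    apply: (measurableT_comp (@normr_measurable R setT)).
    apply: measurable_funB; first exact: (measurableT_comp mr measurable_fst).
    exact: (measurableT_comp mr measurable_snd).
  apply: (measurableT_comp (measurable_powR _)).
  exact: (measurable_eudist (measurable_coords_fst mpt) (measurable_coords_snd mpt)).
have mI := measurable_section_integral_ge0 nu mEX mf f0.
have I0 y : (0 <= \int[nu]_(z in E) f (y, z))%E by apply: integral_ge0 => z _.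
have AV0 : 0 <= A^-1 by rewrite invr_ge0 ltW.
have AI : (A^-1%:E * energy u <= besov_energy H theta p E u)%E.
  rewrite -(ge0_integralZl_EFin nu mEX (fun y _ => I0 y) (measurable_funTS mI) AV0).
  apply: le_trans Hge; rewrite le_eqVlt; apply/orP; left; apply/eqP.
  apply: eq_integral => y yE.
  have mfy : measurable_fun [set: X] (fun z => f (y, z)).
    exact: (measurableT_comp mf (measurable_pair1 y)).
  rewrite -(ge0_integralZl_EFin nu mEX (fun z _ => f0 (y, z)) (measurable_funTS mfy) AV0).
  by apply: eq_integral => z zE; rewrite /f /rE /= !patchE yE zE -EFinM.
by rewrite -lee_pdivrMl.
Qed.

Let u_diag u (y z : X) : E y -> E z -> eudist (pt y) (pt z) = 0 -> rE u y = rE u z.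
Proof. by move=> _ _ /eudist_eq0 yz; have -> : y = z := yz. Qed.

Let e01 : 0 <= (0 : R) <= 1. Proof. by rewrite lexx ler01. Qed.

Let k1 := kconst m c.
Let k2 := (m.*2%:R : R) `^ p * kconst m c ^+ 2.
Let k1_ge0 : 0 <= k1. Proof. by rewrite ltW// kconst_gt0. Qed.
Let k2_ge0 : 0 <= k2. Proof. by rewrite mulr_ge0 ?powR_ge0// exprn_ge0. Qed.

Let powRV2 s : 0 < s -> 0 <= 1 - 2 `^ (- s) :> R.
Proof. by move=> /powR2N_itv/andP[_ h]; rewrite subr_ge0 ltW. Qed.

Let near_ge0 a : 0 <= a -> 0 <= near_const a N Q (2 * r0).
Proof.
move=> a0; rewrite mulr_ge0 ?powR_ge0// divr_ge0 ?mulr_ge0 ?powR_ge0// powRV2//.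
by rewrite subr_gt0.
Qed.

Let far_ge0 a : 0 <= a -> 0 <= far_const a N Q p (2 * r0) theta.
Proof.
move=> a0; rewrite mulr_ge0 ?powR_ge0// mulr_ge0// mulr_ge0 ?powR_ge0//.
rewrite divr_ge0 ?mulr_ge0 ?powR_ge0// powRV2//.
by rewrite addr_gt0// mulr_gt0.
Qed.

Let grad u (w : 'rV[R]_n) : 'rV[R]_n := \row_i dkavg nu E pt m 0 (delta_mx 0 i) (rE u) w.

(** * Bounds for a measure of growth [N], applied to [mu] and to Lebesgue measure *)

Section one_measure.
Variables (lam : {measure set T -> \bar R}) (a : R).
Hypotheses (a_ge0 : 0 <= a) (lamB : (lam B < +oo)%E).
Hypothesis growth : forall y (r : R), E y -> 0 < r ->
  (lam ((B `\` E) `&` [set w | (eudist w y < r)%R]) <= (a * r `^ N)%:E)%E.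
Variable u : 'rV[R]_n -> R.
Hypothesis bu : besov H theta p E u.

Let near_le : (\int[lam]_(w in B `\` E) near_potential nu E pt Q p (rE u) w <=
  (near_const a N Q (2 * r0))%:E * \int[nu]_(y in E) (`|rE u y| `^ p)%:E)%E.
Proof.
have [mr _ _ _] := besov_measurable bu.
exact: (integral_near_potential_le nu p mEX mpt Q_gt0 r0_gt0 FE E_half mr mET lamB a_ge0 QN growth).
Qed.

Let pair_le : (\int[lam]_(w in B `\` E) pair_potential nu E pt Q p (rE u) w <=
  (far_const a N Q p (2 * r0) theta)%:E * (A%:E * besov_energy H theta p E u))%E.
Proof.
have [mr _ _ _] := besov_measurable bu.
apply: (le_trans (integral_pair_potential_le nu mEX mpt p_gt1 Q_gt0 r0_gt0 FE E_half mr mET lamB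
  a_ge0 QN growth theta_gt0 theta_ge (@u_diag u))).
by apply: lee_wpmul2l; rewrite ?lee_fin ?far_ge0//; exact: energy_le.
Qed.

Lemma near_potential_fin : (\int[lam]_(w in B `\` E) near_potential nu E pt Q p (rE u) w < +oo)%E.
Proof.
have [_ _ uoo _] := besov_measurable bu.
by apply: (le_lt_trans near_le); apply: lte_mul_pinfty => //; rewrite lee_fin near_ge0.
Qed.

Lemma pair_potential_fin : (\int[lam]_(w in B `\` E) pair_potential nu E pt Q p (rE u) w < +oo)%E.
Proof.
apply: (le_lt_trans pair_le); apply: lte_mul_pinfty => //; first by rewrite lee_fin far_ge0.
by apply: lte_mul_pinfty => //; [rewrite lee_fin ltW|case: bu].
Qed.

Lemma integral_extension_le :
  (\int[lam]_(w in B `\` E) (`|kavg nu E pt m 0 (rE u) w| `^ p)%:E <=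
   (k1 * near_const a N Q (2 * r0))%:E * \int[nu]_(y in E) (`|rE u y| `^ p)%:E)%E.
Proof.
have [mr ir _ _] := besov_measurable bu.
apply: (le_trans (integral_avg_powR_le m mEX mpt c_gt0 p_gt1 Q_gt0 r0_gt0 nu_lower closedE FE E0 E_half
  mr ir lam e01)).
have k1_ge0' : (0 <= k1%:E)%E by rewrite lee_fin.
by apply: (le_trans (lee_wpmul2l k1_ge0' near_le)); rewrite muleA -EFinM.
Qed.

Lemma integral_gradient_le :
  (\int[lam]_(w in B `\` E) (eunorm (grad u w) `^ p)%:E <=
   (n%:R `^ p * k2 * far_const a N Q p (2 * r0) theta * A)%:E * besov_energy H theta p E u)%E.
Proof.
have [mr ir _ _] := besov_measurable bu.
have n0 : (0 < n)%N by rewrite -(ltr0n R) (lt_trans Q_gt0).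
have nk0 : 0 <= n%:R `^ p * k2 by rewrite mulr_ge0 ?powR_ge0.
apply: (@le_trans _ _ ((n%:R `^ p * k2)%:E *
    \int[lam]_(w in B `\` E) pair_potential nu E pt Q p (rE u) w)%E); last first.
  have nk0' : (0 <= (n%:R `^ p * k2)%:E)%E by rewrite lee_fin.
  have h := lee_wpmul2l nk0' pair_le.
  by apply: (le_trans h); rewrite muleA muleA -!EFinM.
have mpp := measurable_pair_potential nu Q p mEX mpt mr.
have pp0 w : (0 <= pair_potential nu E pt Q p (rE u) w)%E.
  by do 2 (apply: integral_ge0 => ? _); rewrite lee_fin mulr_ge0 ?powR_ge0.
rewrite -(ge0_integralZl_EFin lam mD (fun w _ => pp0 w) (measurable_funTS mpp) nk0).
apply: ge0_le_integral_sup => w Dw; first by rewrite lee_fin powR_ge0.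
rewrite [X in (_ <= X * _)%E]EFinM -muleA; apply: (eunorm_powR_le n0 p_gt0) => i.
rewrite mxE; have := davg_powR_le mEX mpt c_gt0 p_gt1 Q_gt0 r0_gt0 m_large nu_lower closedE FE E0 E_half
  mr ir (delta_mx 0 i) e01 Dw.
by rewrite eunorm_delta mulr1.
Qed.

End one_measure.

Let mu_ae (P : T -> Prop) : {ae leb, forall x, P x} -> {ae mu, forall x, P x}.
Proof. by move=> [Z [mZ Z0 sub]]; exists Z; split => //; exact: (density_null mu_density Z0 mZ). Qed.

Let muB_fin : (mu B < +oo)%E. Proof. exact: (density_eball_fin _ _ mu_density). Qed.
Let lebB_fin : (leb B < +oo)%E. Proof. exact: lebesgue_eball_fin. Qed.

Let mu_off_E (f : T -> \bar R) : measurable_fun (B : set T) f -> (forall w, 0 <= f w)%E ->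
  (\int[mu]_(w in B) f w = \int[mu]_(w in B `\` E) f w)%E.
Proof. by move=> mf f0; apply: (ge0_negligible_integral mET mB mf _ mu_E) => w _; exact: f0. Qed.

Let mpowR (f : T -> R) : measurable_fun (B : set T) f ->
  measurable_fun (B : set T) (fun w => (`|f w| `^ p)%:E).
Proof.
move=> mf; apply/measurable_EFinP; apply: (measurableT_comp (measurable_powR _)).
exact: (measurableT_comp (@normr_measurable R setT) mf).
Qed.

Let meunorm (D : set T) (g : T -> 'rV[R]_n) : measurable_coords D g ->
  measurable_fun D (eunorm \o g).
Proof.
move=> mg; have := measurable_eudist mg (measurable_coords_cst (0 : 'rV[R]_n)).
by congr measurable_fun; apply/funext => w; rewrite /eudist subr0.
Qed.

Let C1 := (k1 * near_const Amu N Q (2 * r0)) `^ p^-1.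
Let C2 := (n%:R `^ p * k2 * far_const Amu N Q p (2 * r0) theta * A) `^ p^-1.

Lemma extension_sobolev : exists2 C, 0 <= C & forall u, besov H theta p E u ->
  sobolev mu p B (S u) /\
  (sobolev_norm mu p B (S u) <= C%:E * Lp_besov_norm H theta p E u)%E.
Proof.
exists (C1 + C2) => [|u bu]; first by rewrite addr_ge0 ?powR_ge0.
 have [mr ir uoo uE] := besov_measurable bu.
have mavg := measurable_avg nu m mEX mpt mr 0.
have mS : measurable_fun (B : set T) (S u : T -> R).
  exact: (measurable_off_null closedE leb_E mavg (@S_off u)).
have pV : 0 <= p^-1 by rewrite invr_ge0 ltW.
(* Finiteness for Lebesgue measure yields the weak gradient; [mu] enters in the norm estimates
   below. *)
have Mfin := near_potential_fin Aleb_ge0 lebB_fin growth_leb bu.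
have Wfin := pair_potential_fin Aleb_ge0 lebB_fin growth_leb bu.
have wgS : is_weak_gradient B (S u) (grad u).
  exact: (weak_gradient_avg mEX mpt c_gt0 p_gt1 Q_gt0 r0_gt0 m_large nu_lower closedE FE E0 E_half
    mr ir leb_E Mfin Wfin nuE_gt0 (@S_off u)).
have exg : exists g, is_weak_gradient B (S u) g by exists (grad u).
have wgx : is_weak_gradient B (S u) (weak_gradient B (S u)).
  by rewrite /weak_gradient; have := xgetPex (fun=> 0) exg.
(* The gradient in the norm is an arbitrary choice; uniqueness identifies it with [grad u] Lebesgue
   almost everywhere, and absolute continuity transfers this to [mu]. *)
have wg_ae := weak_gradient_unique (@eball_open R n x0 r0) wgx wgS.
have mwg : measurable_fun (B : set T) (eunorm \o weak_gradient B (S u)).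
  by apply: meunorm => i; have [_ /(_ i)[[]]] := wgx.
have mgrad : measurable_fun (B : set T) (eunorm \o grad u).
  by apply: meunorm => i; have [_ /(_ i)[[]]] := wgS.
have wg_mu : {ae mu, forall x, B x ->
    (eunorm \o weak_gradient B (S u)) x = (eunorm \o grad u) x}.
  by apply: ae_imply (mu_ae wg_ae) => x h Bx; rewrite /= h.
have ISE : (\int[mu]_(w in B) (`|S u w| `^ p)%:E <=
    (k1 * near_const Amu N Q (2 * r0))%:E * \int[nu]_(y in E) (`|rE u y| `^ p)%:E)%E.
  rewrite (mu_off_E (mpowR mS)); last by move=> w; rewrite lee_fin powR_ge0.
  apply: le_trans (integral_extension_le Amu_ge0 muB_fin growth_mu bu).
  rewrite le_eqVlt; apply/orP; left; apply/eqP; apply: eq_integral => w.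
  by rewrite inE => -[_ nEw]; rewrite S_off.
have IgE : (\int[mu]_(w in B) (`|(eunorm \o grad u) w| `^ p)%:E <=
    (n%:R `^ p * k2 * far_const Amu N Q p (2 * r0) theta * A)%:E * besov_energy H theta p E u)%E.
  rewrite (mu_off_E (mpowR mgrad)); last by move=> w; rewrite lee_fin powR_ge0.
  apply: le_trans (integral_gradient_le Amu_ge0 muB_fin growth_mu bu).
  rewrite le_eqVlt; apply/orP; left; apply/eqP; apply: eq_integral => w _.
  by rewrite /= ger0_norm ?eunorm_ge0.
have c10 : 0 <= k1 * near_const Amu N Q (2 * r0) by exact: (mulr_ge0 k1_ge0 (near_ge0 Amu_ge0)).
have c20 : 0 <= n%:R `^ p * k2 * far_const Amu N Q p (2 * r0) theta * A.
  exact: (mulr_ge0 (mulr_ge0 (mulr_ge0 (powR_ge0 _ _) k2_ge0) (far_ge0 Amu_ge0)) (ltW A_gt0)).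
have I0 : (0 <= \int[nu]_(y in E) (`|rE u y| `^ p)%:E)%E.
  by apply: integral_ge0 => y _; rewrite lee_fin powR_ge0.
have J0 : (0 <= besov_energy H theta p E u)%E.
  apply: integral_ge0 => y _; apply: integral_ge0 => z _; apply: mule_ge0.
    by rewrite lee_fin divr_ge0 ?powR_ge0.
  by rewrite inve_ge0 outer_measure_ge0.
have pos (D : set T) (f : T -> R) : (0 <= \int[mu]_(w in D) (`|f w| `^ p)%:E)%E.
  by apply: integral_ge0 => w _; rewrite lee_fin powR_ge0.
have norm_wg := Lp_norm_ae_eq p_gt0 mB mwg mgrad wg_mu.
have N1 : (Lp_norm mu p B (S u) <= C1%:E * Lp_norm nu' p E u)%E.
  by rewrite (Lp_normE _ _ _ p_gt0) uE; exact: (poweR_scale_le pV c10 (pos _ _) I0 ISE).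
have N2 : (Lp_norm mu p B (eunorm \o weak_gradient B (S u)) <= C2%:E * besov_norm H theta p E u)%E.
  by rewrite norm_wg (Lp_normE _ _ _ p_gt0); exact: (poweR_scale_le pV c20 (pos _ _) J0 IgE).
split.
  split; [|exact: exg|].
    apply/(Lp_onP _ _ p_gt0 mB); split; first exact: mS.
    apply: (le_lt_trans ISE); apply: (lte_mul_pinfty _ _ uoo); last by [].
    by rewrite lee_fin.
  have h : (\int[mu]_(w in B) (`|(eunorm \o weak_gradient B (S u)) w| `^ p)%:E =
      \int[mu]_(w in B) (`|(eunorm \o grad u) w| `^ p)%:E)%E.
    apply: ae_eq_integral; [exact: mB|exact: mpowR|exact: mpowR|].
    by apply: ae_imply wg_mu => w e Bw; rewrite e.
  apply/(Lp_onP _ _ p_gt0 mB); split; first exact: mwg.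
  rewrite h; apply: (le_lt_trans IgE); apply: (lte_mul_pinfty _ _ bu.2); last by [].
  by rewrite lee_fin.
have L0 : (0 <= Lp_norm nu' p E u)%E by rewrite (Lp_normE _ _ _ p_gt0) poweR_ge0.
have B0 : (0 <= besov_norm H theta p E u)%E by exact: poweR_ge0.
rewrite /sobolev_norm /Lp_besov_norm EFinD.
rewrite ge0_muleDl ?lee_fin ?powR_ge0//.
have C10 : (0 <= C1%:E)%E by rewrite lee_fin powR_ge0.
have C20 : (0 <= C2%:E)%E by rewrite lee_fin powR_ge0.
apply: leeD.
  by apply: (le_trans N1); apply: lee_wpmul2l => //; rewrite leeDl.
by apply: (le_trans N2); apply: lee_wpmul2l => //; rewrite leeDr.
Qed.

(** Off [E] the kernel is bounded on [E], so the integrals converge and are additive; the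
    normalizing mass does not depend on [u]. *)
Lemma extension_linear a u v x : besov H theta p E u -> besov H theta p E v ->
  S (fun y => a * u y + v y) x = a * S u x + S v x.
Proof.
move=> bu bv; have [Ex|nEx] := pselect (E x); first by rewrite !S_on.
have [mru iru _ _] := besov_measurable bu; have [mrv irv _ _] := besov_measurable bv.
rewrite !S_off//.
have [delta d0 dle] := off_closed_dist closedE FE nEx.
have M0 y : E y -> `|ker m 0 x (pt y)| <= (delta ^+ 2)^-1 ^+ m.
  move=> Ey; have ry : 0 < rho 0 x (pt y) by rewrite rho0E (lt_le_trans d0)// dle.
  rewrite ger0_norm ?ker_ge0//; apply: lerXn2r.
  - by rewrite nnegrE invr_ge0 rho2_ge0.
  - by rewrite nnegrE invr_ge0 sqr_ge0.
  rewrite -sqr_rho lef_pV2 ?posrE ?exprn_gt0//.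
  by rewrite lerXn2r ?nnegrE ?(ltW d0) ?rho_ge0// rho0E dle.
have mk : measurable_fun (E : set X) (fun y => ker m 0 x (pt y)).
  exact: (measurable_funTS (measurable_ker _ _ (measurable_coords_cst x) mpt)).
have iu := integrable_mul_bounded mEX iru mk M0.
have iv := integrable_mul_bounded mEX irv mk M0.
have iau : nu.-integrable (E : set X) (EFin \o (fun y => a * (rE u y * ker m 0 x (pt y)))).
  by apply: eq_integrable (integrableZl mEX a iu) => // y _; rewrite /= EFinM.
have E1 : \int[nu]_(y in E) (rE (fun y => a * u y + v y) y * ker m 0 x (pt y)) =
    a * \int[nu]_(y in E) (rE u y * ker m 0 x (pt y)) +
    \int[nu]_(y in E) (rE v y * ker m 0 x (pt y)).
  rewrite -RintegralZl// -RintegralD//; apply: eq_Rintegral => y yE.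
  by rewrite /rE !patchE yE mulrDl mulrA.
have iuv : nu.-integrable (E : set X)
    (EFin \o (fun y => rE (fun y => a * u y + v y) y * ker m 0 x (pt y))).
  apply: eq_integrable (integrableD mEX iau iv) => // y yE.
  by rewrite /= -EFinD /rE !patchE yE mulrDl mulrA.
by rewrite !kavg_dominated// E1 mulrDl mulrA.
Qed.

Lemma extension_lipschitz_fun u : lipschitz_fun E u ->
  lipschitz_fun B (S u) /\ forall x, E x -> S u x = u x.
Proof.
move=> [L0 uL]; split; last by move=> x; exact: S_on.
(* The constant supplied by [lipschitz_fun] may fail to be positive, while [lipschitz_measurable]
   divides by it. *)
pose L := Num.max L0 1.
have L1 : 1 <= L by rewrite le_max lexx orbT.
have Lp : 0 < L by exact: lt_le_trans L1.
have lip y z : E y -> E z -> `|u y - u z| <= L * eudist y z.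
  move=> Ey Ez; apply: (le_trans (uL y z Ey Ez)); apply: ler_wpM2r; first exact: eudist_ge0.
  by rewrite le_max lexx.
have mr : measurable_fun [set: X] (rE u).
  by apply/(measurable_restrictT _ mEX); exact: (lipschitz_measurable Hc Lp mEX lip).
have [y0 Ey0] := E0.
pose M := `|u y0| + L * R1.
have uM y : E y -> `|rE u y| <= M.
  move=> Ey; rewrite /rE patchE mem_set// -(subrK (u y0) (u y)).
  apply: (le_trans (ler_normD _ _)); rewrite addrC lerD2l.
  apply: (le_trans (lip _ _ Ey Ey0)); apply: ler_wpM2l; first exact: ltW.
  exact: le_trans (le_diam Ey Ey0) diamE_le.
have ir : nu.-integrable (E : set X) (EFin \o rE u).
  apply: (le_integrable mEX _ _ (finite_measure_integrable_cst nu M mEX)).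
    exact/measurable_EFinP/(measurable_funTS mr).
  by move=> y Ey; rewrite /= lee_fin (le_trans (uM y Ey))// ler_norm.
have lipE (y z : X) : E y -> E z -> `|rE u y - rE u z| <= L * eudist (pt y) (pt z).
  by move=> Ey Ez; rewrite /rE !patchE !mem_set//; exact: lip.
apply: (extension_lipschitz mEX mpt c_gt0 p_gt1 Q_gt0 r0_gt0 m_large nu_lower closedE FE E0 E_half
  mr ir (ltW A_gt0) (ltW Lp) nuE_gt0 nu_upper lipE (@S_off u)).
- by move=> y Ey; rewrite S_on// /rE patchE mem_set.
- by move=> x Ex; exists x.
Qed.

End extension_operator.

Unset Implicit Arguments.

(* The elements of the function spaces are represented by functions on R^n, of
   which only the values on E, resp. on B, matter.  Linearity and boundedness
   imply that S respects almost everywhere equality.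
   A one-point E satisfies the regularity condition vacuously, but then
   hausdorff_on Q E = 0 and no such S exists: hence 0 < diam E. *)
Theorem theorem1p2 (R : realType) (n : nat) (Q p theta alpha : R)
  (E B : set 'rV[R]_n) (x0 : 'rV[R]_n) (r0 : R)
  (mu : {measure set (lebesgue_space R n) -> \bar R})
  (w : lebesgue_space R n -> R)
  (Q_gt0 : 0 < Q) (Q_ltn : Q < n%:R)
  (cE : compact E) (regE : ahlfors_regular Q E)
  (diamE_gt0 : (0 < diam E)%E) (diamE_le1 : (diam E <= 1)%E)
  (r0_gt0 : 0 < r0) (B_ball : B = eball x0 r0)
  (E_halfB : E `<=` eball x0 (2^-1 * r0))
  (p_gt1 : 1 < p) (theta_gt0 : 0 < theta) (theta_lt1 : theta < 1)
  (alpha_le0 : alpha <= 0) (codim_gt0 : 0 < alpha + n%:R - Q)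
  (theta_ge : 1 - (alpha + n%:R - Q) / p <= theta)
  (mu_density : has_density mu w) (mu_doubling : doubling_on B mu)
  (mu_growth : ball_growth E mu (n%:R + alpha)) :
  exists S : ('rV[R]_n -> R) -> ('rV[R]_n -> R),
    [/\ forall u, besov (hausdorff_on Q E) theta p E u -> sobolev mu p B (S u),
        forall (a : R) u v,
          besov (hausdorff_on Q E) theta p E u ->
          besov (hausdorff_on Q E) theta p E v ->
          {ae mu, forall x, B x ->
            S (fun y => a * u y + v y) x = a * S u x + S v x},
        exists2 C : R, 0 <= C &
          forall u, besov (hausdorff_on Q E) theta p E u ->
            (sobolev_norm mu p B (S u) <=
              C%:E * Lp_besov_norm (hausdorff_on Q E) theta p E u)%E &
        forall u, lipschitz_fun E u ->
          lipschitz_fun B (S u) /\ forall x, E x -> S u x = u x].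
Proof.
subst B; pose N := n%:R + alpha.
have p0 : 0 < p by exact: lt_trans p_gt1.
have QN : Q < N by rewrite -subr_gt0 /N [n%:R + alpha]addrC.
have N0 : 0 < N by exact: lt_trans QN.
have Nn : N <= n%:R by rewrite /N gerDl.
(* Clearing the denominator [p] turns the condition on [theta] into the comparison of exponents
   behind [far_const]. *)
have th : p + 2 * Q <= theta * p + Q + N.
  have := ler_wpM2r (ltW p0) theta_ge; rewrite mulrBl mul1r divfK ?gt_eqF// => h.
  by rewrite /N; lra.
have mET : measurable (E : set (lebesgue_space R n)).
  by apply: lebesgue_closed_measurable; apply: compact_closed => //; exact: norm_hausdorff.
have Efin := hausdorff_compact_fin cE regE diamE_gt0 diamE_le1.
have E0 := nonempty_of_diam diamE_gt0.
have dle := diam_eudist_le diamE_gt0 diamE_le1.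
have dR : fine (diam E) <= 2 * r0 + 1.
  rewrite -lee_fin fineK; last by rewrite ge0_fin_numE ?(ltW diamE_gt0)// (le_lt_trans diamE_le1)// ltry.
  by apply: (le_trans diamE_le1); rewrite lee_fin lerDr mulr_ge0// ltW.
have [A A0 upper] := hausdorff_upper_regular Q_gt0 cE regE diamE_gt0 diamE_le1.
have [c c0 lower] := hausdorff_lower_regular Q_gt0 regE diamE_gt0 diamE_le1 dR.
have [Amu Amu0 growth_mu] := density_growth x0 r0 mET mu_density N0 mu_growth.
have [Aleb Aleb0 growth_leb] := lebesgue_growth x0 r0 mET N0 Nn.
(* The truncation plus 1 already exceeds [2 * Q + p], so its double does too. *)
pose m := (Num.truncn (2 * Q + p)).+1.
have mQ : 2 * Q + p <= m.*2%:R.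
  rewrite (le_trans (ltW (truncnS_gt _)))// ler_nat -addnn leq_addr//.
have nufin : (cara_measure (hausdorff_on Q E) [set: caratheodory_type (hausdorff_on Q E)] < +oo)%E.
  by rewrite /cara_measure /= /hausdorff_on setTI.
(* Restriction to the full set changes no value; it packages the Hausdorff measure on [E] as a
   finite measure. *)
pose nu : {finite_measure set (caratheodory_type (hausdorff_on Q E)) -> \bar R} :=
  mfrestr measurableT nufin.
have nuE D : measurable D -> nu D = hausdorff_on Q E D.
  by move=> _; rewrite /nu /= /mfrestr /mrestr setIT.
(* The upper constant is only known to be nonnegative, and the energy comparison divides by it. *)
have A1 : 0 < A + 1 by rewrite ltr_wpDl.
have upper1 y t : E y -> 0 < t -> (hausdorff Q (E `&` eball y t) <= ((A + 1) * t `^ Q)%:E)%E.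
  move=> Ey t0; apply: (le_trans (upper y t Ey t0)).
  by rewrite lee_fin ler_wpM2r ?powR_ge0// lerDl.
have [C C0 ext] := extension_sobolev Q_gt0 Q_ltn cE p_gt1 theta_gt0 r0_gt0 E_halfB QN th mu_density E0
  Efin nuE A1 c0 Amu0 Aleb0 mQ dR upper1 lower dle growth_mu growth_leb.
exists (kernel_extension nu m); split.
- by move=> u /ext[].
- move=> a u v bu bv; apply: aeW => x _.
  exact: (extension_linear Q_gt0 cE p_gt1 m nuE a x bu bv).
- by exists C => // u /ext[].
- move=> u lu; exact: (extension_lipschitz_fun Q_gt0 cE p_gt1 r0_gt0 E_halfB E0 nuE A1 c0 mQ dR upper1 lower dle lu).
Qed.
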